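(* Let $\alpha\in(0,2)$, let $\Omega=(a_x,b_x)\times(a_y,b_y)\subset\mathbb{R}^2$ be a bounded rectangle, and let $u:\mathbb{R}^2\to\mathbb{R}$ satisfy $u=0$ on $\mathbb{R}^2\setminus\Omega$. Let $0<\varepsilon\le 1+\lfloor\alpha\rfloor-\alpha$ and assume $u\in C^{2+\lfloor\alpha\rfloor,\,\alpha-\lfloor\alpha\rfloor+\varepsilon}(\mathbb{R}^2)$. Then with splitting parameter $\gamma=2$ there is a constant $C>0$ independent of $h$ such that, for all sufficiently small $h=L/N$, $$\sup_{\mathbf{x}\in\Omega}\big|(-\Delta)^{\alpha/2}u(\mathbf{x})-(-\Delta)^{\alpha/2}_{h,2}u(\mathbf{x})\big|\le C h^{2}.$$
   Context: $\lfloor\cdot\rfloor$ is the floor function. For $k\in\mathbb{N}_0$, $s\in(0,1]$, $C^{k,s}(\mathbb{R}^d)$ is the space of functions $\mathbb{R}^d\to\mathbb{R}$ with continuous partial derivatives of all orders $\le k$ whose $k$-th order partial derivatives are uniformly Hölder continuous with exponent $s$. The fractional Laplacian is $(-\Delta)^{\alpha/2}u(\mathbf{x})=c_{d,\alpha}\,\mathrm{P.V.}\int_{\mathbb{R}^d}\frac{u(\mathbf{x})-u(\mathbf{x}')}{|\mathbf{x}-\mathbf{x}'|^{d+\alpha}}\,d\mathbf{x}'$ with $c_{d,\alpha}=\frac{2^{\alpha-1}\alpha\,\Gamma((d+\alpha)/2)}{\pi^{d/2}\Gamma(1-\alpha/2)}$. Two-dimensional discrete operator: let $L=\max\{b_x-a_x,b_y-a_y\}$,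 $N$ a positive integer, $h=L/N$, $\boldsymbol{\xi}_{ij}=(ih,jh)$, $I_{ij}=[ih,(i+1)h]\times[jh,(j+1)h]$, $D_1=(0,L)^2$, $D_2=[0,\infty)^2\setminus D_1$. For $\mathbf{x}=(x,y)$ and $\boldsymbol{\xi}=(\xi,\eta)\in[0,\infty)^2\setminus\{0\}$ set $\psi_\gamma(\mathbf{x},\boldsymbol{\xi})=|\boldsymbol{\xi}|^{-\gamma}\Big(\sum_{m,n\in\{0,1\}}u(x+(-1)^m\xi,\,y+(-1)^n\eta)-4u(\mathbf{x})\Big)$ and $\omega_\gamma(\boldsymbol{\xi})=|\boldsymbol{\xi}|^{\gamma-(2+\alpha)}$. Let $c^\gamma_{mn}=1$ for $(m,n)\in\{(1,0),(0,1),(1,1)\}$ when $\gamma\in(\alpha,2)$, and $c^2_{10}=c^2_{01}=2$, $c^2_{11}=0$ when $\gamma=2$. Define, for $\mathbf{x}\in\Omega$, $$(-\Delta)^{\alpha/2}_{h,\gamma}u(\mathbf{x})=-c_{2,\alpha}\Big[\tfrac14\Big(\sum_{(m,n)\in\{0,1\}^2\setminus\{(0,0)\}}c^\gamma_{mn}\psi_\gamma(\mathbf{x},\boldsymbol{\xi}_{mn})\Big)\int_{I_{00}}\omega_\gamma\,d\boldsymbol{\xi}+\tfrac14\sum_{\substack{0\le i,j\le N-1\\(i,j)\ne(0,0)}}\Big(\sum_{m,n\in\{0,1\}}\psi_\gamma(\mathbf{x},\boldsymbol{\xi}_{(i+m)(j+n)})\Big)\int_{I_{ij}}\omega_\gamma\,d\boldsymbol{\xi}-4u(\mathbf{x})\int_{D_2}|\boldsymbol{\xi}|^{-(2+\alpha)}d\boldsymbol{\xi}\Big].$$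 *)

(* Defs.v *)
From Stdlib Require Import Reals Lra Lia List ClassicalEpsilon.
Open Scope R_scope.

Fixpoint sumR (n : nat) (f : nat -> R) : R :=
  match n with
  | O => 0
  | S k => sumR k f + f k
  end.

Definition norm2 (x y : R) : R := sqrt (x * x + y * y).
Definition dist2 (x y x' y' : R) : R := norm2 (x - x') (y - y').

Definition RInt1 (f : R -> R) (a b : R) : R :=
  epsilon (inhabits 0)
    (fun v => exists pr : Riemann_integrable f a b, RiemannInt pr = v).

Definition Gamma (z : R) : R :=
  epsilon (inhabits 0)
    (fun v => forall e, 0 < e -> exists d, 0 < d /\ exists M, 0 < M /\
       forall a b, 0 < a < d -> M < b ->
         Rabs (RInt1 (fun t => Rpower t (z - 1) * exp (- t)) a b - v) < e).

Definition riemann2_val (f : R -> R -> R) (a b c d v : R) : Prop :=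
  forall e, 0 < e -> exists N : nat, forall n : nat, (N <= n)%nat -> (0 < n)%nat ->
    forall tx ty : nat -> nat -> R,
      (forall i j, (i < n)%nat -> (j < n)%nat ->
         a + INR i * (b - a) / INR n <= tx i j <= a + INR (S i) * (b - a) / INR n /\
         c + INR j * (d - c) / INR n <= ty i j <= c + INR (S j) * (d - c) / INR n) ->
      Rabs (sumR n (fun i => sumR n (fun j => f (tx i j) (ty i j)))
              * ((b - a) / INR n) * ((d - c) / INR n) - v) < e.

Definition box_int (f : R -> R -> R) (a b c d : R) : R :=
  epsilon (inhabits 0) (riemann2_val f a b c d).

(* Improper / principal-value integral over R^2 of f, with a (possible)
   singularity at (cx,cy): joint limit, as r -> 0+ and Rr -> +oo, of the
   integral of f over the square of half-side Rr centred at (cx,cy) with the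
   disk of radius r around (cx,cy) removed. *)
Definition integral2 (cx cy : R) (f : R -> R -> R) : R :=
  epsilon (inhabits 0)
    (fun v => forall e, 0 < e -> exists d, 0 < d /\ exists M, 0 < M /\
       forall r Rr, 0 < r < d -> M < Rr ->
         Rabs (box_int (fun x y => if Rlt_dec r (dist2 x y cx cy) then f x y else 0)
                 (cx - Rr) (cx + Rr) (cy - Rr) (cy + Rr) - v) < e).

Definition c2 (alpha : R) : R :=
  Rpower 2 (alpha - 1) * alpha * Gamma ((2 + alpha) / 2)
    / (PI * Gamma (1 - alpha / 2)).

Definition frac_lap (alpha : R) (u : R -> R -> R) (x y : R) : R :=
  c2 alpha * integral2 x y
    (fun x' y' => (u x y - u x' y') / Rpower (dist2 x y x' y') (2 + alpha)).

Definition cont2 (f : R -> R -> R) : Prop :=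
  forall x y e, 0 < e -> exists d, 0 < d /\
    forall x' y', dist2 x' y' x y < d -> Rabs (f x' y' - f x y) < e.

(* D l is the partial derivative along the word l (false = d/dx, true = d/dy),
   the head of l being the last derivative applied. *)
Definition Holder2 (k : nat) (s : R) (u : R -> R -> R) : Prop :=
  exists D : list bool -> R -> R -> R,
    D nil = u /\
    (forall l, (length l < k)%nat -> forall x y,
        derivable_pt_lim (fun t => D l t y) x (D (false :: l) x y) /\
        derivable_pt_lim (fun t => D l x t) y (D (true :: l) x y)) /\
    (forall l, (length l <= k)%nat -> cont2 (D l)) /\
    (forall l, length l = k -> exists H, forall x y x' y',
        (x, y) <> (x', y') ->
        Rabs (D l x y - D l x' y') <= H * Rpower (dist2 x y x' y') s).

Definition floorR (a : R) : Z := Int_part a.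

Definition psi (gamma : R) (u : R -> R -> R) (x y xi eta : R) : R :=
  Rpower (norm2 xi eta) (- gamma) *
  (u (x + xi) (y + eta) + u (x + xi) (y - eta) + u (x - xi) (y + eta)
   + u (x - xi) (y - eta) - 4 * u x y).

Definition omega (alpha gamma : R) (xi eta : R) : R :=
  Rpower (norm2 xi eta) (gamma - (2 + alpha)).

(* c^gamma_{mn} for (m,n) <> (0,0) *)
Definition cgam (gamma : R) (m n : nat) : R :=
  if Req_EM_T gamma 2 then
    (match m, n with
     | 1%nat, 0%nat => 2 | 0%nat, 1%nat => 2 | _, _ => 0 end)
  else 1.

Definition indI (h : R) (i j : nat) (xi eta : R) : R :=
  if Rle_dec (INR i * h) xi then if Rle_dec xi (INR (S i) * h) then
  if Rle_dec (INR j * h) eta then if Rle_dec eta (INR (S j) * h) then 1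
  else 0 else 0 else 0 else 0.

Definition indD2 (L : R) (xi eta : R) : R :=
  if Rle_dec 0 xi then if Rle_dec 0 eta then
    (if Rlt_dec xi L then if Rlt_dec eta L then
       (if Rlt_dec 0 xi then if Rlt_dec 0 eta then 0 else 1 else 1)
     else 1 else 1)
  else 0 else 0.

Definition disc_frac_lap (alpha gamma : R) (ax bx ay by_ : R) (N : nat)
    (u : R -> R -> R) (x y : R) : R :=
  let L := Rmax (bx - ax) (by_ - ay) in
  let h := L / INR N in
  let intI i j := integral2 0 0 (fun xi eta => indI h i j xi eta * omega alpha gamma xi eta) in
  let ps m n := psi gamma u x y (INR m * h) (INR n * h) in
  - c2 alpha *
  ( / 4 * (cgam gamma 1 0 * ps 1%nat 0%nat + cgam gamma 0 1 * ps 0%nat 1%nat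
           + cgam gamma 1 1 * ps 1%nat 1%nat) * intI 0%nat 0%nat
    + / 4 * sumR N (fun i => sumR N (fun j =>
          if (Nat.eqb i 0 && Nat.eqb j 0)%bool then 0 else
          (ps i j + ps (S i) j + ps i (S j) + ps (S i) (S j)) * intI i j))
    - 4 * u x y * integral2 0 0 (fun xi eta => indD2 L xi eta * Rpower (norm2 xi eta) (- (2 + alpha)))).

(* Main.v *)
Require Import Defs.
From Stdlib Require Import Reals ZArith Lra Lia List Classical ClassicalEpsilon FunctionalExtensionality.
Open Scope R_scope.

(** Folding the plane onto the first quadrant turns both operators into integrals of
    [W(xi) |xi|^(-2-al)], where [W(xi)] is the sum of the four values [u(x +- xi, y +- eta)]
    minus [4 u(x, y)]; the parts outside [(0, L)^2] coincide because [u] vanishes there. Write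
    [W = 2 A xi^2 + 2 B eta^2 + G] with [A = u_xx], [B = u_yy] at the centre. Divided by
    [|xi|^2], the quadratic part is the constant [A + B], which the quadrature integrates
    exactly, plus a function antisymmetric under exchanging [xi] and [eta], whose error
    cancels by symmetry (this is where [c_10 = c_01 = 2], [c_11 = 0] is needed). By evenness of
    [W], the second derivatives of [G] are [O(|xi|^(al+eps))]; hence on a cell of side [h] at
    distance [s] from the origin the error for [G / |xi|^2] is [O(h^2 . h^2 s^(eps-2))], and
    [s^(eps-2)] is integrable at the origin. All integrals are handled through their
    Riemann sums at midpoints of a refinement of the grid. *)


(** Every integral in the statement is a value picked by [epsilon], so nothing can be said about it
    before its defining limit is shown to exist. Each integrand is therefore folded, then compared
    with a nonnegative radial kernel whose truncated integrals are bounded; for nonnegative folded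
    integrands, monotonicity in both truncation parameters gives convergence. Midpoints are the tags
    of choice because they avoid the axes and the edges shared by the closed cells, and because
    those of one cell are symmetric about its centre, which removes the odd linear part of the
    error. The bound [C h^2] holds for the midpoint sums themselves, before any limit. Its constant
    sees [u] only through a Hölder bound [K]: the values [A] and [B], and with them the position of
    the centre, cancel identically, and this makes the estimate uniform over the rectangle. In the
    corner cell no cancellation is sought: there [G / |xi|^2] is [O(h^(al+eps))] and the weight has
    total mass [O(h^(2-al))]. *)

Lemma Rabs_le_inv x a : Rabs x <= a -> - a <= x <= a.
Proof. unfold Rabs; destruct Rcase_abs; lra. Qed.

(** * Finite sums and double sums *)

Lemma sumR_ext n f g : (forall i, (i < n)%nat -> f i = g i) -> sumR n f = sumR n g.
Proof.
  induction n as [|n IH]; intros E; simpl; [reflexivity|].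
  rewrite IH, E; auto.
Qed.

Lemma sumR_le n f g : (forall i, (i < n)%nat -> f i <= g i) -> sumR n f <= sumR n g.
Proof.
  induction n as [|n IH]; intros E; simpl; [lra|].
  apply Rplus_le_compat; auto.
Qed.

Lemma sumR_plus n f g : sumR n (fun i => f i + g i) = sumR n f + sumR n g.
Proof. induction n as [|n IH]; simpl; [lra|rewrite IH; ring]. Qed.

Lemma sumR_scal n c f : sumR n (fun i => c * f i) = c * sumR n f.
Proof. induction n as [|n IH]; simpl; [lra|rewrite IH; ring]. Qed.

Lemma sumR_const n c : sumR n (fun _ => c) = INR n * c.
Proof. induction n as [|n IH]; [simpl; lra|]. simpl sumR. rewrite IH, S_INR. ring. Qed.

Lemma sumR_abs n f : Rabs (sumR n f) <= sumR n (fun i => Rabs (f i)).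
Proof.
  induction n as [|n IH]; simpl; [rewrite Rabs_R0; lra|].
  eapply Rle_trans; [apply Rabs_triang|]. lra.
Qed.

Lemma sumR_nonneg n f : (forall i, (i < n)%nat -> 0 <= f i) -> 0 <= sumR n f.
Proof.
  intros E. replace 0 with (sumR n (fun _ => 0)) by (rewrite sumR_const; ring).
  apply sumR_le; auto.
Qed.

Lemma sumR_swap n m (f : nat -> nat -> R) :
  sumR n (fun i => sumR m (fun j => f i j)) = sumR m (fun j => sumR n (fun i => f i j)).
Proof.
  induction n as [|n IH]; simpl.
  - rewrite sumR_const; ring.
  - rewrite IH, <- sumR_plus. reflexivity.
Qed.

Lemma sumR_telescope n f : sumR n (fun i => f (S i) - f i) = f n - f O.
Proof. induction n as [|n IH]; simpl; [ring|rewrite IH; ring]. Qed.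

Lemma sumR_app n m f : sumR (n + m) f = sumR n f + sumR m (fun i => f (n + i)%nat).
Proof.
  induction m as [|m IH].
  - rewrite Nat.add_0_r; simpl; ring.
  - rewrite Nat.add_succ_r; simpl; rewrite IH; ring.
Qed.

Lemma sumR_mul n m f :
  sumR (n * m) f = sumR n (fun i => sumR m (fun p => f (i * m + p)%nat)).
Proof.
  induction n as [|n IH]; [reflexivity|].
  replace (S n * m)%nat with (n * m + m)%nat by lia.
  rewrite sumR_app, IH. reflexivity.
Qed.

Lemma sumR_rev n f : sumR n (fun i => f (n - 1 - i)%nat) = sumR n f.
Proof.
  revert f; induction n as [|n IH]; intros f; [reflexivity|].
  replace (sumR (S n) f) with (sumR (1 + n) f) by reflexivity.
  rewrite sumR_app; simpl. rewrite Rplus_0_l, Nat.sub_0_r, Nat.sub_diag, Rplus_comm.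
  f_equal. rewrite <- (IH (fun i => f (S i))).
  apply sumR_ext; intros i Hi. f_equal; lia.
Qed.

Lemma sumR_single n f i0 :
  (i0 < n)%nat -> (forall i, (i < n)%nat -> i <> i0 -> f i = 0) -> sumR n f = f i0.
Proof.
  induction n as [|n IH]; intros Hi Hf; [lia|]. simpl.
  destruct (Nat.eq_dec i0 n) as [->|Hne].
  - rewrite (sumR_ext n f (fun _ => 0)), sumR_const; [ring|].
    intros i Hi'; apply Hf; lia.
  - rewrite IH, (Hf n); try lia; [ring|]. intros; apply Hf; lia.
Qed.

Definition dsum (n : nat) (f : nat -> nat -> R) : R :=
  sumR n (fun i => sumR n (fun j => f i j)).

Lemma dsum_ext n f g :
  (forall i j, (i < n)%nat -> (j < n)%nat -> f i j = g i j) -> dsum n f = dsum n g.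
Proof. intros E; apply sumR_ext; intros; apply sumR_ext; auto. Qed.

Lemma dsum_le n f g :
  (forall i j, (i < n)%nat -> (j < n)%nat -> f i j <= g i j) -> dsum n f <= dsum n g.
Proof. intros E; apply sumR_le; intros; apply sumR_le; auto. Qed.

Lemma dsum_plus n f g : dsum n (fun i j => f i j + g i j) = dsum n f + dsum n g.
Proof.
  unfold dsum. rewrite <- sumR_plus. apply sumR_ext; intros; apply sumR_plus.
Qed.

Lemma dsum_scal n c f : dsum n (fun i j => c * f i j) = c * dsum n f.
Proof.
  unfold dsum. rewrite <- sumR_scal. apply sumR_ext; intros; apply sumR_scal.
Qed.

Lemma dsum_minus n f g : dsum n (fun i j => f i j - g i j) = dsum n f - dsum n g.
Proof.
  replace (dsum n f - dsum n g) with (dsum n f + (-1) * dsum n g) by ring.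
  rewrite <- dsum_scal, <- dsum_plus. apply dsum_ext; intros; ring.
Qed.

Lemma dsum_const n c : dsum n (fun _ _ => c) = INR n * INR n * c.
Proof. unfold dsum. rewrite !sumR_const. ring. Qed.

Lemma dsum_abs n f : Rabs (dsum n f) <= dsum n (fun i j => Rabs (f i j)).
Proof.
  unfold dsum. eapply Rle_trans; [apply sumR_abs|].
  apply sumR_le; intros; apply sumR_abs.
Qed.

Lemma dsum_nonneg n f :
  (forall i j, (i < n)%nat -> (j < n)%nat -> 0 <= f i j) -> 0 <= dsum n f.
Proof. intros E; apply sumR_nonneg; intros; apply sumR_nonneg; auto. Qed.

Lemma dsum_prod n f g : dsum n (fun i j => f i * g j) = sumR n f * sumR n g.
Proof.
  unfold dsum. rewrite (sumR_ext _ _ (fun i => sumR n g * f i)).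
  - rewrite sumR_scal; ring.
  - intros. rewrite sumR_scal; ring.
Qed.

Lemma dsum_swap n f : dsum n (fun i j => f j i) = dsum n f.
Proof. unfold dsum. apply sumR_swap. Qed.

Lemma dsum_mul n m f :
  dsum (n * m) f
  = dsum n (fun i j => dsum m (fun p q => f (i * m + p)%nat (j * m + q)%nat)).
Proof.
  unfold dsum. rewrite sumR_mul. apply sumR_ext; intros i Hi.
  rewrite (sumR_swap n m). apply sumR_ext; intros p Hp. apply sumR_mul.
Qed.

Lemma dsum_single n f i0 j0 :
  (i0 < n)%nat -> (j0 < n)%nat ->
  (forall i j, (i < n)%nat -> (j < n)%nat -> (i, j) <> (i0, j0) -> f i j = 0) ->
  dsum n f = f i0 j0.
Proof.
  intros Hi Hj Hf. unfold dsum. rewrite (sumR_single n _ i0 Hi).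
  - apply sumR_single; auto. intros; apply Hf; auto; congruence.
  - intros i Hi' Hne. rewrite (sumR_ext n _ (fun _ => 0)), sumR_const; [ring|].
    intros; apply Hf; auto; congruence.
Qed.

Lemma dsum_swap_dsum n m (f : nat -> nat -> nat -> nat -> R) :
  dsum n (fun i j => dsum m (fun p q => f i j p q))
  = dsum m (fun p q => dsum n (fun i j => f i j p q)).
Proof.
  unfold dsum.
  rewrite (sumR_ext n _ (fun i => sumR m (fun p => sumR m (fun q => sumR n (fun j => f i j p q))))).
  2:{ intros i Hi. rewrite sumR_swap. apply sumR_ext; intros; apply sumR_swap. }
  rewrite sumR_swap. apply sumR_ext; intros. apply sumR_swap.
Qed.

Lemma dsum_rev n f : dsum n (fun i j => f (n - 1 - i)%nat (n - 1 - j)%nat) = dsum n f.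
Proof.
  unfold dsum. rewrite (sumR_ext n _ (fun i => sumR n (fun j => f (n - 1 - i)%nat j))).
  - apply (sumR_rev n (fun i => sumR n (fun j => f i j))).
  - intros. apply (sumR_rev n (fun j => f (n - 1 - i)%nat j)).
Qed.

(** * Riemann integrability on boxes *)

Definition tagged (n : nat) (a b c d : R) (tx ty : nat -> nat -> R) : Prop :=
  forall i j, (i < n)%nat -> (j < n)%nat ->
    a + INR i * (b - a) / INR n <= tx i j <= a + INR (S i) * (b - a) / INR n /\
    c + INR j * (d - c) / INR n <= ty i j <= c + INR (S j) * (d - c) / INR n.

(** An oscillation criterion that mentions no value of the integral, so that closure under sums and
    products reduces to pointwise inequalities; boundedness is kept for products. All fine uniform
    grids and all pairs of taggings are covered because [riemann2_val] allows arbitrary tags. *)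
Definition Rintable (f : R -> R -> R) (a b c d : R) : Prop :=
  (exists M, forall x y, a <= x <= b -> c <= y <= d -> Rabs (f x y) <= M) /\
  forall e, 0 < e -> exists N : nat, forall n, (N <= n)%nat -> (0 < n)%nat ->
    forall tx ty sx sy, tagged n a b c d tx ty -> tagged n a b c d sx sy ->
      dsum n (fun i j => Rabs (f (tx i j) (ty i j) - f (sx i j) (sy i j)))
        * ((b - a) / INR n) * ((d - c) / INR n) < e.

Lemma grid_in a b n i : a < b -> (i <= n)%nat -> (0 < n)%nat ->
  a <= a + INR i * (b - a) / INR n <= b.
Proof.
  intros Hab Hi Hn. assert (0 < INR n) by (apply lt_0_INR; lia).
  assert (INR i <= INR n) by (apply le_INR; lia). assert (0 <= INR i) by apply pos_INR.
  split.
  - assert (0 <= INR i * (b - a) / INR n); [|lra].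
    apply Rmult_le_pos; [nra|]. left; apply Rinv_0_lt_compat; auto.
  - assert (INR i * (b - a) / INR n <= b - a); [|lra].
    apply Rmult_le_reg_r with (INR n); auto.
    replace (INR i * (b - a) / INR n * INR n) with (INR i * (b - a)) by (field; lra). nra.
Qed.

Lemma tagged_in a b c d n tx ty i j : a < b -> c < d -> tagged n a b c d tx ty ->
  (i < n)%nat -> (j < n)%nat -> a <= tx i j <= b /\ c <= ty i j <= d.
Proof.
  intros Hab Hcd T Hi Hj. destruct (T i j Hi Hj).
  pose proof (grid_in a b n i Hab ltac:(lia) ltac:(lia)).
  pose proof (grid_in a b n (S i) Hab ltac:(lia) ltac:(lia)).
  pose proof (grid_in c d n j Hcd ltac:(lia) ltac:(lia)).
  pose proof (grid_in c d n (S j) Hcd ltac:(lia) ltac:(lia)). lra.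
Qed.

Lemma grid_S a b n i : (0 < n)%nat ->
  a + INR (S i) * (b - a) / INR n = a + INR i * (b - a) / INR n + (b - a) / INR n.
Proof. intros Hn. rewrite S_INR. field. apply not_0_INR; lia. Qed.

Lemma tagged_left n a b c d : a < b -> c < d ->
  tagged n a b c d (fun i _ => a + INR i * (b - a) / INR n)
                   (fun _ j => c + INR j * (d - c) / INR n).
Proof.
  intros Hab Hcd i j Hi Hj.
  assert (0 < INR n) by (apply lt_0_INR; lia).
  assert (0 < (b - a) / INR n) by (apply Rdiv_lt_0_compat; lra).
  assert (0 < (d - c) / INR n) by (apply Rdiv_lt_0_compat; lra).
  rewrite !grid_S by lia. lra.
Qed.

Lemma archimed_nat x : exists N : nat, x < INR N.
Proof.
  destruct (INR_unbounded x) as [N HN]. exists N; lra.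
Qed.

Lemma cell_area a b c d n : a < b -> c < d -> (0 < n)%nat ->
  0 < ((b - a) / INR n) * ((d - c) / INR n).
Proof.
  intros. assert (0 < INR n) by (apply lt_0_INR; lia).
  apply Rmult_lt_0_compat; apply Rdiv_lt_0_compat; lra.
Qed.

(** A total oscillation of order [n] is harmless, since a cell has area of order [n^(-2)]. Lipschitz
    functions reach this order with [n^2] cells of oscillation [O(1/n)], monotone ones by
    telescoping. *)
Lemma osc_small a b c d K e : a < b -> c < d -> 0 < e ->
  exists N : nat, forall n : nat, (N <= n)%nat -> (0 < n)%nat ->
    INR n * K * ((b - a) / INR n) * ((d - c) / INR n) < e.
Proof.
  intros Hab Hcd He.
  destruct (archimed_nat (K * (b - a) * (d - c) / e)) as [N HN].
  exists N. intros n Hn Hp.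
  assert (0 < INR n) by (apply lt_0_INR; lia).
  assert (INR N <= INR n) by (apply le_INR; lia).
  replace (INR n * K * ((b - a) / INR n) * ((d - c) / INR n))
    with (K * (b - a) * (d - c) / INR n) by (field; lra).
  apply Rmult_lt_reg_r with (INR n); auto.
  replace (K * (b - a) * (d - c) / INR n * INR n) with (K * (b - a) * (d - c)) by (field; lra).
  assert (K * (b - a) * (d - c) / e < INR n) by lra.
  apply Rmult_lt_compat_r with (r := e) in H1; auto.
  replace (K * (b - a) * (d - c) / e * e) with (K * (b - a) * (d - c)) in H1 by (field; lra).
  lra.
Qed.

(** Oscillation sums inherit any pointwise domination of oscillations. The algebraic closure
    properties below are instances or consequences, so the epsilon argument is made only once. *)
Lemma Rintable_dominated f g1 g2 K a b c d : a < b -> c < d -> 0 <= K ->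
  Rintable g1 a b c d -> Rintable g2 a b c d ->
  (exists M, forall x y, a <= x <= b -> c <= y <= d -> Rabs (f x y) <= M) ->
  (forall x y x' y', a <= x <= b -> c <= y <= d -> a <= x' <= b -> c <= y' <= d ->
     Rabs (f x y - f x' y')
     <= K * (Rabs (g1 x y - g1 x' y') + Rabs (g2 x y - g2 x' y'))) ->
  Rintable f a b c d.
Proof.
  intros Hab Hcd HK [_ H1] [_ H2] HM Hf. split; [exact HM|].
  intros e He.
  assert (He' : 0 < e / (2 * (K + 1))) by (apply Rdiv_lt_0_compat; lra).
  destruct (H1 _ He') as [N1 HN1]. destruct (H2 _ He') as [N2 HN2].
  exists (max N1 N2). intros n Hn Hp tx ty sx sy Ht Hs.
  specialize (HN1 n ltac:(lia) Hp tx ty sx sy Ht Hs).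
  specialize (HN2 n ltac:(lia) Hp tx ty sx sy Ht Hs).
  pose proof (cell_area a b c d n Hab Hcd Hp) as HA.
  set (A := (b - a) / INR n) in *. set (B := (d - c) / INR n) in *.
  set (S1 := dsum n (fun i j => Rabs (g1 (tx i j) (ty i j) - g1 (sx i j) (sy i j)))) in *.
  set (S2 := dsum n (fun i j => Rabs (g2 (tx i j) (ty i j) - g2 (sx i j) (sy i j)))) in *.
  assert (Hle : dsum n (fun i j => Rabs (f (tx i j) (ty i j) - f (sx i j) (sy i j)))
     <= K * (S1 + S2)).
  { unfold S1, S2. rewrite <- dsum_plus, <- dsum_scal. apply dsum_le; intros i j Hi Hj.
    destruct (tagged_in _ _ _ _ _ _ _ i j Hab Hcd Ht Hi Hj).
    destruct (tagged_in _ _ _ _ _ _ _ i j Hab Hcd Hs Hi Hj). auto. }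
  assert (0 <= S1) by (apply dsum_nonneg; intros; apply Rabs_pos).
  assert (0 <= S2) by (apply dsum_nonneg; intros; apply Rabs_pos).
  rewrite Rmult_assoc in *.
  apply Rle_lt_trans with (K * (S1 * (A * B) + S2 * (A * B))).
  { apply Rmult_le_compat_r with (r := A * B) in Hle; lra. }
  apply Rle_lt_trans with (K * (e / (2 * (K + 1)) + e / (2 * (K + 1)))).
  { apply Rmult_le_compat_l; lra. }
  apply Rmult_lt_reg_r with (K + 1); [lra|].
  replace (K * (e / (2 * (K + 1)) + e / (2 * (K + 1))) * (K + 1)) with (K * e) by (field; lra).
  lra.
Qed.

Lemma Rintable_const k a b c d : a < b -> c < d -> Rintable (fun _ _ => k) a b c d.
Proof.
  intros Hab Hcd. split; [exists (Rabs k); intros; lra|].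
  intros e He. exists O. intros n _ Hp tx ty sx sy _ _.
  replace (k - k) with 0 by ring. rewrite Rabs_R0, dsum_const. lra.
Qed.

Lemma Rintable_plus f g a b c d : a < b -> c < d ->
  Rintable f a b c d -> Rintable g a b c d -> Rintable (fun x y => f x y + g x y) a b c d.
Proof.
  intros Hab Hcd Hf Hg. apply (Rintable_dominated _ f g 1); auto; try lra.
  - destruct Hf as [[M HM] _], Hg as [[M' HM'] _]. exists (M + M'). intros.
    eapply Rle_trans; [apply Rabs_triang|]. apply Rplus_le_compat; auto.
  - intros. replace (f x y + g x y - (f x' y' + g x' y'))
      with ((f x y - f x' y') + (g x y - g x' y')) by ring.
    rewrite Rmult_1_l. apply Rabs_triang.
Qed.

Lemma Rintable_mult f g a b c d : a < b -> c < d ->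
  Rintable f a b c d -> Rintable g a b c d -> Rintable (fun x y => f x y * g x y) a b c d.
Proof.
  intros Hab Hcd Hf Hg. destruct (proj1 Hf) as [M HM], (proj1 Hg) as [M' HM'].
  assert (0 <= M) by (eapply Rle_trans; [apply Rabs_pos|apply (HM a c); lra]).
  assert (0 <= M') by (eapply Rle_trans; [apply Rabs_pos|apply (HM' a c); lra]).
  apply (Rintable_dominated _ f g (M + M')); auto; try lra.
  - exists (M * M'). intros. rewrite Rabs_mult.
    apply Rmult_le_compat; auto using Rabs_pos.
  - intros. replace (f x y * g x y - f x' y' * g x' y')
      with ((f x y - f x' y') * g x y + f x' y' * (g x y - g x' y')) by ring.
    eapply Rle_trans; [apply Rabs_triang|]. rewrite !Rabs_mult.
    pose proof (HM x' y' ltac:(lra) ltac:(lra)). pose proof (HM' x y ltac:(lra) ltac:(lra)).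
    pose proof (Rabs_pos (f x y - f x' y')). pose proof (Rabs_pos (g x y - g x' y')). nra.
Qed.

Lemma Rintable_ext f g a b c d : a < b -> c < d ->
  (forall x y, a <= x <= b -> c <= y <= d -> f x y = g x y) ->
  Rintable f a b c d -> Rintable g a b c d.
Proof.
  intros Hab Hcd E Hf. apply (Rintable_dominated _ f f 1); auto; try lra.
  - destruct Hf as [[M HM] _]. exists M. intros. rewrite <- E; auto.
  - intros. rewrite !E by lra. pose proof (Rabs_pos (g x y - g x' y')). lra.
Qed.

Lemma Rintable_scal k f a b c d : a < b -> c < d ->
  Rintable f a b c d -> Rintable (fun x y => k * f x y) a b c d.
Proof.
  intros. apply Rintable_mult; auto. apply Rintable_const; auto.
Qed.

Lemma Rintable_minus f g a b c d : a < b -> c < d ->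
  Rintable f a b c d -> Rintable g a b c d -> Rintable (fun x y => f x y - g x y) a b c d.
Proof.
  intros Hab Hcd Hf Hg.
  apply Rintable_ext with (fun x y => f x y + (-1) * g x y); auto; [intros; ring|].
  apply Rintable_plus; auto. apply Rintable_scal; auto.
Qed.

Lemma Rintable_lipschitz f K a b c d : a < b -> c < d -> 0 <= K ->
  (forall x y x' y', a <= x <= b -> c <= y <= d -> a <= x' <= b -> c <= y' <= d ->
     Rabs (f x y - f x' y') <= K * (Rabs (x - x') + Rabs (y - y'))) ->
  Rintable f a b c d.
Proof.
  intros Hab Hcd HK Hf. split.
  - exists (Rabs (f a c) + K * ((b - a) + (d - c))). intros x y Hx Hy.
    specialize (Hf x y a c Hx Hy ltac:(lra) ltac:(lra)).
    rewrite (Rabs_right (x - a)), (Rabs_right (y - c)) in Hf by lra.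
    replace (f x y) with (f a c + (f x y - f a c)) by ring.
    eapply Rle_trans; [apply Rabs_triang|]. nra.
  - intros e He.
    destruct (osc_small a b c d (K * ((b - a) + (d - c))) e Hab Hcd He) as [N HN].
    exists N. intros n Hn Hp tx ty sx sy Ht Hs.
    eapply Rle_lt_trans; [|apply (HN n Hn Hp)].
    pose proof (cell_area a b c d n Hab Hcd Hp) as HA.
    assert (0 < INR n) by (apply lt_0_INR; lia).
    set (A := (b - a) / INR n) in *. set (B := (d - c) / INR n) in *.
    replace (INR n * (K * (b - a + (d - c)))) with (INR n * INR n * (K * (A + B)))
      by (unfold A, B; field; lra).
    rewrite !(Rmult_assoc _ A B). apply Rmult_le_compat_r; [lra|].
    rewrite <- dsum_const. apply dsum_le; intros i j Hi Hj.
    destruct (tagged_in _ _ _ _ _ _ _ i j Hab Hcd Ht Hi Hj).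
    destruct (tagged_in _ _ _ _ _ _ _ i j Hab Hcd Hs Hi Hj).
    eapply Rle_trans; [apply Hf; auto|]. apply Rmult_le_compat_l; auto.
    destruct (Ht i j Hi Hj) as [T1 T2]. destruct (Hs i j Hi Hj) as [T3 T4].
    rewrite grid_S in T1, T2, T3, T4 by auto. fold A in T1, T3. fold B in T2, T4.
    apply Rplus_le_compat; apply Rabs_le; lra.
Qed.

(** [D] bounds the oscillation on a cell independently of the tags. The [4 * M] comes from two
    families of [n] telescoping sums, one along rows and one along columns, each sum being at most
    [2 * M]. *)
Lemma Rintable_mono_aux f (D : nat -> nat -> nat -> R) a b c d M : a < b -> c < d ->
  (forall x y, a <= x <= b -> c <= y <= d -> Rabs (f x y) <= M) ->
  (forall n tx ty sx sy, (0 < n)%nat ->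
     tagged n a b c d tx ty -> tagged n a b c d sx sy ->
     forall i j, (i < n)%nat -> (j < n)%nat ->
     Rabs (f (tx i j) (ty i j) - f (sx i j) (sy i j)) <= D n i j) ->
  (forall n, (0 < n)%nat -> dsum n (D n) <= INR n * (4 * M)) ->
  Rintable f a b c d.
Proof.
  intros Hab Hcd HM HD HS. split; [exists M; auto|].
  intros e He. destruct (osc_small a b c d (4 * M) e Hab Hcd He) as [N HN].
  exists N. intros n Hn Hp tx ty sx sy Ht Hs.
  eapply Rle_lt_trans; [|apply (HN n Hn Hp)].
  pose proof (cell_area a b c d n Hab Hcd Hp) as HA.
  set (A := (b - a) / INR n) in *. set (B := (d - c) / INR n) in *.
  rewrite !(Rmult_assoc _ A B). apply Rmult_le_compat_r; [lra|]. eapply Rle_trans; [|apply HS; auto].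
  apply dsum_le. intros; eapply HD; eauto.
Qed.

(* The oscillation on a cell is at most the increment along its diagonal, and the
   diagonal increments telescope along rows and columns. *)
Lemma Rintable_incr_incr f a b c d : a < b -> c < d ->
  (forall x x' y y', a <= x <= x' -> x' <= b -> c <= y <= y' -> y' <= d -> f x y <= f x' y') ->
  Rintable f a b c d.
Proof.
  intros Hab Hcd Hf. set (M := Rabs (f a c) + Rabs (f b d)).
  assert (HM : forall x y, a <= x <= b -> c <= y <= d -> Rabs (f x y) <= M).
  { intros x y Hx Hy. pose proof (Hf a x c y ltac:(lra) ltac:(lra) ltac:(lra) ltac:(lra)).
    pose proof (Hf x b y d ltac:(lra) ltac:(lra) ltac:(lra) ltac:(lra)).
    unfold M. revert H H0. unfold Rabs; repeat destruct Rcase_abs; lra. }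
  pose (X := fun n i => a + INR i * (b - a) / INR n).
  pose (Y := fun n j => c + INR j * (d - c) / INR n).
  assert (HX : forall n i, (0 < n)%nat -> (i <= n)%nat -> a <= X n i <= b)
    by (intros; apply grid_in; auto).
  assert (HY : forall n i, (0 < n)%nat -> (i <= n)%nat -> c <= Y n i <= d)
    by (intros; apply grid_in; auto).
  apply (Rintable_mono_aux f (fun n i j => f (X n (S i)) (Y n (S j)) - f (X n i) (Y n j))
           a b c d M); auto.
  - intros n tx ty sx sy Hp Ht Hs i j Hi Hj.
    destruct (Ht i j Hi Hj) as [T1 T2]. destruct (Hs i j Hi Hj) as [T3 T4].
    change (X n i <= tx i j <= X n (S i)) in T1. change (Y n j <= ty i j <= Y n (S j)) in T2.
    change (X n i <= sx i j <= X n (S i)) in T3. change (Y n j <= sy i j <= Y n (S j)) in T4.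
    pose proof (HX n i Hp ltac:(lia)). pose proof (HX n (S i) Hp ltac:(lia)).
    pose proof (HY n j Hp ltac:(lia)). pose proof (HY n (S j) Hp ltac:(lia)).
    pose proof (Hf (X n i) (tx i j) (Y n j) (ty i j)).
    pose proof (Hf (X n i) (sx i j) (Y n j) (sy i j)).
    pose proof (Hf (tx i j) (X n (S i)) (ty i j) (Y n (S j))).
    pose proof (Hf (sx i j) (X n (S i)) (sy i j) (Y n (S j))).
    apply Rabs_le; lra.
  - intros n Hp.
    rewrite (dsum_ext n _ (fun i j => (f (X n (S i)) (Y n (S j)) - f (X n i) (Y n (S j)))
       + (f (X n i) (Y n (S j)) - f (X n i) (Y n j)))) by (intros; ring).
    rewrite dsum_plus.
    assert (forall x y x' y', a <= x <= b -> c <= y <= d -> a <= x' <= b -> c <= y' <= d ->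
       f x y - f x' y' <= 2 * M).
    { intros x y x' y' h1 h2 h3 h4. pose proof (HM x y h1 h2). pose proof (HM x' y' h3 h4).
      apply Rabs_le_inv in H, H0. lra. }
    replace (INR n * (4 * M)) with (INR n * (2 * M) + INR n * (2 * M)) by ring.
    rewrite <- sumR_const. apply Rplus_le_compat.
    + unfold dsum. rewrite sumR_swap. apply sumR_le; intros j Hj.
      rewrite (sumR_telescope n (fun i => f (X n i) (Y n (S j)))). apply H; auto with arith.
    + unfold dsum. apply sumR_le; intros i Hi.
      rewrite (sumR_telescope n (fun j => f (X n i) (Y n j))). apply H; auto with arith.
Qed.

(** With opposite monotonicity the extreme values on a cell sit at the ends of its other diagonal;
    the increments along it again split into telescoping horizontal and vertical ones. *)
Lemma Rintable_incr_decr f a b c d : a < b -> c < d ->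
  (forall x x' y y', a <= x <= x' -> x' <= b -> c <= y' <= y -> y <= d -> f x y <= f x' y') ->
  Rintable f a b c d.
Proof.
  intros Hab Hcd Hf. set (M := Rabs (f a d) + Rabs (f b c)).
  assert (HM : forall x y, a <= x <= b -> c <= y <= d -> Rabs (f x y) <= M).
  { intros x y Hx Hy. pose proof (Hf a x d y ltac:(lra) ltac:(lra) ltac:(lra) ltac:(lra)).
    pose proof (Hf x b y c ltac:(lra) ltac:(lra) ltac:(lra) ltac:(lra)).
    unfold M. revert H H0. unfold Rabs; repeat destruct Rcase_abs; lra. }
  pose (X := fun n i => a + INR i * (b - a) / INR n).
  pose (Y := fun n j => c + INR j * (d - c) / INR n).
  assert (HX : forall n i, (0 < n)%nat -> (i <= n)%nat -> a <= X n i <= b)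
    by (intros; apply grid_in; auto).
  assert (HY : forall n i, (0 < n)%nat -> (i <= n)%nat -> c <= Y n i <= d)
    by (intros; apply grid_in; auto).
  apply (Rintable_mono_aux f (fun n i j => f (X n (S i)) (Y n j) - f (X n i) (Y n (S j)))
           a b c d M); auto.
  - intros n tx ty sx sy Hp Ht Hs i j Hi Hj.
    destruct (Ht i j Hi Hj) as [T1 T2]. destruct (Hs i j Hi Hj) as [T3 T4].
    change (X n i <= tx i j <= X n (S i)) in T1. change (Y n j <= ty i j <= Y n (S j)) in T2.
    change (X n i <= sx i j <= X n (S i)) in T3. change (Y n j <= sy i j <= Y n (S j)) in T4.
    pose proof (HX n i Hp ltac:(lia)). pose proof (HX n (S i) Hp ltac:(lia)).
    pose proof (HY n j Hp ltac:(lia)). pose proof (HY n (S j) Hp ltac:(lia)).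
    pose proof (Hf (X n i) (tx i j) (Y n (S j)) (ty i j)).
    pose proof (Hf (X n i) (sx i j) (Y n (S j)) (sy i j)).
    pose proof (Hf (tx i j) (X n (S i)) (ty i j) (Y n j)).
    pose proof (Hf (sx i j) (X n (S i)) (sy i j) (Y n j)).
    apply Rabs_le; lra.
  - intros n Hp.
    rewrite (dsum_ext n _ (fun i j => (f (X n (S i)) (Y n j) - f (X n i) (Y n j))
       + (-1) * (f (X n i) (Y n (S j)) - f (X n i) (Y n j)))) by (intros; ring).
    rewrite dsum_plus.
    assert (forall x y x' y', a <= x <= b -> c <= y <= d -> a <= x' <= b -> c <= y' <= d ->
       f x y - f x' y' <= 2 * M).
    { intros x y x' y' h1 h2 h3 h4. pose proof (HM x y h1 h2). pose proof (HM x' y' h3 h4).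
      apply Rabs_le_inv in H, H0. lra. }
    replace (INR n * (4 * M)) with (INR n * (2 * M) + INR n * (2 * M)) by ring.
    rewrite <- sumR_const. apply Rplus_le_compat.
    + unfold dsum. rewrite sumR_swap. apply sumR_le; intros j Hj.
      rewrite (sumR_telescope n (fun i => f (X n i) (Y n j))). apply H; auto with arith.
    + unfold dsum. apply sumR_le; intros i Hi. rewrite sumR_scal.
      rewrite (sumR_telescope n (fun j => f (X n i) (Y n j))).
      pose proof (H (X n i) (Y n 0%nat) (X n i) (Y n n)
        ltac:(auto with arith) ltac:(auto with arith) ltac:(auto with arith) ltac:(auto with arith)).
      lra.
Qed.

Lemma Rintable_decr_decr f a b c d : a < b -> c < d ->
  (forall x x' y y', a <= x <= x' -> x' <= b -> c <= y <= y' -> y' <= d -> f x' y' <= f x y) ->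
  Rintable f a b c d.
Proof.
  intros Hab Hcd Hf.
  apply Rintable_ext with (fun x y => (-1) * ((-1) * f x y)); auto; [intros; ring|].
  apply Rintable_scal; auto. apply Rintable_incr_incr; auto.
  intros x x' y y' h1 h2 h3 h4. specialize (Hf x x' y y' h1 h2 h3 h4). lra.
Qed.

Lemma Rintable_decr_incr f a b c d : a < b -> c < d ->
  (forall x x' y y', a <= x <= x' -> x' <= b -> c <= y' <= y -> y <= d -> f x' y' <= f x y) ->
  Rintable f a b c d.
Proof.
  intros Hab Hcd Hf.
  apply Rintable_ext with (fun x y => (-1) * ((-1) * f x y)); auto; [intros; ring|].
  apply Rintable_scal; auto. apply Rintable_incr_decr; auto.
  intros x x' y y' h1 h2 h3 h4. specialize (Hf x x' y y' h1 h2 h3 h4). lra.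
Qed.

(* Every Riemann sum on the [n m]-grid is an average of [m^2] Riemann sums on the [n]-grid. *)
Lemma riemann_refine f a b c d n m tx ty sx sy e :
  a < b -> c < d -> (0 < n)%nat -> (0 < m)%nat ->
  (forall tx ty sx sy, tagged n a b c d tx ty -> tagged n a b c d sx sy ->
      dsum n (fun i j => Rabs (f (tx i j) (ty i j) - f (sx i j) (sy i j)))
        * ((b - a) / INR n) * ((d - c) / INR n) < e) ->
  tagged (n * m) a b c d tx ty -> tagged n a b c d sx sy ->
  Rabs (dsum (n * m) (fun i j => f (tx i j) (ty i j))
          * ((b - a) / INR (n * m)) * ((d - c) / INR (n * m))
        - dsum n (fun i j => f (sx i j) (sy i j)) * ((b - a) / INR n) * ((d - c) / INR n)) <= e.
Proof.
  intros Hab Hcd Hn Hm Hosc Ht Hs.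
  assert (Pn : 0 < INR n) by (apply lt_0_INR; lia).
  assert (Pm : 0 < INR m) by (apply lt_0_INR; lia).
  pose proof (cell_area a b c d n Hab Hcd Hn) as HA.
  assert (Hsub : forall p q, (p < m)%nat -> (q < m)%nat ->
    tagged n a b c d (fun i j => tx (i * m + p)%nat (j * m + q)%nat)
                     (fun i j => ty (i * m + p)%nat (j * m + q)%nat)).
  { assert (Hg : forall a b i p t, a < b -> (p < m)%nat ->
       a + INR (i * m + p) * (b - a) / INR (n * m) <= t
         <= a + INR (S (i * m + p)) * (b - a) / INR (n * m) ->
       a + INR i * (b - a) / INR n <= t <= a + INR (S i) * (b - a) / INR n).
    { clear - Pn Pm Hn Hm. intros a b i p t Hab Hp Ht.
      rewrite mult_INR in Ht. rewrite !S_INR, !plus_INR, mult_INR in *.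
      assert (INR p + 1 <= INR m) by (rewrite <- S_INR; apply le_INR; lia).
      pose proof (pos_INR p).
      replace ((INR i * INR m + INR p) * (b - a) / (INR n * INR m))
        with (INR i * (b - a) / INR n + INR p * ((b - a) / (INR n * INR m))) in Ht by (field; lra).
      replace ((INR i * INR m + INR p + 1) * (b - a) / (INR n * INR m))
        with (INR i * (b - a) / INR n + (INR p + 1) * ((b - a) / (INR n * INR m))) in Ht by (field; lra).
      replace ((INR i + 1) * (b - a) / INR n)
        with (INR i * (b - a) / INR n + INR m * ((b - a) / (INR n * INR m))) by (field; lra).
      assert (0 < (b - a) / (INR n * INR m)) by (apply Rdiv_lt_0_compat; nra).
      split; nra. }
    intros p q Hp Hq i j Hi Hj.
    destruct (Ht (i * m + p)%nat (j * m + q)%nat) as [T1 T2]; [nia|nia|].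
    split; [apply (Hg a b i p)|apply (Hg c d j q)]; auto. }
  rewrite dsum_mul, dsum_swap_dsum.
  set (A := (b - a) / INR n) in *. set (B := (d - c) / INR n) in *.
  rewrite mult_INR.
  replace ((b - a) / (INR n * INR m)) with (A * / INR m) by (unfold A; field; lra).
  replace ((d - c) / (INR n * INR m)) with (B * / INR m) by (unfold B; field; lra).
  set (S0 := dsum n (fun i j => f (sx i j) (sy i j))).
  set (Sp := fun p q => dsum n (fun i j => f (tx (i * m + p)%nat (j * m + q)%nat)
                                             (ty (i * m + p)%nat (j * m + q)%nat))).
  match goal with |- Rabs ?X <= _ => replace X with (/ INR m * / INR m * dsum m (fun p q => (Sp p q - S0) * A * B)) end.
  2:{ rewrite (dsum_ext m _ (fun p q => (A * B) * (Sp p q - S0))) by (intros; ring).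
      rewrite dsum_scal, dsum_minus, dsum_const. unfold Sp. field. lra. }
  rewrite Rabs_mult, (Rabs_right (/ INR m * / INR m)).
  2:{ apply Rle_ge, Rmult_le_pos; left; apply Rinv_0_lt_compat; auto. }
  apply Rle_trans with (/ INR m * / INR m * (INR m * INR m * e)).
  2:{ right; field; lra. }
  apply Rmult_le_compat_l.
  { apply Rmult_le_pos; left; apply Rinv_0_lt_compat; auto. }
  eapply Rle_trans; [apply dsum_abs|]. rewrite <- dsum_const. apply dsum_le.
  intros p q Hp Hq. specialize (Hosc _ _ _ _ (Hsub p q Hp Hq) Hs).
  rewrite Rmult_assoc, Rabs_mult, (Rabs_right (A * B)) by lra.
  rewrite Rmult_assoc in Hosc. eapply Rle_trans; [|left; apply Hosc].
  apply Rmult_le_compat_r; [lra|]. unfold Sp, S0. rewrite <- dsum_minus. apply dsum_abs.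
Qed.

(** Grids with [n] and [m] cells per side are not nested, but both are refined by the [n m]-grid, so
    [riemann_refine] makes the left-endpoint sums a Cauchy sequence. Arbitrary tags differ from left
    endpoints only by an oscillation sum. *)
Lemma Rintable_value f a b c d : a < b -> c < d -> Rintable f a b c d ->
  riemann2_val f a b c d (box_int f a b c d).
Proof.
  intros Hab Hcd [_ Hosc]. unfold box_int. apply epsilon_spec.
  pose (X := fun n => dsum n (fun i j => f (a + INR i * (b - a) / INR n) (c + INR j * (d - c) / INR n))
       * ((b - a) / INR n) * ((d - c) / INR n)).
  (* The shift by one skips the meaningless grid [n = 0]. *)
  assert (HC : Cauchy_crit (fun n => X (S n))).
  { intros e He. assert (He4 : 0 < e / 4) by lra. destruct (Hosc _ He4) as [N HN].
    exists N. intros p q Hp Hq.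
    assert (Hr : forall n m, (N <= n)%nat -> (0 < n)%nat -> (0 < m)%nat ->
        Rabs (X (n * m)%nat - X n) <= e / 4).
    { intros n m H1 H2 H3. eapply (riemann_refine f a b c d n m); auto using tagged_left. }
    pose proof (Hr (S p) (S q) ltac:(lia) ltac:(lia) ltac:(lia)) as H1.
    pose proof (Hr (S q) (S p) ltac:(lia) ltac:(lia) ltac:(lia)) as H2.
    rewrite (Nat.mul_comm (S q)) in H2. unfold Rdist.
    apply Rabs_le_inv in H1. apply Rabs_le_inv in H2. apply Rabs_def1; lra. }
  destruct (R_complete _ HC) as [v Hv]. exists v.
  intros e He. assert (He2 : 0 < e / 2) by lra.
  destruct (Hosc _ He2) as [N1 HN1]. destruct (Hv _ He2) as [N2 HN2].
  exists (max N1 (S N2)). intros n Hn Hp tx ty Ht.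
  specialize (HN2 (n - 1)%nat ltac:(lia)). unfold Rdist in HN2.
  replace (S (n - 1)) with n in HN2 by lia.
  specialize (HN1 n ltac:(lia) Hp tx ty _ _ Ht (tagged_left n a b c d Hab Hcd)).
  fold (dsum n (fun i j => f (tx i j) (ty i j))).
  assert (Rabs (dsum n (fun i j => f (tx i j) (ty i j)) * ((b - a) / INR n) * ((d - c) / INR n) - X n) < e / 2).
  { unfold X. rewrite !Rmult_assoc, <- Rmult_minus_distr_r, <- dsum_minus.
    pose proof (cell_area a b c d n Hab Hcd Hp) as HA.
    rewrite Rabs_mult, (Rabs_right (_ / _ * _)) by lra. rewrite Rmult_assoc in HN1.
    eapply Rle_lt_trans; [|apply HN1]. apply Rmult_le_compat_r; [lra|]. apply dsum_abs. }
  apply Rabs_def2 in H. apply Rabs_def2 in HN2. apply Rabs_def1; lra.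
Qed.


(** * The Euclidean norm and radial functions *)

Lemma norm2_nonneg x y : 0 <= norm2 x y.
Proof. apply sqrt_pos. Qed.

Lemma norm2_sqr x y : norm2 x y * norm2 x y = x * x + y * y.
Proof. apply sqrt_sqrt. nra. Qed.

Lemma norm2_opp_l x y : norm2 (- x) y = norm2 x y.
Proof. unfold norm2; f_equal; ring. Qed.

Lemma norm2_opp_r x y : norm2 x (- y) = norm2 x y.
Proof. unfold norm2; f_equal; ring. Qed.

Lemma norm2_comm x y : norm2 x y = norm2 y x.
Proof. unfold norm2; f_equal; ring. Qed.

Lemma norm2_le x y x' y' : 0 <= x <= x' -> 0 <= y <= y' -> norm2 x y <= norm2 x' y'.
Proof. intros; apply sqrt_le_1_alt; nra. Qed.

Lemma norm2_ge_l x y : x <= norm2 x y.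
Proof. pose proof (norm2_nonneg x y). pose proof (norm2_sqr x y). nra. Qed.

Lemma norm2_ge_r x y : y <= norm2 x y.
Proof. rewrite norm2_comm; apply norm2_ge_l. Qed.

Lemma norm2_le_sum x y : 0 <= x -> 0 <= y -> norm2 x y <= x + y.
Proof. intros. pose proof (norm2_nonneg x y). pose proof (norm2_sqr x y). nra. Qed.

(* [k(|x|,|y|)] is a combination of functions of the positive and negative parts of [x]
   and [y], each monotone in each variable, since one of the two parts always vanishes. *)
Lemma Rintable_radial k cx cy a b c d : a < b -> c < d ->
  (forall s t, 0 <= s <= t -> k t <= k s) ->
  Rintable (fun x y => k (dist2 x y cx cy)) a b c d.
Proof.
  intros Hab Hcd Hk. unfold dist2.
  set (pp := fun x => Rmax x 0). set (np := fun x => Rmax (- x) 0).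
  assert (Hpp : forall x x', x <= x' -> 0 <= pp x <= pp x').
  { intros; unfold pp, Rmax; repeat destruct Rle_dec; lra. }
  assert (Hnp : forall x x', x <= x' -> 0 <= np x' <= np x).
  { intros; unfold np, Rmax; repeat destruct Rle_dec; lra. }
  assert (HK : forall x y x' y', 0 <= x <= x' -> 0 <= y <= y' ->
     k (norm2 x' y') <= k (norm2 x y)).
  { intros. apply Hk. split; [apply norm2_nonneg|apply norm2_le; auto]. }
  (* Inclusion and exclusion: of the four leading terms one is the wanted value and the other three
     carry a zero argument; the subtracted terms amount to exactly these three. *)
  apply Rintable_ext with (fun x y =>
     (k (norm2 (pp (x - cx)) (pp (y - cy))) + k (norm2 (pp (x - cx)) (np (y - cy))))
   + (k (norm2 (np (x - cx)) (pp (y - cy))) + k (norm2 (np (x - cx)) (np (y - cy))))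
   - ((k (norm2 (pp (x - cx)) 0) + k (norm2 (np (x - cx)) 0))
     + (k (norm2 0 (pp (y - cy))) + k (norm2 0 (np (y - cy))) - k (norm2 0 0)))); auto.
  { intros x y _ _. unfold pp, np, Rmax.
    repeat destruct Rle_dec; try lra; rewrite ?norm2_opp_l, ?norm2_opp_r;
    try ring;
    repeat match goal with
    | h1 : ?u <= 0, h2 : - ?u <= 0 |- _ =>
        let E := fresh in assert (E : u = 0) by lra; rewrite E in *; clear h1 h2
    end; ring. }
  apply Rintable_minus; auto; [repeat apply Rintable_plus; auto|
    apply Rintable_plus; auto; [apply Rintable_plus|apply Rintable_minus]; auto].
  - apply Rintable_decr_decr; auto. intros; apply HK; apply Hpp; lra.
  - apply Rintable_decr_incr; auto. intros; apply HK; [apply Hpp|apply Hnp]; lra.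
  - apply Rintable_incr_decr; auto. intros; apply HK; [apply Hnp|apply Hpp]; lra.
  - apply Rintable_incr_incr; auto. intros; apply HK; apply Hnp; lra.
  - apply Rintable_decr_decr; auto. intros; apply HK; [apply Hpp|]; lra.
  - apply Rintable_incr_incr; auto. intros; apply HK; [apply Hnp|]; lra.
  - apply Rintable_plus; auto.
    + apply Rintable_decr_decr; auto. intros; apply HK; [|apply Hpp]; lra.
    + apply Rintable_incr_incr; auto. intros; apply HK; [|apply Hnp]; lra.
  - apply Rintable_const; auto.
Qed.

Definition cut (r cx cy : R) (f : R -> R -> R) (x y : R) : R :=
  if Rlt_dec r (dist2 x y cx cy) then f x y else 0.

Lemma Rintable_cut_radial k r cx cy a b c d : a < b -> c < d -> 0 < r ->
  (forall s t, 0 < s <= t -> k t <= k s) ->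
  Rintable (cut r cx cy (fun x y => k (dist2 x y cx cy))) a b c d.
Proof.
  intros Hab Hcd Hr Hk. unfold cut.
  apply Rintable_ext with (fun x y => k (Rmax r (dist2 x y cx cy))
     - k r * (if Rlt_dec r (dist2 x y cx cy) then 0 else 1)); auto.
  { intros x y _ _. unfold Rmax. destruct Rle_dec, Rlt_dec; try lra.
    replace (dist2 x y cx cy) with r by lra. ring. }
  apply Rintable_minus; auto; [|apply Rintable_scal; auto].
  - apply (Rintable_radial (fun t => k (Rmax r t))); auto. intros s t Hst. apply Hk.
    unfold Rmax; repeat destruct Rle_dec; lra.
  - apply (Rintable_radial (fun t => if Rlt_dec r t then 0 else 1)); auto. intros s t Hst.
    repeat destruct Rlt_dec; lra.
Qed.

Lemma Rintable_cut_mult f g r cx cy a b c d : a < b -> c < d ->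
  Rintable f a b c d -> Rintable (cut r cx cy g) a b c d ->
  Rintable (cut r cx cy (fun x y => f x y * g x y)) a b c d.
Proof.
  intros. apply Rintable_ext with (fun x y => f x y * cut r cx cy g x y); auto.
  - intros; unfold cut; destruct Rlt_dec; ring.
  - apply Rintable_mult; auto.
Qed.

(** * Uniqueness and linearity of box integrals *)

Lemma riemann2_unique f a b c d v v' : a < b -> c < d ->
  riemann2_val f a b c d v -> riemann2_val f a b c d v' -> v = v'.
Proof.
  intros Hab Hcd H H'. apply Rminus_diag_uniq.
  destruct (Req_dec (v - v') 0) as [E|E]; auto. exfalso.
  assert (He : 0 < Rabs (v - v') / 2) by (pose proof (Rabs_pos_lt _ E); lra).
  destruct (H _ He) as [N HN]. destruct (H' _ He) as [N' HN'].
  specialize (HN (S (max N N')) ltac:(lia) ltac:(lia) _ _ (tagged_left _ a b c d Hab Hcd)).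
  specialize (HN' (S (max N N')) ltac:(lia) ltac:(lia) _ _ (tagged_left _ a b c d Hab Hcd)).
  revert HN HN'. match goal with |- Rabs (?s - _) < _ -> _ => set (S0 := s) end.
  unfold Rabs; repeat destruct Rcase_abs; lra.
Qed.

(** The box integrals are [epsilon] choices, so the equality comes from uniqueness, once the
    right-hand side is shown to be a limit of Riemann sums of the combination. *)
Lemma box_int_lin f g k a b c d : a < b -> c < d ->
  Rintable f a b c d -> Rintable g a b c d ->
  box_int (fun x y => f x y + k * g x y) a b c d = box_int f a b c d + k * box_int g a b c d.
Proof.
  intros Hab Hcd Hf Hg.
  apply (riemann2_unique (fun x y => f x y + k * g x y) a b c d); auto.
  - apply Rintable_value; auto. apply Rintable_plus; auto. apply Rintable_scal; auto.
  - pose proof (Rintable_value _ _ _ _ _ Hab Hcd Hf) as Vf.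
    pose proof (Rintable_value _ _ _ _ _ Hab Hcd Hg) as Vg.
    intros e He.
    assert (He' : 0 < e / (2 * (Rabs k + 1))).
    { apply Rdiv_lt_0_compat; pose proof (Rabs_pos k); lra. }
    destruct (Vf (e / 2) ltac:(lra)) as [N1 H1]. destruct (Vg _ He') as [N2 H2].
    exists (max N1 N2). intros n Hn Hp tx ty T.
    specialize (H1 n ltac:(lia) Hp tx ty T). specialize (H2 n ltac:(lia) Hp tx ty T).
    change (sumR n (fun i => sumR n (fun j => f (tx i j) (ty i j) + k * g (tx i j) (ty i j))))
     with (dsum n (fun i j => f (tx i j) (ty i j) + k * g (tx i j) (ty i j))).
    rewrite dsum_plus, dsum_scal. unfold dsum.
    match type of H1 with Rabs (?s - ?w) < _ => set (d1 := s - w) in *; set (s1 := s) in * end.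
    match type of H2 with Rabs (?s - ?w) < _ => set (d2 := s - w) in *; set (s2 := s) in * end.
    match goal with |- Rabs ?t < _ => replace t with (d1 + k * d2)
      by (unfold d1, d2, s1, s2; ring) end.
    eapply Rle_lt_trans; [apply Rabs_triang|]. rewrite Rabs_mult.
    pose proof (Rabs_pos k). pose proof (Rabs_pos d2).
    assert (Rabs k * Rabs d2 <= Rabs k * (e / (2 * (Rabs k + 1)))) by (apply Rmult_le_compat_l; lra).
    assert (Rabs k * (e / (2 * (Rabs k + 1))) <= e / 2).
    { apply Rmult_le_reg_r with (Rabs k + 1); [lra|].
      replace (Rabs k * (e / (2 * (Rabs k + 1))) * (Rabs k + 1)) with (Rabs k * (e / 2)) by (field; lra).
      nra. }
    lra.
Qed.

Lemma box_int_ext f g a b c d : a < b -> c < d ->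
  (forall x y, f x y = g x y) -> Rintable f a b c d ->
  box_int f a b c d = box_int g a b c d.
Proof.
  intros Hab Hcd E Hf. apply (riemann2_unique g a b c d); auto.
  - intros e He. destruct (Rintable_value _ _ _ _ _ Hab Hcd Hf e He) as [N HN].
    exists N. intros n Hn Hp tx ty T. specialize (HN n Hn Hp tx ty T).
    change (Rabs (dsum n (fun i j => g (tx i j) (ty i j)) * ((b - a) / INR n) * ((d - c) / INR n)
      - box_int f a b c d) < e).
    rewrite (dsum_ext n _ (fun i j => f (tx i j) (ty i j))) by (intros; rewrite E; auto).
    exact HN.
  - apply Rintable_value; auto. apply Rintable_ext with f; auto.
Qed.

(** * Principal values as limits of symmetric Riemann sums *)

(** Folding about [(cx, cy)]: the integral of [f] over a centred square becomes an integral of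
    [quad f] over a quarter of it. In a principal value this is where the odd part cancels. *)
Definition quad (f : R -> R -> R) (cx cy xi eta : R) : R :=
  f (cx + xi) (cy + eta) + f (cx + xi) (cy - eta)
  + f (cx - xi) (cy + eta) + f (cx - xi) (cy - eta).

Definition qcut (r : R) (g : R -> R -> R) (xi eta : R) : R :=
  if Rlt_dec r (norm2 xi eta) then g xi eta else 0.

Definition loc_int (cx cy : R) (f : R -> R -> R) : Prop :=
  forall r Rr, 0 < r -> 0 < Rr ->
    Rintable (cut r cx cy f) (cx - Rr) (cx + Rr) (cy - Rr) (cy + Rr).

Definition trunc_int (cx cy : R) (f : R -> R -> R) (r Rr : R) : R :=
  box_int (fun x y => if Rlt_dec r (dist2 x y cx cy) then f x y else 0)
    (cx - Rr) (cx + Rr) (cy - Rr) (cy + Rr).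

Definition qsum (n : nat) (w : R) (g : R -> R -> R) (t : nat -> R) : R :=
  dsum n (fun k l => g (t k) (t l)) * w * w.

Lemma sumR_halves n f :
  sumR (n + n) f = sumR n (fun k => f (n + k)%nat + f (n - 1 - k)%nat).
Proof. rewrite sumR_app, sumR_plus, sumR_rev. ring. Qed.

(** Tags on the half-interval are mirrored about the centre to tag the grid with [2 n] cells per
    side. The excised disk is symmetric, so the four mirror images of a tag are cut or kept together
    and add up to one value of [quad]. *)
Lemma trunc_int_qsum cx cy f r Rr : loc_int cx cy f -> 0 < r -> 0 < Rr ->
  forall e, 0 < e -> exists N : nat, forall n, (N <= n)%nat -> (0 < n)%nat ->
    forall t, (forall k, (k < n)%nat -> INR k * (Rr / INR n) <= t k <= INR (S k) * (Rr / INR n)) ->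
    Rabs (qsum n (Rr / INR n) (qcut r (quad f cx cy)) t - trunc_int cx cy f r Rr) < e.
Proof.
  intros HL Hr HR e He.
  assert (HV := Rintable_value _ (cx - Rr) (cx + Rr) (cy - Rr) (cy + Rr)
    ltac:(lra) ltac:(lra) (HL r Rr Hr HR)).
  destruct (HV e He) as [N HN]. exists N. intros n Hn Hp t Ht.
  assert (Pn : 0 < INR n) by (apply lt_0_INR; lia).
  set (tt := fun c (i : nat) => if lt_dec i n then c - t (n - 1 - i)%nat else c + t (i - n)%nat).
  assert (Htt : forall c i, (i < n + n)%nat ->
     c - Rr + INR i * (c + Rr - (c - Rr)) / INR (n + n) <= tt c i
       <= c - Rr + INR (S i) * (c + Rr - (c - Rr)) / INR (n + n)).
  { intros c i Hi. unfold tt. rewrite S_INR, plus_INR.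
    replace (INR i * (c + Rr - (c - Rr)) / (INR n + INR n)) with (INR i * (Rr / INR n)) by (field; lra).
    replace ((INR i + 1) * (c + Rr - (c - Rr)) / (INR n + INR n))
      with ((INR i + 1) * (Rr / INR n)) by (field; lra).
    assert (E : Rr = INR n * (Rr / INR n)) by (field; lra).
    set (w := Rr / INR n) in *.
    destruct lt_dec.
    - specialize (Ht (n - 1 - i)%nat ltac:(lia)). rewrite S_INR, !minus_INR in Ht by lia.
      simpl INR in Ht. split; nra.
    - specialize (Ht (i - n)%nat ltac:(lia)). rewrite S_INR, minus_INR in Ht by lia. split; nra. }
  specialize (HN (n + n)%nat ltac:(lia) ltac:(lia) (fun i _ => tt cx i) (fun _ j => tt cy j)).
  match type of HN with ?P -> _ => assert (HT : P) by (intros i j Hi Hj; split; apply Htt; auto) end.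
  specialize (HN HT). fold (trunc_int cx cy f r Rr) in HN.
  unfold qsum. rewrite plus_INR in HN.
  replace ((cx + Rr - (cx - Rr)) / (INR n + INR n)) with (Rr / INR n) in HN by (field; lra).
  replace ((cy + Rr - (cy - Rr)) / (INR n + INR n)) with (Rr / INR n) in HN by (field; lra).
  match type of HN with Rabs (?s * _ * _ - _) < _ =>
    replace (dsum n (fun k l => qcut r (quad f cx cy) (t k) (t l))) with s; [exact HN|] end.
  rewrite sumR_halves. apply sumR_ext; intros k Hk. rewrite !sumR_halves, <- sumR_plus.
  apply sumR_ext; intros l Hl.
  assert (T1 : forall c k, (k < n)%nat -> tt c (n + k)%nat = c + t k).
  { intros c k0 h. unfold tt. destruct lt_dec; [lia|]. do 2 f_equal; lia. }
  assert (T2 : forall c k, (k < n)%nat -> tt c (n - 1 - k)%nat = c - t k).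
  { intros c k0 h. unfold tt. destruct lt_dec; [|lia]. do 2 f_equal; lia. }
  rewrite !T1, !T2 by auto. unfold cut, qcut, quad, dist2.
  replace (cx + t k - cx) with (t k) by ring. replace (cx - t k - cx) with (- t k) by ring.
  replace (cy + t l - cy) with (t l) by ring. replace (cy - t l - cy) with (- t l) by ring.
  rewrite !norm2_opp_l, !norm2_opp_r. destruct Rlt_dec; ring.
Qed.

Lemma nat_floor x : 0 <= x -> exists m : nat, INR m <= x < INR m + 1.
Proof.
  intros Hx. destruct (archimed x) as [H1 H2].
  assert (0 < up x)%Z by (apply lt_IZR; lra).
  exists (Z.to_nat (up x - 1)). rewrite INR_IZR_INZ, Z2Nat.id by lia.
  rewrite minus_IZR. lra.
Qed.

(** Room for two Riemann-sum errors and one mismatch between meshes. *)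
Lemma le_eps_3 x y : (forall e, 0 < e -> x <= y + 3 * e) -> x <= y.
Proof.
  intros H. destruct (Rle_dec x y) as [|Hn]; auto.
  specialize (H ((x - y) / 6) ltac:(lra)). lra.
Qed.

(** Right endpoints are strictly positive, so hypotheses on [quad] that are made only for positive
    coordinates can be used at every tag. *)
Lemma right_tags n Rr k : 0 < Rr -> (k < n)%nat ->
  INR k * (Rr / INR n) <= INR (S k) * (Rr / INR n) <= INR (S k) * (Rr / INR n).
Proof.
  intros HR Hk. rewrite S_INR.
  assert (0 < Rr / INR n) by (apply Rdiv_lt_0_compat; auto; apply lt_0_INR; lia). nra.
Qed.

Lemma trunc_int_anti_r cx cy f r r' Rr : loc_int cx cy f ->
  (forall xi eta, 0 < xi -> 0 < eta -> 0 <= quad f cx cy xi eta) ->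
  0 < r' <= r -> 0 < Rr -> trunc_int cx cy f r Rr <= trunc_int cx cy f r' Rr.
Proof.
  intros HL Hq Hr HR. apply le_eps_3; intros e He.
  destruct (trunc_int_qsum cx cy f r Rr HL ltac:(lra) HR e He) as [N1 H1].
  destruct (trunc_int_qsum cx cy f r' Rr HL ltac:(lra) HR e He) as [N2 H2].
  set (n := S (max N1 N2)).
  assert (W : 0 < Rr / INR n) by (apply Rdiv_lt_0_compat; auto; apply lt_0_INR; lia).
  specialize (H1 n ltac:(lia) ltac:(lia) _ (fun k => right_tags n Rr k HR)).
  specialize (H2 n ltac:(lia) ltac:(lia) _ (fun k => right_tags n Rr k HR)).
  assert (qsum n (Rr / INR n) (qcut r (quad f cx cy)) (fun k => INR (S k) * (Rr / INR n))
       <= qsum n (Rr / INR n) (qcut r' (quad f cx cy)) (fun k => INR (S k) * (Rr / INR n))).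
  { unfold qsum. do 2 (apply Rmult_le_compat_r; [lra|]). apply dsum_le; intros i j _ _.
    unfold qcut.
    pose proof (Hq (INR (S i) * (Rr / INR n)) (INR (S j) * (Rr / INR n))
      ltac:(apply Rmult_lt_0_compat; auto; apply lt_0_INR; lia)
      ltac:(apply Rmult_lt_0_compat; auto; apply lt_0_INR; lia)).
    repeat destruct Rlt_dec; lra. }
  apply Rabs_def2 in H1. apply Rabs_def2 in H2. lra.
Qed.

Lemma dsum_widen n m g : (m <= n)%nat ->
  (forall i j, (i < n)%nat -> (j < n)%nat -> 0 <= g i j) -> dsum m g <= dsum n g.
Proof.
  intros Hmn Hg. replace n with (m + (n - m))%nat by lia. unfold dsum.
  rewrite sumR_app.
  assert (forall i, (i < n)%nat -> sumR m (fun j => g i j) <= sumR (m + (n - m)) (fun j => g i j)).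
  { intros. rewrite sumR_app. pose proof (sumR_nonneg (n - m) (fun j => g i (m + j)%nat)
      ltac:(intros; apply Hg; lia)). lra. }
  pose proof (sumR_nonneg (n - m) (fun i => sumR (m + (n - m)) (fun j => g (m + i)%nat j))
    ltac:(intros; apply sumR_nonneg; intros; apply Hg; lia)).
  pose proof (sumR_le m (fun i => sumR m (fun j => g i j))
     (fun i => sumR (m + (n - m)) (fun j => g i j)) ltac:(intros; apply H; lia)). lra.
Qed.

(* With [m = floor (n R / R')], the points [(k+1) R' / n], [k < m], are tags both for the
   [n]-grid of [[0, R']] and for the [m]-grid of [[0, R]]. *)
Lemma trunc_int_mono_R cx cy f r Rr Rr' : loc_int cx cy f ->
  (forall xi eta, 0 < xi -> 0 < eta -> 0 <= quad f cx cy xi eta) ->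
  0 < r -> 0 < Rr <= Rr' -> trunc_int cx cy f r Rr <= trunc_int cx cy f r Rr'.
Proof.
  intros HL Hq Hr [HR HRR]. apply le_eps_3; intros e He.
  set (V := trunc_int cx cy f r Rr). assert (HR' : 0 < Rr') by lra.
  destruct (trunc_int_qsum cx cy f r Rr HL Hr HR e He) as [N1 H1].
  destruct (trunc_int_qsum cx cy f r Rr' HL Hr ltac:(lra) e He) as [N2 H2].
  fold V in H1.
  (* [N3] makes the relative mesh error [2 / (m + 1)] of a sum of size at most [Rabs V + e] cost at
     most [e]; [N4] makes [m] exceed both [N1] and [N3]. *)
  destruct (archimed_nat (2 * (Rabs V + e) / e)) as [N3 HN3].
  destruct (archimed_nat ((INR (S (N1 + N3)) + 1) * Rr' / Rr)) as [N4 HN4].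
  set (n := S (max N2 N4)).
  assert (Pn : 0 < INR n) by (apply lt_0_INR; lia).
  set (w := Rr' / INR n) in *.
  assert (W : 0 < w) by (apply Rdiv_lt_0_compat; lra).
  destruct (nat_floor (Rr / w)) as [m [Hm1 Hm2]].
  { left; apply Rdiv_lt_0_compat; lra. }
  assert (HmR : INR m * w <= Rr < (INR m + 1) * w).
  { split.
    - apply Rmult_le_compat_r with (r := w) in Hm1; [|lra].
      replace (Rr / w * w) with Rr in Hm1 by (field; lra). lra.
    - apply Rmult_lt_compat_r with (r := w) in Hm2; [|lra].
      replace (Rr / w * w) with Rr in Hm2 by (field; lra). lra. }
  assert (Hnw : INR n * w = Rr') by (unfold w; field; lra).
  assert (Hmn : (m <= n)%nat) by (apply INR_le; nra).
  assert (Hmbig : (S (N1 + N3) <= m)%nat).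
  { apply INR_le.
    assert ((INR (S (N1 + N3)) + 1) * Rr' / Rr < INR n).
    { eapply Rlt_trans; [apply HN4|]. apply lt_INR; lia. }
    apply Rmult_lt_compat_r with (r := Rr) in H; auto.
    replace ((INR (S (N1 + N3)) + 1) * Rr' / Rr * Rr) with ((INR (S (N1 + N3)) + 1) * Rr')
      in H by (field; lra).
    assert ((INR (S (N1 + N3)) + 1) * Rr' < (INR m + 1) * Rr') by nra.
    apply Rmult_lt_reg_r in H0; lra. }
  assert (Pm : 0 < INR m) by (apply lt_0_INR; lia).
  set (t := fun k => INR (S k) * w).
  assert (Ht : forall k, (k < m)%nat -> INR k * (Rr / INR m) <= t k <= INR (S k) * (Rr / INR m)).
  { intros k Hk. unfold t.
    assert (Hw : w <= Rr / INR m).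
    { apply Rmult_le_reg_r with (INR m); auto.
      replace (Rr / INR m * INR m) with Rr by (field; lra). lra. }
    assert (Hw2 : INR m * (Rr / INR m) = Rr) by (field; lra).
    set (w' := Rr / INR m) in *. rewrite S_INR. pose proof (pos_INR k).
    assert (INR k + 1 <= INR m) by (rewrite <- S_INR; apply le_INR; lia).
    assert (INR m * (w' - w) <= w) by lra. split; nra. }
  assert (tpos : forall k, 0 < t k) by (intros; apply Rmult_lt_0_compat; auto; apply lt_0_INR; lia).
  assert (gpos : forall k l, 0 <= qcut r (quad f cx cy) (t k) (t l)).
  { intros. unfold qcut. destruct Rlt_dec; [apply Hq; auto|lra]. }
  specialize (H1 m ltac:(lia) ltac:(lia) t Ht).
  specialize (H2 n ltac:(lia) ltac:(lia) _ (fun k => right_tags n Rr' k HR')).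
  fold w in H2. fold t in H2.
  unfold qsum in H1, H2.
  pose proof (dsum_widen n m (fun k l => qcut r (quad f cx cy) (t k) (t l)) Hmn
    ltac:(intros; apply gpos)) as Hw.
  set (Sm := dsum m (fun k l => qcut r (quad f cx cy) (t k) (t l))) in *.
  set (Sn := dsum n (fun k l => qcut r (quad f cx cy) (t k) (t l))) in *.
  assert (P0 : 0 <= Sm) by (apply dsum_nonneg; intros; apply gpos).
  set (X := Sm * (Rr / INR m) * (Rr / INR m)) in *.
  assert (HX : X <= Rabs V + e).
  { apply Rabs_def2 in H1. pose proof (Rle_abs V). lra. }
  assert (HX0 : 0 <= X).
  { unfold X. assert (0 < Rr / INR m) by (apply Rdiv_lt_0_compat; lra).
    apply Rmult_le_pos; [apply Rmult_le_pos|]; lra. }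
  (* The [m]-grid has mesh [Rr / m], the [n]-grid mesh [w], and [Rr < (m + 1) w]. Replacing the
     first mesh by the second costs at most the factor [q^2 >= 1 - 2 / (m + 1)] with
     [q = m / (m + 1)]. *)
  assert (Hwm : INR m / (INR m + 1) * (Rr / INR m) <= w).
  { apply Rmult_le_reg_r with (INR m + 1); [lra|].
    replace (INR m / (INR m + 1) * (Rr / INR m) * (INR m + 1)) with Rr by (field; lra). lra. }
  assert (HXn : X - 2 / (INR m + 1) * X <= Sn * w * w).
  { apply Rle_trans with (Sm * w * w).
    2:{ do 2 (apply Rmult_le_compat_r; [lra|]). exact Hw. }
    set (q := INR m / (INR m + 1)) in *. set (w' := Rr / INR m) in *.
    assert (Eq : 2 / (INR m + 1) = 2 * (1 - q)) by (unfold q; field; lra).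
    assert (0 < w') by (apply Rdiv_lt_0_compat; lra).
    assert (0 < q) by (apply Rdiv_lt_0_compat; lra).
    apply Rle_trans with (q * q * X).
    { rewrite Eq. assert (0 <= (1 - q) * (1 - q)) by nra. nra. }
    unfold X. replace (q * q * (Sm * w' * w')) with (Sm * ((q * w') * (q * w'))) by ring.
    rewrite (Rmult_assoc Sm). apply Rmult_le_compat_l; auto.
    apply Rmult_le_compat; auto; left; apply Rmult_lt_0_compat; auto. }
  assert (H2X : 2 / (INR m + 1) * X <= e).
  { apply Rmult_le_reg_r with (INR m + 1); [lra|].
    replace (2 / (INR m + 1) * X * (INR m + 1)) with (2 * X) by (field; lra).
    assert (INR N3 <= INR m) by (apply le_INR; lia).
    apply Rmult_lt_compat_r with (r := e) in HN3; auto.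
    replace (2 * (Rabs V + e) / e * e) with (2 * (Rabs V + e)) in HN3 by (field; lra). nra. }
  apply Rabs_def2 in H1. apply Rabs_def2 in H2. lra.
Qed.

(** * Existence of improper integrals *)

Definition integral2_val (cx cy : R) (f : R -> R -> R) (v : R) : Prop :=
  forall e, 0 < e -> exists d, 0 < d /\ exists M, 0 < M /\
    forall r Rr, 0 < r < d -> M < Rr -> Rabs (trunc_int cx cy f r Rr - v) < e.

Lemma integral2_spec cx cy f v :
  integral2_val cx cy f v -> integral2_val cx cy f (integral2 cx cy f).
Proof.
  intros H. apply (epsilon_spec (inhabits 0) (integral2_val cx cy f)). exists v; exact H.
Qed.

(** Monotonicity in both truncation parameters turns the supremum of the truncated integrals into
    their joint limit: a value close to it, once reached at [(r0, R0)], is kept for all smaller [r]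
    and larger [Rr]. *)
Lemma integral2_nonneg_ex cx cy f B : loc_int cx cy f ->
  (forall xi eta, 0 < xi -> 0 < eta -> 0 <= quad f cx cy xi eta) ->
  (forall r Rr, 0 < r -> 0 < Rr -> trunc_int cx cy f r Rr <= B) ->
  exists v, integral2_val cx cy f v.
Proof.
  intros HL Hq HB.
  set (E := fun z => exists r Rr, 0 < r /\ 0 < Rr /\ z = trunc_int cx cy f r Rr).
  destruct (completeness E) as [v [Hub Hlub]].
  { exists B. intros z [r [Rr [h1 [h2 ->]]]]. auto. }
  { exists (trunc_int cx cy f 1 1), 1, 1. repeat split; lra. }
  exists v. intros e He.
  assert (Hex : exists r Rr, 0 < r /\ 0 < Rr /\ v - e < trunc_int cx cy f r Rr).
  { apply NNPP. intros Hn. assert (v <= v - e); [|lra]. apply Hlub.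
    intros z [r [Rr [h1 [h2 ->]]]]. apply Rnot_lt_le. intros h. apply Hn. exists r, Rr. auto. }
  destruct Hex as [r0 [R0 [h1 [h2 h3]]]].
  exists r0. split; auto. exists R0. split; auto. intros r Rr Hr HR.
  assert (trunc_int cx cy f r Rr <= v).
  { apply Hub. exists r, Rr. repeat split; lra. }
  assert (trunc_int cx cy f r0 R0 <= trunc_int cx cy f r Rr).
  { eapply Rle_trans; [apply (trunc_int_mono_R _ _ _ _ R0 Rr)|apply trunc_int_anti_r]; auto; lra. }
  apply Rabs_def1; lra.
Qed.

Lemma loc_int_lin cx cy f g k : loc_int cx cy f -> loc_int cx cy g ->
  loc_int cx cy (fun x y => f x y + k * g x y).
Proof.
  intros Hf Hg r Rr Hr HR.
  apply Rintable_ext with (fun x y => cut r cx cy f x y + k * cut r cx cy g x y); try lra.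
  - intros; unfold cut; destruct Rlt_dec; ring.
  - apply Rintable_plus; try lra; auto. apply Rintable_scal; try lra; auto.
Qed.

Lemma trunc_int_lin cx cy f g k r Rr : loc_int cx cy f -> loc_int cx cy g ->
  0 < r -> 0 < Rr ->
  trunc_int cx cy (fun x y => f x y + k * g x y) r Rr
  = trunc_int cx cy f r Rr + k * trunc_int cx cy g r Rr.
Proof.
  intros Hf Hg Hr HR. unfold trunc_int.
  pose proof (box_int_lin _ _ k (cx - Rr) (cx + Rr) (cy - Rr) (cy + Rr) ltac:(lra) ltac:(lra) (Hf r Rr Hr HR) (Hg r Rr Hr HR)) as E.
  change (fun x y => if Rlt_dec r (dist2 x y cx cy) then f x y else 0) with (cut r cx cy f).
  change (fun x y => if Rlt_dec r (dist2 x y cx cy) then g x y else 0) with (cut r cx cy g).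
  rewrite <- E. apply box_int_ext; try lra.
  - intros; unfold cut; destruct Rlt_dec; ring.
  - apply (loc_int_lin cx cy f g k Hf Hg r Rr Hr HR).
Qed.

(* The upper bound is tested on right-endpoint tags, away from the axes. *)
Lemma trunc_int_le cx cy f r Rr B : loc_int cx cy f -> 0 < r -> 0 < Rr ->
  (forall n, (0 < n)%nat ->
     qsum n (Rr / INR n) (qcut r (quad f cx cy)) (fun k => INR (S k) * (Rr / INR n)) <= B) ->
  trunc_int cx cy f r Rr <= B.
Proof.
  intros HL Hr HR HB. apply le_eps_3; intros e He.
  destruct (trunc_int_qsum cx cy f r Rr HL Hr HR e He) as [N HN].
  specialize (HN (S N) ltac:(lia) ltac:(lia) _ (fun k => right_tags (S N) Rr k HR)).
  specialize (HB (S N) ltac:(lia)). apply Rabs_def2 in HN. lra.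
Qed.

(* If [quad f] is dominated by a radial kernel with bounded truncated integrals, then
   [f + C k] and [C k] are nonnegative after symmetrization, so both limits exist by monotonicity. *)
Lemma integral2_dominated_ex cx cy f k C B : loc_int cx cy f -> 0 <= C ->
  (forall s, 0 <= k s) -> (forall s t, 0 < s <= t -> k t <= k s) ->
  (forall r Rr, 0 < r -> 0 < Rr ->
     trunc_int cx cy (fun x y => k (dist2 x y cx cy)) r Rr <= B) ->
  (forall xi eta, 0 < xi -> 0 < eta -> Rabs (quad f cx cy xi eta) <= C * k (norm2 xi eta)) ->
  exists v, integral2_val cx cy f v.
Proof.
  intros HL HC Hk0 Hk HB Hq.
  set (g := fun x y => k (dist2 x y cx cy)) in *.
  assert (Hg : loc_int cx cy g).
  { intros r Rr Hr HR. apply Rintable_cut_radial; auto; lra. }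
  assert (Hgq : forall xi eta, quad g cx cy xi eta = 4 * k (norm2 xi eta)).
  { intros. unfold quad, g, dist2.
    replace (cx + xi - cx) with xi by ring. replace (cx - xi - cx) with (- xi) by ring.
    replace (cy + eta - cy) with eta by ring. replace (cy - eta - cy) with (- eta) by ring.
    rewrite !norm2_opp_l, !norm2_opp_r. ring. }
  assert (Hq' : forall h, quad (fun x y => f x y + h * g x y) cx cy
     = fun xi eta => quad f cx cy xi eta + h * (4 * k (norm2 xi eta))).
  { intros h. apply functional_extensionality; intros xi.
    apply functional_extensionality; intros eta. rewrite <- Hgq. unfold quad. ring. }
  destruct (integral2_nonneg_ex cx cy g B) as [v1 H1]; auto.
  { intros. rewrite Hgq. specialize (Hk0 (norm2 xi eta)). lra. }
  (* [quad g] is four times [k], hence the factor [C / 4]. The bound is [C / 2 * B] because [f]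
     itself contributes at most as much as [C / 4 * g]. *)
  destruct (integral2_nonneg_ex cx cy (fun x y => f x y + C / 4 * g x y) (C / 2 * B)) as [v2 H2].
  - apply loc_int_lin; auto.
  - intros xi eta h1 h2. rewrite Hq'. specialize (Hq xi eta h1 h2). apply Rabs_le_inv in Hq. lra.
  - intros r Rr Hr HR.
    apply Rle_trans with (C / 2 * trunc_int cx cy g r Rr).
    2:{ apply Rmult_le_compat_l; [lra|auto]. }
    rewrite trunc_int_lin by auto.
    cut (trunc_int cx cy f r Rr + (- (C / 4)) * trunc_int cx cy g r Rr <= 0); [lra|].
    rewrite <- trunc_int_lin by auto. apply trunc_int_le; auto; [apply loc_int_lin; auto|].
    intros n Hn. rewrite Hq'.
    assert (W : 0 < Rr / INR n) by (apply Rdiv_lt_0_compat; auto; apply lt_0_INR; lia).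
    unfold qsum. assert (forall X, X <= 0 -> X * (Rr / INR n) * (Rr / INR n) <= 0).
    { intros. assert (0 < (Rr / INR n) * (Rr / INR n)) by nra. nra. }
    apply H. replace 0 with (dsum n (fun _ _ => 0)) by (rewrite dsum_const; ring).
    apply dsum_le; intros i j _ _. unfold qcut. destruct Rlt_dec; [|lra].
    specialize (Hq (INR (S i) * (Rr / INR n)) (INR (S j) * (Rr / INR n))
      ltac:(apply Rmult_lt_0_compat; auto; apply lt_0_INR; lia)
      ltac:(apply Rmult_lt_0_compat; auto; apply lt_0_INR; lia)).
    apply Rabs_le_inv in Hq. lra.
  - exists (v2 - C / 4 * v1). intros e He.
    assert (He' : 0 < e / (C + 1) ) by (apply Rdiv_lt_0_compat; lra).
    destruct (H1 _ He') as [d1 [P1 [M1 [Q1 T1]]]].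
    destruct (H2 (e / 2) ltac:(lra)) as [d2 [P2 [M2 [Q2 T2]]]].
    exists (Rmin d1 d2). split; [apply Rmin_glb_lt; auto|].
    exists (Rmax M1 M2). split; [eapply Rlt_le_trans; [apply Q1|apply Rmax_l]|].
    intros r Rr [Hr Hr'] HR.
    pose proof (Rmin_l d1 d2). pose proof (Rmin_r d1 d2).
    pose proof (Rmax_l M1 M2). pose proof (Rmax_r M1 M2).
    specialize (T1 r Rr ltac:(lra) ltac:(lra)). specialize (T2 r Rr ltac:(lra) ltac:(lra)).
    rewrite trunc_int_lin in T2 by (auto; lra).
    set (a := trunc_int cx cy f r Rr) in *. set (b := trunc_int cx cy g r Rr) in *.
    replace (a - (v2 - C / 4 * v1)) with ((a + C / 4 * b - v2) + (- (C / 4)) * (b - v1)) by ring.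
    eapply Rle_lt_trans; [apply Rabs_triang|]. rewrite Rabs_mult, Rabs_Ropp, (Rabs_right (C / 4)) by lra.
    assert (C / 4 * Rabs (b - v1) <= C / 4 * (e / (C + 1))) by (apply Rmult_le_compat_l; lra).
    assert (C / 4 * (e / (C + 1)) <= e / 4).
    { apply Rmult_le_reg_r with (C + 1); [lra|].
      replace (C / 4 * (e / (C + 1)) * (C + 1)) with (C * (e / 4)) by (field; lra). nra. }
    lra.
Qed.


(** * One-dimensional sums and the dominating kernel *)

Lemma Rpower_pos x q : 0 < Rpower x q.
Proof. apply exp_pos. Qed.

Lemma Rpower_anti q s t : q <= 0 -> 0 < s <= t -> Rpower t q <= Rpower s q.
Proof.
  intros Hq [Hs Ht]. replace q with (- - q) by ring. rewrite !(Rpower_Ropp _ (- q)).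
  apply Rinv_le_contravar; [apply Rpower_pos|]. apply Rle_Rpower_l; lra.
Qed.

(** Integral comparison for a decreasing [P] that may blow up at 0. The mean value theorem handles
    all cells but the first; there [t * P t <= Phi t] stands in for integrability at 0, so no limit
    at 0 is taken. *)
Lemma sum_decr_le P Phi : (forall s t, 0 < s <= t -> P t <= P s) ->
  (forall t, 0 < t -> derivable_pt_lim Phi t (P t)) ->
  (forall t, 0 < t -> t * P t <= Phi t) ->
  forall w n, 0 < w -> (0 < n)%nat ->
  sumR n (fun k => w * P (INR (S k) * w)) <= Phi (INR n * w).
Proof.
  intros HP HD H0 w n Hw Hn. destruct n as [|n]; [lia|]. clear Hn.
  induction n as [|n IH].
  - simpl. rewrite Rplus_0_l. replace (1 * w) with w by ring. apply H0; auto.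
  - cbn [sumR] in *. set (s := INR (S n) * w) in *.
    assert (Hs : 0 < s) by (apply Rmult_lt_0_compat; auto; apply lt_0_INR; lia).
    replace (INR (S (S n)) * w) with (s + w) by (unfold s; rewrite (S_INR (S n)); ring).
    destruct (MVT_cor2 Phi P s (s + w) ltac:(lra)) as [c [E Hc]].
    { intros c Hc. apply HD; lra. }
    assert (HPc : P (s + w) <= P c). { apply HP; lra. } nra.
Qed.

(** Serves twice: with [q = al / 2] for the weight on the corner cell, and with [q = 1 - eps / 2]
    for the sum of the cell errors. *)
Lemma sum_Rpower_le q w n : 0 <= q < 1 -> 0 < w -> (0 < n)%nat ->
  sumR n (fun k => w * Rpower (INR (S k) * w) (- q)) <= Rpower (INR n * w) (1 - q) / (1 - q).
Proof.
  intros Hq Hw Hn.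
  apply (sum_decr_le (fun t => Rpower t (- q)) (fun t => Rpower t (1 - q) / (1 - q))); auto.
  - intros; apply Rpower_anti; lra.
  - intros t Ht.
    replace (Rpower t (- q)) with (/ (1 - q) * ((1 - q) * Rpower t (1 - q - 1))).
    2:{ replace (1 - q - 1) with (- q) by ring. field; lra. }
    replace (fun t => Rpower t (1 - q) / (1 - q)) with (mult_real_fct (/ (1 - q)) (fun t => Rpower t (1 - q))).
    2:{ apply functional_extensionality; intros. unfold mult_real_fct. field; lra. }
    apply derivable_pt_lim_scal, derivable_pt_lim_power; auto.
  - intros t Ht. rewrite <- (Rpower_1 t) at 1 by auto. rewrite <- Rpower_plus.
    replace (1 + - q) with (1 - q) by ring. pose proof (Rpower_pos t (1 - q)).
    apply Rmult_le_reg_r with (1 - q); [lra|].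
    unfold Rdiv. rewrite Rmult_assoc, Rinv_l by lra. nra.
Qed.

(* [Pker a] is, up to the factor [a], the derivative of [t^a / (1 + t^a)]; its square is a
   radial kernel integrable over the plane, comparable with [rho^(-al)] near 0 and dominating
   [rho^(-2-al)] at infinity when [a <= al/2] and [a <= 1 - al/2]. *)
Definition Pker (a t : R) : R := Rpower t (a - 1) / ((1 + Rpower t a) * (1 + Rpower t a)).

Lemma Pker_pos a t : 0 < Pker a t.
Proof.
  pose proof (Rpower_pos t a). apply Rdiv_lt_0_compat; [apply Rpower_pos|nra].
Qed.

Lemma Pker_anti a s t : 0 < a < 1 -> 0 < s <= t -> Pker a t <= Pker a s.
Proof.
  intros Ha Hst. pose proof (Rpower_pos s a). pose proof (Rpower_pos t a).
  pose proof (Rle_Rpower_l s t a ltac:(lra) Hst).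
  apply Rmult_le_compat; [left; apply Rpower_pos| |apply Rpower_anti; lra|].
  - left; apply Rinv_0_lt_compat; nra.
  - apply Rinv_le_contravar; nra.
Qed.

(** The antiderivative [t^a / (1 + t^a)] stays below 1, so the bound depends neither on the mesh nor
    on the length of the range. *)
Lemma sum_Pker_le a w n : 0 < a < 1 -> 0 < w -> (0 < n)%nat ->
  sumR n (fun k => w * Pker a (INR (S k) * w)) <= / a.
Proof.
  intros Ha Hw Hn.
  assert (H : sumR n (fun k => w * (a * Pker a (INR (S k) * w)))
    <= Rpower (INR n * w) a / (1 + Rpower (INR n * w) a)).
  { apply (sum_decr_le (fun t => a * Pker a t) (fun t => Rpower t a / (1 + Rpower t a))); auto.
    - intros. apply Rmult_le_compat_l; [lra|]. apply Pker_anti; auto.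
    - intros t Ht. pose proof (Rpower_pos t a).
      replace (a * Pker a t) with
        ((a * Rpower t (a - 1) * (1 + Rpower t a) - (0 + a * Rpower t (a - 1)) * Rpower t a)
          / Rsqr (1 + Rpower t a)).
      2:{ unfold Pker, Rsqr. field. lra. }
      apply (derivable_pt_lim_div (fun t => Rpower t a) (fun t => 1 + Rpower t a)).
      + apply derivable_pt_lim_power; auto.
      + apply (derivable_pt_lim_plus (fun _ => 1) (fun t => Rpower t a)).
        * apply derivable_pt_lim_const.
        * apply derivable_pt_lim_power; auto.
      + lra.
    - intros t Ht. pose proof (Rpower_pos t a).
      replace (t * (a * Pker a t)) with (a * (Rpower t a / ((1 + Rpower t a) * (1 + Rpower t a)))).
      2:{ unfold Pker. replace (Rpower t a) with (t * Rpower t (a - 1)) at 1.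
          - field. lra.
          - rewrite <- (Rpower_1 t) at 1 by auto. rewrite <- Rpower_plus. f_equal; ring. }
      assert (0 < / (1 + Rpower t a) <= 1).
      { split; [apply Rinv_0_lt_compat; lra|]. rewrite <- Rinv_1 at 2. apply Rinv_le_contravar; lra. }
      unfold Rdiv. rewrite Rinv_mult. set (z := / (1 + Rpower t a)) in *.
      assert (a * z <= 1) by nra. assert (0 < Rpower t a * z) by nra. nra. }
  rewrite (sumR_ext n _ (fun k => a * (w * Pker a (INR (S k) * w)))) in H by (intros; ring).
  rewrite sumR_scal in H. pose proof (Rpower_pos (INR n * w) a).
  assert (Rpower (INR n * w) a / (1 + Rpower (INR n * w) a) <= 1).
  { apply Rmult_le_reg_r with (1 + Rpower (INR n * w) a); [lra|].
    unfold Rdiv; rewrite Rmult_assoc, Rinv_l; lra. }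
  apply Rmult_le_reg_l with a; [lra|]. rewrite Rinv_r; lra.
Qed.

Definition ker (a s : R) : R := Pker a s * Pker a s.

Lemma ker_nonneg a s : 0 <= ker a s.
Proof. pose proof (Pker_pos a s). unfold ker; nra. Qed.

Lemma ker_anti a s t : 0 < a < 1 -> 0 < s <= t -> ker a t <= ker a s.
Proof.
  intros Ha Hst. pose proof (Pker_anti a s t Ha Hst). pose proof (Pker_pos a t).
  unfold ker; nra.
Qed.

Lemma loc_int_ker a cx cy : 0 < a < 1 -> loc_int cx cy (fun x y => ker a (dist2 x y cx cy)).
Proof.
  intros Ha r Rr Hr HR. apply Rintable_cut_radial; try lra. intros; apply ker_anti; auto.
Qed.

Lemma quad_radial k cx cy xi eta :
  quad (fun x y => k (dist2 x y cx cy)) cx cy xi eta = 4 * k (norm2 xi eta).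
Proof.
  unfold quad, dist2.
  replace (cx + xi - cx) with xi by ring. replace (cx - xi - cx) with (- xi) by ring.
  replace (cy + eta - cy) with eta by ring. replace (cy - eta - cy) with (- eta) by ring.
  rewrite !norm2_opp_l, !norm2_opp_r. ring.
Qed.

(** The norm dominates both coordinates and [Pker] is antitone, so [ker a] of the norm is at most
    [Pker a x * Pker a y], and the double sum factors into one-dimensional ones. The 4 counts the
    reflections. *)
Lemma ker_trunc_le a cx cy r Rr : 0 < a < 1 -> 0 < r -> 0 < Rr ->
  trunc_int cx cy (fun x y => ker a (dist2 x y cx cy)) r Rr <= 4 * (/ a * / a).
Proof.
  intros Ha Hr HR. apply trunc_int_le; auto using loc_int_ker. intros n Hn.
  assert (Pn : 0 < INR n) by (apply lt_0_INR; lia).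
  assert (W : 0 < Rr / INR n) by (apply Rdiv_lt_0_compat; auto).
  set (w := Rr / INR n) in *. unfold qsum.
  pose proof (sum_Pker_le a w n Ha W Hn) as HS.
  set (s := sumR n (fun k => w * Pker a (INR (S k) * w))) in *.
  assert (0 <= s).
  { apply sumR_nonneg; intros. pose proof (Pker_pos a (INR (S i) * w)). nra. }
  apply Rle_trans with (4 * (s * s)).
  2:{ apply Rmult_le_compat_l; [lra|]. apply Rmult_le_compat; auto. }
  unfold s. rewrite <- dsum_prod, <- dsum_scal.
  rewrite Rmult_assoc, (Rmult_comm (dsum _ _)), <- dsum_scal. apply dsum_le; intros i j Hi Hj.
  assert (forall k, 0 < INR (S k) * w) by (intros; apply Rmult_lt_0_compat; auto; apply lt_0_INR; lia).
  set (x := INR (S i) * w) in *. set (y := INR (S j) * w) in *.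
  replace (4 * (w * Pker a x * (w * Pker a y))) with ((w * w) * (4 * (Pker a x * Pker a y))) by ring.
  apply Rmult_le_compat_l; [nra|]. unfold qcut.
  pose proof (Pker_pos a x). pose proof (Pker_pos a y).
  destruct Rlt_dec; [|nra]. rewrite quad_radial. apply Rmult_le_compat_l; [lra|].
  pose proof (Pker_pos a (norm2 x y)).
  apply Rmult_le_compat; try lra; apply Pker_anti; auto; split; unfold x, y; auto.
  - apply norm2_ge_l.
  - apply norm2_ge_r.
Qed.

Lemma Rpower_split x p q s : p = q + s -> Rpower x p = Rpower x q * Rpower x s.
Proof. intros ->. apply Rpower_plus. Qed.

(** [s^(-al) = s^(2 (a - 1)) s^(2 - 2 a - al)], where the last exponent is nonnegative and [s <= M]
    bounds that power; [z^4] absorbs the denominator [(1 + s^a)^4] of [ker]. *)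
Lemma ker_near al a M : 0 < a < 1 -> a <= 1 - al / 2 -> 0 < M ->
  exists C, 0 <= C /\ forall s, 0 < s <= M -> Rpower s (- al) <= C * ker a s.
Proof.
  intros Ha Hal HM. set (z := 1 + Rpower M a).
  exists (Rpower M (2 - 2 * a - al) * (z * z * z * z)).
  pose proof (Rpower_pos M a). pose proof (Rpower_pos M (2 - 2 * a - al)).
  assert (0 < z) by (unfold z; lra).
  assert (0 < z * z * z * z) by (repeat apply Rmult_lt_0_compat; auto).
  split; [nra|]. intros s Hs. unfold ker, Pker.
  rewrite (Rpower_split s (- al) (a - 1) ((a - 1) + (2 - 2 * a - al))) by ring.
  rewrite (Rpower_plus (a - 1)).
  pose proof (Rpower_pos s a). pose proof (Rle_Rpower_l s M a ltac:(lra) Hs).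
  pose proof (Rle_Rpower_l s M (2 - 2 * a - al) ltac:(lra) Hs).
  pose proof (Rpower_pos s (2 - 2 * a - al)). pose proof (Rpower_pos s (a - 1)).
  set (y := 1 + Rpower s a). set (p := Rpower s (a - 1)) in *.
  assert (Hy : 0 < y <= z) by (unfold y, z; lra).
  replace (Rpower M (2 - 2 * a - al) * (z * z * z * z) * (p / (y * y) * (p / (y * y))))
    with (p * (p * (Rpower M (2 - 2 * a - al) * ((z / y) * (z / y) * ((z / y) * (z / y))))))
    by (field; lra).
  apply Rmult_le_compat_l; [lra|]. apply Rmult_le_compat_l; [lra|].
  assert (1 <= z / y).
  { apply Rmult_le_reg_r with y; [lra|]. unfold Rdiv; rewrite Rmult_assoc, Rinv_l; lra. }
  assert (1 <= z / y * (z / y)) by nra. assert (1 <= z / y * (z / y) * (z / y * (z / y))) by nra.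
  nra.
Qed.

(** Writing [1 + s^a = s^a (1 + s^(-a))] shows that [ker] decays like [s^(-2 - 2 a)], while
    [s^(-2 - al)] carries the further factor [s^(2 a - al)] of nonpositive exponent; [z^4] absorbs
    [(1 + s^(-a))^4]. *)
Lemma ker_far al a M : 0 < a < 1 -> a <= al / 2 -> 0 < M ->
  exists C, 0 <= C /\ forall s, M <= s -> Rpower s (- (2 + al)) <= C * ker a s.
Proof.
  intros Ha Hal HM. set (z := Rpower M (- a) + 1).
  exists (Rpower M (2 * a - al) * (z * z * z * z)).
  pose proof (Rpower_pos M (- a)). pose proof (Rpower_pos M (2 * a - al)).
  assert (0 < z) by (unfold z; lra).
  assert (0 < z * z * z * z) by (repeat apply Rmult_lt_0_compat; auto).
  split; [nra|]. intros s Hs. unfold ker, Pker.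
  rewrite (Rpower_split s (- (2 + al)) (a - 1) ((a - 1) +
    ((2 * a - al) + (- a + (- a + (- a + - a)))))) by ring.
  rewrite !Rpower_plus.
  pose proof (Rpower_pos s a). pose proof (Rpower_anti (- a) M s ltac:(lra) ltac:(lra)).
  pose proof (Rpower_anti (2 * a - al) M s ltac:(lra) ltac:(lra)).
  pose proof (Rpower_pos s (2 * a - al)). pose proof (Rpower_pos s (a - 1)).
  pose proof (Rpower_pos s (- a)).
  assert (E : Rpower s a = / Rpower s (- a)) by (rewrite Rpower_Ropp, Rinv_inv; auto).
  rewrite E. set (b := Rpower s (- a)) in *. set (p := Rpower s (a - 1)) in *.
  assert (Hy : 0 < b + 1 <= z) by (unfold z; lra).
  set (K := Rpower M (2 * a - al)) in *.
  replace (K * (z * z * z * z) * (p / ((1 + / b) * (1 + / b)) * (p / ((1 + / b) * (1 + / b)))))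
    with (p * (p * (K * (b * (b * (b * b))) * ((z / (b + 1)) * (z / (b + 1)) * ((z / (b + 1)) * (z / (b + 1)))))))
    by (field; lra).
  apply Rmult_le_compat_l; [lra|]. apply Rmult_le_compat_l; [lra|].
  assert (1 <= z / (b + 1)).
  { apply Rmult_le_reg_r with (b + 1); [lra|]. unfold Rdiv; rewrite Rmult_assoc, Rinv_l; lra. }
  set (y := z / (b + 1)) in *.
  assert (1 <= y * y) by nra. assert (1 <= y * y * (y * y)) by nra.
  assert (0 < b * (b * (b * b))) by (repeat apply Rmult_lt_0_compat; auto).
  set (b4 := b * (b * (b * b))) in *.
  assert (Rpower s (2 * a - al) * b4 <= K * b4) by (apply Rmult_le_compat_r; lra).
  assert (0 < K * b4) by (apply Rmult_lt_0_compat; lra). nra.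
Qed.

(** * Limits of midpoint sums *)

(* The square of half-side [(t+1) L] and the excised disk of radius [L / (N (t+1))] are driven
   by one index [t]; the grid of width [L / (N m)] refines every cell [I_ij]. *)
Definition midsum (L : R) (N : nat) (g : R -> R -> R) (t m : nat) : R :=
  qsum (S t * (N * m)) (L / INR (N * m)) (qcut (L / INR N / INR (S t)) g)
    (fun k => (INR k + / 2) * (L / INR (N * m))).

(** The limit is iterated, with the mesh threshold [m0] allowed to depend on the truncation [t]:
    convergence of the Riemann sums is known for each fixed truncation, not uniformly as the excised
    disk shrinks. *)
Definition iter_lim (s : nat -> nat -> R) (v : R) : Prop :=
  forall e, 0 < e -> exists t0 : nat, forall t, (t0 <= t)%nat ->
    exists m0 : nat, forall m, (m0 <= m)%nat -> (0 < m)%nat -> Rabs (s t m - v) < e.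

Lemma integral2_midsum cx cy f L N : loc_int cx cy f -> 0 < L -> (0 < N)%nat ->
  (exists v, integral2_val cx cy f v) ->
  iter_lim (midsum L N (quad f cx cy)) (integral2 cx cy f).
Proof.
  intros HL PL PN [v0 Hv0]. apply integral2_spec in Hv0. intros e He.
  set (v := integral2 cx cy f) in *.
  destruct (Hv0 (e / 2) ltac:(lra)) as [d [Hd [M [HM HV]]]].
  assert (PN' : 0 < INR N) by (apply lt_0_INR; lia).
  (* [t1] brings the radius of the disk below [d], [t2] the half-side of the square above [M]. *)
  destruct (archimed_nat (L / INR N / d)) as [t1 Ht1].
  destruct (archimed_nat (M / L)) as [t2 Ht2].
  exists (max t1 t2). intros t Ht.
  assert (Pt : 0 < INR (S t)) by (apply lt_0_INR; lia).
  assert (h1 : 0 < L / INR N / INR (S t)) by (repeat apply Rdiv_lt_0_compat; auto).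
  assert (h2 : L / INR N / INR (S t) < d).
  { assert (INR t1 < INR (S t)) by (apply lt_INR; lia).
    apply Rmult_lt_reg_r with (INR (S t) / d); [apply Rdiv_lt_0_compat; auto|].
    replace (L / INR N / INR (S t) * (INR (S t) / d)) with (L / INR N / d) by (field; lra).
    replace (d * (INR (S t) / d)) with (INR (S t)) by (field; lra). lra. }
  assert (h3 : M < INR (S t) * L).
  { assert (INR t2 < INR (S t)) by (apply lt_INR; lia).
    apply Rmult_lt_reg_r with (/ L); [apply Rinv_0_lt_compat; auto|].
    rewrite Rmult_assoc, Rinv_r by lra. unfold Rdiv in Ht2. lra. }
  destruct (trunc_int_qsum cx cy f _ (INR (S t) * L) HL h1 ltac:(lra) (e / 2) ltac:(lra))
    as [n0 Hn0].
  specialize (HV _ _ (conj h1 h2) h3).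
  exists n0. intros m Hm Pm. assert (Pm' : 0 < INR m) by (apply lt_0_INR; lia).
  specialize (Hn0 (S t * (N * m))%nat ltac:(nia) ltac:(nia)
    (fun k => (INR k + / 2) * (L / INR (N * m)))).
  assert (Ew : INR (S t) * L / INR (S t * (N * m)) = L / INR (N * m)).
  { rewrite !mult_INR. field. lra. }
  rewrite Ew in Hn0.
  assert (0 < L / INR (N * m)) by (apply Rdiv_lt_0_compat; auto; rewrite mult_INR; nra).
  assert (Hn1 := Hn0 ltac:(intros; rewrite S_INR; split; nra)).
  unfold midsum. apply Rabs_def2 in Hn1. apply Rabs_def2 in HV. apply Rabs_def1; lra.
Qed.

Lemma iter_lim_lin s1 s2 v1 v2 k : iter_lim s1 v1 -> iter_lim s2 v2 ->
  iter_lim (fun t m => s1 t m + k * s2 t m) (v1 + k * v2).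
Proof.
  intros H1 H2 e He. pose proof (Rabs_pos k) as Hk.
  assert (He' : 0 < e / (2 * (Rabs k + 1))) by (apply Rdiv_lt_0_compat; lra).
  destruct (H1 (e / 2) ltac:(lra)) as [t1 T1]. destruct (H2 _ He') as [t2 T2].
  exists (max t1 t2). intros t Ht.
  destruct (T1 t ltac:(lia)) as [m1 M1]. destruct (T2 t ltac:(lia)) as [m2 M2].
  exists (max m1 m2). intros m Hm Pm.
  specialize (M1 m ltac:(lia) Pm). specialize (M2 m ltac:(lia) Pm).
  replace (s1 t m + k * s2 t m - (v1 + k * v2)) with ((s1 t m - v1) + k * (s2 t m - v2)) by ring.
  eapply Rle_lt_trans; [apply Rabs_triang|]. rewrite Rabs_mult.
  assert (Rabs k * Rabs (s2 t m - v2) <= Rabs k * (e / (2 * (Rabs k + 1))))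
    by (apply Rmult_le_compat_l; lra).
  assert (Rabs k * (e / (2 * (Rabs k + 1))) <= e / 2).
  { apply Rmult_le_reg_r with (Rabs k + 1); [lra|].
    replace (Rabs k * (e / (2 * (Rabs k + 1))) * (Rabs k + 1)) with (Rabs k * (e / 2)) by (field; lra).
    nra. }
  lra.
Qed.

Lemma iter_lim_zero : iter_lim (fun _ _ => 0) 0.
Proof.
  intros e He. exists O; intros; exists O; intros. rewrite Rminus_0_r, Rabs_R0; auto.
Qed.

Lemma iter_lim_sum n (s : nat -> nat -> nat -> R) (q v : nat -> R) :
  (forall i, (i < n)%nat -> iter_lim (s i) (v i)) ->
  iter_lim (fun t m => sumR n (fun i => q i * s i t m)) (sumR n (fun i => q i * v i)).
Proof.
  induction n as [|n IH]; intros H; [exact iter_lim_zero|]. simpl. apply iter_lim_lin; auto.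
Qed.

Lemma iter_lim_dsum n (s : nat -> nat -> nat -> nat -> R) (q v : nat -> nat -> R) :
  (forall i j, (i < n)%nat -> (j < n)%nat -> iter_lim (s i j) (v i j)) ->
  iter_lim (fun t m => dsum n (fun i j => q i j * s i j t m)) (dsum n (fun i j => q i j * v i j)).
Proof.
  intros H. unfold dsum.
  pose proof (iter_lim_sum n (fun i t m => sumR n (fun j => q i j * s i j t m)) (fun _ => 1)
    (fun i => sumR n (fun j => q i j * v i j))
    ltac:(intros; apply iter_lim_sum; intros; auto)) as X.
  cbv beta in X. intros e He. destruct (X e He) as [t0 T]. exists t0. intros t Ht.
  destruct (T t Ht) as [m0 M]. exists m0. intros m Hm Pm. specialize (M m Hm Pm).
  rewrite (sumR_ext n (fun i => 1 * sumR n (fun j => q i j * s i j t m))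
     (fun i => sumR n (fun j => q i j * s i j t m))) in M by (intros; ring).
  rewrite (sumR_ext n (fun i => 1 * sumR n (fun j => q i j * v i j))
     (fun i => sumR n (fun j => q i j * v i j))) in M by (intros; ring).
  exact M.
Qed.

Lemma iter_lim_bound s v B : iter_lim s v ->
  (forall t m, (0 < m)%nat -> Rabs (s t m) <= B) -> Rabs v <= B.
Proof.
  intros H HB. apply le_eps_3; intros e He.
  destruct (H e He) as [t0 T]. destruct (T t0 (le_n _)) as [m0 M].
  specialize (M (S m0) ltac:(lia) ltac:(lia)). specialize (HB t0 (S m0) ltac:(lia)).
  replace v with (s t0 (S m0) - (s t0 (S m0) - v)) by ring.
  eapply Rle_trans; [apply Rabs_triang|]. rewrite Rabs_Ropp. lra.
Qed.


(** * Taylor remainders of symmetrized functions *)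

Lemma norm2_pos x y : (x, y) <> (0, 0) -> 0 < norm2 x y.
Proof.
  intros H. destruct (norm2_nonneg x y) as [|E]; auto. exfalso. apply H.
  pose proof (norm2_sqr x y) as S. rewrite <- E in S.
  f_equal; nra.
Qed.

Lemma norm2_le_abs x y x' y' : Rabs x <= Rabs x' -> Rabs y <= Rabs y' -> norm2 x y <= norm2 x' y'.
Proof.
  intros Hx Hy. apply sqrt_le_1_alt. apply Rsqr_le_abs_1 in Hx. apply Rsqr_le_abs_1 in Hy.
  unfold Rsqr in *. lra.
Qed.

Lemma norm2_scal2 x y : norm2 (2 * x) (2 * y) = 2 * norm2 x y.
Proof.
  unfold norm2. replace (2 * x * (2 * x) + 2 * y * (2 * y)) with (2 * 2 * (x * x + y * y)) by ring.
  rewrite sqrt_mult by nra. rewrite sqrt_square; lra.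
Qed.

Lemma norm2_ge_abs_l x y : Rabs x <= norm2 x y.
Proof.
  unfold Rabs; destruct Rcase_abs; [|apply norm2_ge_l].
  rewrite <- norm2_opp_l. apply norm2_ge_l.
Qed.

Lemma norm2_ge_abs_r x y : Rabs y <= norm2 x y.
Proof. rewrite norm2_comm. apply norm2_ge_abs_l. Qed.

Lemma MVT_any f f' a b : (forall c, derivable_pt_lim f c (f' c)) ->
  exists c, f b - f a = f' c * (b - a) /\ Rmin a b <= c <= Rmax a b.
Proof.
  intros H. destruct (Rtotal_order a b) as [Hl|[->|Hg]].
  - destruct (MVT_cor2 f f' a b Hl) as [c [E Hc]]; [auto|].
    exists c. split; auto. rewrite Rmin_left, Rmax_right; lra.
  - exists b. split; [ring|]. rewrite Rmin_left, Rmax_right; lra.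
  - destruct (MVT_cor2 f f' b a Hg) as [c [E Hc]]; [auto|].
    exists c. split; [lra|]. rewrite Rmin_right, Rmax_left; lra.
Qed.

Lemma between_abs a d c : Rmin a (a + d) <= c <= Rmax a (a + d) -> Rabs (c - a) <= Rabs d.
Proof.
  unfold Rmin, Rmax, Rabs; repeat destruct Rle_dec; repeat destruct Rcase_abs; lra.
Qed.

Definition sym_diff (v : R -> R -> R) (x y xi eta : R) : R :=
  v (x + xi) (y + eta) + v (x - xi) (y - eta) - 2 * v x y.

(** Allowing any [r > 0] above the distance includes coincident points and lets later estimates use
    convenient radii such as [2 * rho]. *)
Definition Holder_any (H s : R) (v : R -> R -> R) : Prop :=
  forall x y x' y' r, 0 < r -> dist2 x y x' y' <= r ->
    Rabs (v x y - v x' y') <= H * Rpower r s.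

Lemma Holder_any_intro H s v : 0 <= s ->
  (forall x y x' y', (x, y) <> (x', y') ->
     Rabs (v x y - v x' y') <= H * Rpower (dist2 x y x' y') s) ->
  Holder_any (Rabs H) s v.
Proof.
  intros Hs HH x y x' y' r Hr Hd. pose proof (Rpower_pos r s). pose proof (Rabs_pos H).
  destruct (classic ((x, y) = (x', y'))) as [E|NE].
  - injection E as -> ->. replace (v x' y' - v x' y') with 0 by ring. rewrite Rabs_R0. nra.
  - eapply Rle_trans; [apply HH; auto|].
    assert (P : 0 < dist2 x y x' y').
    { apply norm2_pos. intros E. injection E as E1 E2. apply NE. f_equal; lra. }
    pose proof (Rle_Rpower_l (dist2 x y x' y') r s Hs ltac:(lra)).
    pose proof (Rpower_pos (dist2 x y x' y') s). pose proof (Rle_abs H). nra.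
Qed.

Lemma sym_diff_Holder0 H s v x y xi eta : Holder_any H s v -> (xi, eta) <> (0, 0) ->
  Rabs (sym_diff v x y xi eta) <= 2 * H * Rpower (norm2 xi eta) s.
Proof.
  intros HH NE. pose proof (norm2_pos _ _ NE) as P.
  pose proof (HH (x + xi) (y + eta) x y (norm2 xi eta) P) as H1.
  pose proof (HH (x - xi) (y - eta) x y (norm2 xi eta) P) as H2.
  unfold dist2 in H1, H2.
  replace (x + xi - x) with xi in H1 by ring. replace (y + eta - y) with eta in H1 by ring.
  replace (x - xi - x) with (- xi) in H2 by ring. replace (y - eta - y) with (- eta) in H2 by ring.
  rewrite norm2_opp_l, norm2_opp_r in H2.
  specialize (H1 (Rle_refl _)). specialize (H2 (Rle_refl _)).
  unfold sym_diff.
  replace (v (x + xi) (y + eta) + v (x - xi) (y - eta) - 2 * v x y)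
    with ((v (x + xi) (y + eta) - v x y) + (v (x - xi) (y - eta) - v x y)) by ring.
  eapply Rle_trans; [apply Rabs_triang|]. lra.
Qed.

(** The two displacements are opposite, so the mean values pair into differences of [vx] and of [vy]
    at points at most [2 rho] apart. This gains one power of [rho] over the Hölder exponent of the
    derivatives. *)
Lemma sym_diff_Holder1 H1 H2 s v vx vy x y xi eta : 0 <= H1 -> 0 <= H2 ->
  (forall x y, derivable_pt_lim (fun t => v t y) x (vx x y)) ->
  (forall x y, derivable_pt_lim (fun t => v x t) y (vy x y)) ->
  Holder_any H1 s vx -> Holder_any H2 s vy -> (xi, eta) <> (0, 0) ->
  Rabs (sym_diff v x y xi eta)
  <= (H1 + H2) * Rpower 2 s * Rpower (norm2 xi eta) (1 + s).
Proof.
  intros P1 P2 D1 D2 HH1 HH2 NE. pose proof (norm2_pos _ _ NE) as P.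
  set (rho := norm2 xi eta) in *.
  destruct (MVT_any (fun t => v t (y + eta)) (fun t => vx t (y + eta)) x (x + xi)
    ltac:(auto)) as [c1 [E1 B1]].
  destruct (MVT_any (fun t => v t (y - eta)) (fun t => vx t (y - eta)) x (x + - xi)
    ltac:(auto)) as [c2 [E2 B2]].
  destruct (MVT_any (fun t => v x t) (fun t => vy x t) y (y + eta) ltac:(auto)) as [c3 [E3 B3]].
  destruct (MVT_any (fun t => v x t) (fun t => vy x t) y (y + - eta) ltac:(auto)) as [c4 [E4 B4]].
  apply between_abs in B1, B2, B3, B4. rewrite Rabs_Ropp in B2, B4.
  assert (N2 : norm2 (2 * xi) (2 * eta) = 2 * rho) by apply norm2_scal2.
  assert (K1 : Rabs (vx c1 (y + eta) - vx c2 (y - eta)) <= H1 * Rpower (2 * rho) s).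
  { apply HH1; [lra|]. rewrite <- N2. apply norm2_le_abs.
    - replace (c1 - c2) with ((c1 - x) - (c2 - x)) by ring. rewrite Rabs_mult, (Rabs_right 2) by lra.
      eapply Rle_trans; [apply Rabs_triang|]. rewrite Rabs_Ropp. lra.
    - right; f_equal; ring. }
  assert (K2 : Rabs (vy x c3 - vy x c4) <= H2 * Rpower (2 * rho) s).
  { apply HH2; [lra|]. rewrite <- N2. apply norm2_le_abs.
    - replace (x - x) with 0 by ring. rewrite Rabs_R0. apply Rabs_pos.
    - replace (c3 - c4) with ((c3 - y) - (c4 - y)) by ring. rewrite Rabs_mult, (Rabs_right 2) by lra.
      eapply Rle_trans; [apply Rabs_triang|]. rewrite Rabs_Ropp. lra. }
  cbv beta in E1, E2, E3, E4.
  replace (x + - xi) with (x - xi) in E2 by ring. replace (y + - eta) with (y - eta) in E4 by ring.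
  replace (sym_diff v x y xi eta)
    with (xi * (vx c1 (y + eta) - vx c2 (y - eta)) + eta * (vy x c3 - vy x c4))
    by (unfold sym_diff; lra).
  rewrite <- Rpower_mult_distr in K1, K2 by lra.
  rewrite Rpower_plus, Rpower_1 by auto.
  eapply Rle_trans; [apply Rabs_triang|]. rewrite !Rabs_mult.
  pose proof (norm2_ge_abs_l xi eta) as A1. pose proof (norm2_ge_abs_r xi eta) as A2. fold rho in A1, A2.
  replace ((H1 + H2) * Rpower 2 s * (rho * Rpower rho s))
    with (rho * (H1 * (Rpower 2 s * Rpower rho s)) + rho * (H2 * (Rpower 2 s * Rpower rho s))) by ring.
  apply Rplus_le_compat; apply Rmult_le_compat; auto using Rabs_pos.
Qed.

Definition loc_lipschitz (f : R -> R -> R) : Prop :=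
  forall M, 0 <= M -> exists B, 0 <= B /\ forall x y x' y',
    Rabs x <= M -> Rabs y <= M -> Rabs x' <= M -> Rabs y' <= M ->
    Rabs (f x y - f x' y') <= B * (Rabs (x - x') + Rabs (y - y')).

Definition loc_bounded (f : R -> R -> R) : Prop :=
  forall M, 0 <= M -> exists B, 0 <= B /\ forall x y, Rabs x <= M -> Rabs y <= M -> Rabs (f x y) <= B.

Lemma between_bound a b c M : Rabs a <= M -> Rabs b <= M -> Rmin a b <= c <= Rmax a b -> Rabs c <= M.
Proof.
  unfold Rmin, Rmax; intros. apply Rabs_le_inv in H, H0. apply Rabs_le.
  repeat destruct Rle_dec; lra.
Qed.

Lemma loc_lipschitz_C1 f fx fy :
  (forall x y, derivable_pt_lim (fun t => f t y) x (fx x y)) ->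
  (forall x y, derivable_pt_lim (fun t => f x t) y (fy x y)) ->
  loc_bounded fx -> loc_bounded fy -> loc_lipschitz f.
Proof.
  intros D1 D2 B1 B2 M HM. destruct (B1 M HM) as [b1 [P1 H1]]. destruct (B2 M HM) as [b2 [P2 H2]].
  exists (b1 + b2). split; [lra|]. intros x y x' y' h1 h2 h3 h4.
  destruct (MVT_any (fun t => f t y) (fun t => fx t y) x' x ltac:(auto)) as [c1 [E1 C1]].
  destruct (MVT_any (fun t => f x' t) (fun t => fy x' t) y' y ltac:(auto)) as [c2 [E2 C2]].
  replace (f x y - f x' y') with (fx c1 y * (x - x') + fy x' c2 * (y - y')) by lra.
  eapply Rle_trans; [apply Rabs_triang|]. rewrite !Rabs_mult.
  specialize (H1 c1 y (between_bound _ _ _ _ h3 h1 C1) h2).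
  specialize (H2 x' c2 h3 (between_bound _ _ _ _ h4 h2 C2)).
  pose proof (Rabs_pos (x - x')). pose proof (Rabs_pos (y - y')). nra.
Qed.

Lemma loc_lipschitz_bounded f : loc_lipschitz f -> loc_bounded f.
Proof.
  intros H M HM. destruct (H M HM) as [B [PB HB]].
  exists (Rabs (f 0 0) + B * (M + M)). split; [pose proof (Rabs_pos (f 0 0)); nra|].
  intros x y hx hy. specialize (HB x y 0 0 hx hy). rewrite Rabs_R0, !Rminus_0_r in HB.
  specialize (HB HM HM). replace (f x y) with (f 0 0 + (f x y - f 0 0)) by ring.
  eapply Rle_trans; [apply Rabs_triang|]. nra.
Qed.

Lemma Holder_loc_bounded H s f : 0 <= s -> 0 <= H -> Holder_any H s f -> loc_bounded f.
Proof.
  intros Hs HP HH M HM. exists (Rabs (f 0 0) + H * Rpower (2 * M + 1) s).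
  pose proof (Rpower_pos (2 * M + 1) s). pose proof (Rabs_pos (f 0 0)). split; [nra|].
  intros x y hx hy. specialize (HH x y 0 0 (2 * M + 1) ltac:(lra)).
  replace (f x y) with (f 0 0 + (f x y - f 0 0)) by ring.
  eapply Rle_trans; [apply Rabs_triang|]. apply Rplus_le_compat_l, HH.
  unfold dist2. rewrite !Rminus_0_r.
  apply Rle_trans with (norm2 (Rabs x) (Rabs y)).
  - apply norm2_le_abs; rewrite Rabs_Rabsolu; lra.
  - eapply Rle_trans; [apply norm2_le_sum; apply Rabs_pos|lra].
Qed.

(* The centred second differences decay like [rho^beta] both when the exponent is reached
   with second derivatives ([al < 1]) and with third derivatives ([al >= 1]), which lets the
   two cases be treated together. *)
Definition sym_C2 (K beta : R) (u ux uy uxx uxy uyy : R -> R -> R) : Prop :=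
  (forall x y, derivable_pt_lim (fun t => u t y) x (ux x y)) /\
  (forall x y, derivable_pt_lim (fun t => u x t) y (uy x y)) /\
  (forall x y, derivable_pt_lim (fun t => ux t y) x (uxx x y)) /\
  (forall x y, derivable_pt_lim (fun t => ux x t) y (uxy x y)) /\
  (forall x y, derivable_pt_lim (fun t => uy x t) y (uyy x y)) /\
  forall v, v = uxx \/ v = uxy \/ v = uyy -> forall x y xi eta, (xi, eta) <> (0, 0) ->
    Rabs (sym_diff v x y xi eta) <= K * Rpower (norm2 xi eta) beta.

Lemma floor_cases al : 0 < al < 2 ->
  (floorR al = 0%Z /\ al < 1) \/ (floorR al = 1%Z /\ 1 <= al).
Proof.
  intros Hal. unfold floorR. destruct (base_Int_part al) as [H1 H2].
  assert (-1 < Int_part al < 2)%Z.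
  { split; apply lt_IZR; lra. }
  assert (E : (Int_part al = 0 \/ Int_part al = 1)%Z) by lia.
  destruct E as [E|E]; rewrite E in *; [left|right]; split; auto; lra.
Qed.

Lemma Holder2_sym_C2 al eps u : 0 < al < 2 -> 0 < eps <= 1 + IZR (floorR al) - al ->
  Holder2 (Z.to_nat (2 + floorR al)) (al - IZR (floorR al) + eps) u ->
  loc_lipschitz u /\
  exists K ux uy uxx uxy uyy, 0 <= K /\ sym_C2 K (al + eps) u ux uy uxx uxy uyy.
Proof.
  intros Hal Heps [D [D0 [DD [_ DH]]]]. subst u.
  destruct (floor_cases al Hal) as [[F Hal']|[F Hal']]; rewrite F in *; simpl IZR in *;
  simpl Z.to_nat in *.
  - assert (HB : forall l, length l = 2%nat -> exists H, 0 <= H /\ Holder_any H (al - 0 + eps) (D l)).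
    { intros l Hl. destruct (DH l Hl) as [H HH]. exists (Rabs H). split; [apply Rabs_pos|].
      apply Holder_any_intro; auto; lra. }
    assert (LB : forall l, length l = 2%nat -> loc_bounded (D l)).
    { intros l Hl. destruct (HB l Hl) as [H [P HH]]. apply (Holder_loc_bounded H (al - 0 + eps)); auto; lra. }
    assert (LB1 : forall l, length l = 1%nat -> loc_bounded (D l)).
    { intros l Hl. apply loc_lipschitz_bounded.
      apply (loc_lipschitz_C1 _ (D (false :: l)) (D (true :: l)));
        try (intros; apply DD; simpl; lia); apply LB; simpl; lia. }
    split.
    + apply (loc_lipschitz_C1 _ (D (false :: nil)) (D (true :: nil)));
        try (intros; apply DD; simpl; lia); apply LB1; reflexivity.
    + destruct (HB (false :: false :: nil)%list eq_refl) as [H1 [P1 HH1]].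
      (* The head of the word is applied last: this is the [y]-derivative of the [x]-derivative, as
         [uxy] requires. *)
      destruct (HB (true :: false :: nil)%list eq_refl) as [H2 [P2 HH2]].
      destruct (HB (true :: true :: nil)%list eq_refl) as [H3 [P3 HH3]].
      exists (2 * (H1 + H2 + H3)), (D (false :: nil)%list), (D (true :: nil)%list),
        (D (false :: false :: nil)%list), (D (true :: false :: nil)%list), (D (true :: true :: nil)%list).
      split; [lra|]. repeat split; try (intros; apply DD; simpl; lia).
      intros v Hv x y xi eta NE. pose proof (Rpower_pos (norm2 xi eta) (al + eps)).
      replace (al - 0 + eps) with (al + eps) in * by ring.
      destruct Hv as [-> | [-> | ->]];
        (eapply Rle_trans; [apply sym_diff_Holder0; eauto|]);
        apply Rmult_le_compat_r; lra.
  - assert (HB : forall l, length l = 3%nat -> exists H, 0 <= H /\ Holder_any H (al - 1 + eps) (D l)).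
    { intros l Hl. destruct (DH l Hl) as [H HH]. exists (Rabs H). split; [apply Rabs_pos|].
      apply Holder_any_intro; auto; lra. }
    assert (LB : forall l, length l = 3%nat -> loc_bounded (D l)).
    { intros l Hl. destruct (HB l Hl) as [H [P HH]]. apply (Holder_loc_bounded H (al - 1 + eps)); auto; lra. }
    assert (LB2 : forall l, length l = 2%nat -> loc_bounded (D l)).
    { intros l Hl. apply loc_lipschitz_bounded.
      apply (loc_lipschitz_C1 _ (D (false :: l)) (D (true :: l)));
        try (intros; apply DD; simpl; lia); apply LB; simpl; lia. }
    assert (LB1 : forall l, length l = 1%nat -> loc_bounded (D l)).
    { intros l Hl. apply loc_lipschitz_bounded.
      apply (loc_lipschitz_C1 _ (D (false :: l)) (D (true :: l)));
        try (intros; apply DD; simpl; lia); apply LB2; simpl; lia. }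
    split.
    + apply (loc_lipschitz_C1 _ (D (false :: nil)) (D (true :: nil)));
        try (intros; apply DD; simpl; lia); apply LB1; reflexivity.
    + assert (SD : forall l, length l = 2%nat -> exists K, 0 <= K /\ forall x y xi eta,
         (xi, eta) <> (0, 0) ->
         Rabs (sym_diff (D l) x y xi eta) <= K * Rpower (norm2 xi eta) (al + eps)).
      { intros l Hl. destruct (HB (false :: l) ltac:(simpl; lia)) as [H1 [P1 HH1]].
        destruct (HB (true :: l) ltac:(simpl; lia)) as [H2 [P2 HH2]].
        exists ((H1 + H2) * Rpower 2 (al - 1 + eps)). pose proof (Rpower_pos 2 (al - 1 + eps)).
        split; [nra|]. intros x y xi eta NE.
        replace (al + eps) with (1 + (al - 1 + eps)) by ring.
        apply (sym_diff_Holder1 H1 H2 _ _ (D (false :: l)) (D (true :: l))); auto;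
          intros; apply DD; simpl; lia. }
      destruct (SD (false :: false :: nil)%list eq_refl) as [H1 [P1 HH1]].
      destruct (SD (true :: false :: nil)%list eq_refl) as [H2 [P2 HH2]].
      destruct (SD (true :: true :: nil)%list eq_refl) as [H3 [P3 HH3]].
      exists (H1 + H2 + H3), (D (false :: nil)%list), (D (true :: nil)%list),
        (D (false :: false :: nil)%list), (D (true :: false :: nil)%list), (D (true :: true :: nil)%list).
      split; [lra|]. repeat split; try (intros; apply DD; simpl; lia).
      intros v Hv x y xi eta NE. pose proof (Rpower_pos (norm2 xi eta) (al + eps)).
      destruct Hv as [-> | [-> | ->]];
        (eapply Rle_trans; [eauto|]); apply Rmult_le_compat_r; lra.
Qed.

(** Models a function even in each variable: [G1] vanishes on the whole line [x = 0] and [G2] on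
    [y = 0], so bounds can be integrated up from the axes. A single mixed derivative suffices
    because increments are taken along one fixed kind of two-leg path. *)
Definition small_C2 (K beta : R) (G : R -> R -> R) : Prop :=
  exists G1 G2 G11 G12 G22 : R -> R -> R,
  (forall x y, derivable_pt_lim (fun t => G t y) x (G1 x y)) /\
  (forall x y, derivable_pt_lim (fun t => G x t) y (G2 x y)) /\
  (forall x y, derivable_pt_lim (fun t => G1 t y) x (G11 x y)) /\
  (forall x y, derivable_pt_lim (fun t => G1 x t) y (G12 x y)) /\
  (forall x y, derivable_pt_lim (fun t => G2 x t) y (G22 x y)) /\
  G 0 0 = 0 /\ (forall y, G1 0 y = 0) /\ (forall x, G2 x 0 = 0) /\
  forall v, v = G11 \/ v = G12 \/ v = G22 -> forall x y, (x, y) <> (0, 0) ->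
    Rabs (v x y) <= K * Rpower (norm2 x y) beta.

Lemma derivable_pt_lim_eq f g x l l' : derivable_pt_lim f x l ->
  (forall t, f t = g t) -> l = l' -> derivable_pt_lim g x l'.
Proof.
  intros H E <-. replace g with f; auto. apply functional_extensionality; auto.
Qed.

Lemma derivable_pt_lim_shift f x t l :
  derivable_pt_lim f (x + t) l -> derivable_pt_lim (fun t => f (x + t)) t l.
Proof.
  intros H e He. destruct (H e He) as [d Hd]. exists d. intros h Hh Hhd.
  rewrite <- Rplus_assoc. auto.
Qed.

Lemma derivable_pt_lim_reflect f x t l :
  derivable_pt_lim f (x - t) l -> derivable_pt_lim (fun t => f (x - t)) t (- l).
Proof.
  intros H e He. destruct (H e He) as [d Hd]. exists d. intros h Hh Hhd.
  specialize (Hd (- h) ltac:(lra)). rewrite Rabs_Ropp in Hd. specialize (Hd Hhd).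
  replace (x - (t + h)) with (x - t + - h) by ring. rewrite <- Rabs_Ropp.
  match type of Hd with Rabs ?a < _ => match goal with |- Rabs ?b < _ =>
    replace b with a; auto end end. field. auto.
Qed.

Lemma derivable_pt_lim_quadratic c t : derivable_pt_lim (fun t => c * (t * t)) t (2 * c * t).
Proof.
  eapply derivable_pt_lim_eq.
  - apply (derivable_pt_lim_scal (fun t => t * t) c t (2 * t)).
    eapply derivable_pt_lim_eq.
    + apply (derivable_pt_lim_mult id id t 1 1); apply derivable_pt_lim_id.
    + intros; reflexivity.
    + unfold id; ring.
  - intros; reflexivity.
  - ring.
Qed.

Lemma derivable_pt_lim_linear c t : derivable_pt_lim (fun t => c * t) t c.
Proof.
  eapply derivable_pt_lim_eq.
  - apply (derivable_pt_lim_scal id c t 1). apply derivable_pt_lim_id.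
  - intros; reflexivity.
  - ring.
Qed.

Lemma derivable_pt_lim_sum4 f1 f2 f3 f4 g x l1 l2 l3 l4 l : derivable_pt_lim f1 x l1 ->
  derivable_pt_lim f2 x l2 -> derivable_pt_lim f3 x l3 -> derivable_pt_lim f4 x l4 ->
  derivable_pt_lim g x l ->
  derivable_pt_lim (fun t => f1 t + f2 t + f3 t + f4 t + g t) x (l1 + l2 + l3 + l4 + l).
Proof.
  intros H1 H2 H3 H4 H.
  exact (derivable_pt_lim_plus _ _ _ _ _ (derivable_pt_lim_plus _ _ _ _ _
    (derivable_pt_lim_plus _ _ _ _ _ (derivable_pt_lim_plus _ _ _ _ _ H1 H2) H3) H4) H).
Qed.

Lemma derivable_pt_lim_neg f x l : derivable_pt_lim f x l -> derivable_pt_lim (fun t => - f t) x (- l).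
Proof. apply derivable_pt_lim_opp. Qed.

(** The four reflections remove the odd terms and the mixed second-order term of the Taylor
    expansion and quadruple [u_xx xi^2 / 2], whence the coefficient 2. *)
Definition taylor_rem (u uxx uyy : R -> R -> R) (x y xi eta : R) : R :=
  quad u x y xi eta - 4 * u x y - 2 * uxx x y * (xi * xi) - 2 * uyy x y * (eta * eta).

Lemma taylor_rem_small K beta u ux uy uxx uxy uyy x y :
  sym_C2 K beta u ux uy uxx uxy uyy -> small_C2 (2 * K) beta (taylor_rem u uxx uyy x y).
Proof.
  intros [D1 [D2 [D11 [D12 [D22 HK]]]]].
  set (A := uxx x y). set (B := uyy x y).
  exists (fun s t => ux (x + s) (y + t) + ux (x + s) (y - t) + - ux (x - s) (y + t)
            + - ux (x - s) (y - t) + - 4 * A * s),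
    (fun s t => uy (x + s) (y + t) + - uy (x + s) (y - t) + uy (x - s) (y + t)
            + - uy (x - s) (y - t) + - 4 * B * t),
    (fun s t => quad uxx x y s t + - 4 * A),
    (fun s t => uxy (x + s) (y + t) + - uxy (x + s) (y - t) + - uxy (x - s) (y + t)
            + uxy (x - s) (y - t)),
    (fun s t => quad uyy x y s t + - 4 * B).
  repeat match goal with |- _ /\ _ => split end.
  - intros s t. eapply derivable_pt_lim_eq.
    + apply derivable_pt_lim_sum4;
      [ apply (derivable_pt_lim_shift (fun z => u z (y + t)) x s), D1
      | apply (derivable_pt_lim_shift (fun z => u z (y - t)) x s), D1
      | apply (derivable_pt_lim_reflect (fun z => u z (y + t)) x s), D1
      | apply (derivable_pt_lim_reflect (fun z => u z (y - t)) x s), D1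
      | apply (derivable_pt_lim_plus (fun z => - 2 * A * (z * z)) (fun _ => - 4 * u x y - 2 * B * (t * t)));
        [apply derivable_pt_lim_quadratic|apply derivable_pt_lim_const]].
    + intros z. unfold taylor_rem, quad, plus_fct. fold A B. cbv beta. ring.
    + ring.
  - intros s t. eapply derivable_pt_lim_eq.
    + apply derivable_pt_lim_sum4;
      [ apply (derivable_pt_lim_shift (fun z => u (x + s) z) y t), D2
      | apply (derivable_pt_lim_reflect (fun z => u (x + s) z) y t), D2
      | apply (derivable_pt_lim_shift (fun z => u (x - s) z) y t), D2
      | apply (derivable_pt_lim_reflect (fun z => u (x - s) z) y t), D2
      | apply (derivable_pt_lim_plus (fun z => - 2 * B * (z * z)) (fun _ => - 4 * u x y - 2 * A * (s * s)));
        [apply derivable_pt_lim_quadratic|apply derivable_pt_lim_const]].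
    + intros z. unfold taylor_rem, quad, plus_fct. fold A B. cbv beta. ring.
    + ring.
  - intros s t. eapply derivable_pt_lim_eq.
    + apply derivable_pt_lim_sum4;
      [ apply (derivable_pt_lim_shift (fun z => ux z (y + t)) x s), D11
      | apply (derivable_pt_lim_shift (fun z => ux z (y - t)) x s), D11
      | apply derivable_pt_lim_neg, (derivable_pt_lim_reflect (fun z => ux z (y + t)) x s), D11
      | apply derivable_pt_lim_neg, (derivable_pt_lim_reflect (fun z => ux z (y - t)) x s), D11
      | apply (derivable_pt_lim_linear (- 4 * A)) ].
    + intros z. cbv beta. ring.
    + unfold quad. ring.
  - intros s t. eapply derivable_pt_lim_eq.
    + apply derivable_pt_lim_sum4;
      [ apply (derivable_pt_lim_shift (fun z => ux (x + s) z) y t), D12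
      | apply (derivable_pt_lim_reflect (fun z => ux (x + s) z) y t), D12
      | apply derivable_pt_lim_neg, (derivable_pt_lim_shift (fun z => ux (x - s) z) y t), D12
      | apply derivable_pt_lim_neg, (derivable_pt_lim_reflect (fun z => ux (x - s) z) y t), D12
      | apply (derivable_pt_lim_const (- 4 * A * s)) ].
    + intros z. unfold fct_cte. cbv beta. ring.
    + ring.
  - intros s t. eapply derivable_pt_lim_eq.
    + apply derivable_pt_lim_sum4;
      [ apply (derivable_pt_lim_shift (fun z => uy (x + s) z) y t), D22
      | apply derivable_pt_lim_neg, (derivable_pt_lim_reflect (fun z => uy (x + s) z) y t), D22
      | apply (derivable_pt_lim_shift (fun z => uy (x - s) z) y t), D22
      | apply derivable_pt_lim_neg, (derivable_pt_lim_reflect (fun z => uy (x - s) z) y t), D22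
      | apply (derivable_pt_lim_linear (- 4 * B)) ].
    + intros z. cbv beta. ring.
    + unfold quad. ring.
  - unfold taylor_rem, quad. rewrite !Rplus_0_r, !Rminus_0_r. ring.
  - intros t. rewrite !Rplus_0_r, !Rminus_0_r. ring.
  - intros s. rewrite !Rplus_0_r, !Rminus_0_r. ring.
  (* The four reflected points form two opposite pairs: [G11] and [G22] are sums, and [G12] is the
     difference, of the centred differences along [(s, t)] and [(s, - t)]. Hence the doubled
     constant. *)
  - assert (HK2 : forall v, v = uxx \/ v = uxy \/ v = uyy -> forall s t, (s, t) <> (0, 0) ->
      Rabs (sym_diff v x y s t) <= K * Rpower (norm2 s t) beta /\
      Rabs (sym_diff v x y s (- t)) <= K * Rpower (norm2 s t) beta).
    { intros v Hv s t NE. split; [auto|]. rewrite <- (norm2_opp_r s t). apply HK; auto.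
      intros E; injection E as E1 E2; apply NE; f_equal; lra. }
    intros v Hv s t NE. unfold sym_diff in HK2. replace (y + - - t) with (y + t) in * by ring.
    destruct Hv as [-> | [-> | ->]]; unfold quad.
    + destruct (HK2 uxx ltac:(auto) s t NE) as [X Y].
      replace (y + - t) with (y - t) in Y by ring. replace (y - - t) with (y + t) in Y by ring.
      fold A in X, Y. apply Rabs_le_inv in X, Y. apply Rabs_le; lra.
    + destruct (HK2 uxy ltac:(auto) s t NE) as [X Y].
      replace (y + - t) with (y - t) in Y by ring. replace (y - - t) with (y + t) in Y by ring.
      apply Rabs_le_inv in X, Y. apply Rabs_le; lra.
    + destruct (HK2 uyy ltac:(auto) s t NE) as [X Y].
      replace (y + - t) with (y - t) in Y by ring. replace (y - - t) with (y + t) in Y by ring.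
      fold B in X, Y. apply Rabs_le_inv in X, Y. apply Rabs_le; lra.
Qed.


(** * Estimates for the remainder and its quotient on a cell *)

Lemma Rabs_mult_le a b x y : Rabs a <= x -> Rabs b <= y -> Rabs (a * b) <= x * y.
Proof. intros. rewrite Rabs_mult. apply Rmult_le_compat; auto using Rabs_pos. Qed.

Lemma Rabs_plus_le a b x y : Rabs a <= x -> Rabs b <= y -> Rabs (a + b) <= x + y.
Proof. intros. eapply Rle_trans; [apply Rabs_triang|]. lra. Qed.

Lemma Rpower_bound K beta rho M v : 0 <= K -> 0 <= beta -> 0 < rho <= M ->
  Rabs v <= K * Rpower rho beta -> Rabs v <= K * Rpower M beta.
Proof.
  intros HK Hb Hr H. eapply Rle_trans; [apply H|]. apply Rmult_le_compat_l; auto.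
  apply Rle_Rpower_l; auto.
Qed.

(** [G1] is integrated from [x = 0], [G2] from [y = 0] and [G] from the origin, each integration
    gaining a factor [M]. The second claim is a Taylor estimate on a box that misses the origin,
    where the second derivatives are not controlled; each of the three contributes one term
    [K M^beta h^2]. *)
Lemma small_C2_bounds K beta G : 0 <= K -> 0 <= beta -> small_C2 K beta G ->
  exists G1 G2 : R -> R -> R,
  (forall M x y, 0 < M -> 0 <= x -> 0 <= y -> norm2 x y <= M ->
     Rabs (G x y) <= 2 * K * (M * M) * Rpower M beta /\
     Rabs (G1 x y) <= K * M * Rpower M beta /\ Rabs (G2 x y) <= K * M * Rpower M beta) /\
  (forall M x0 y0 x1 y1 h x y x' y', 0 <= x0 -> 0 <= y0 -> (x0, y0) <> (0, 0) ->
     norm2 x1 y1 <= M -> x0 <= x <= x1 -> y0 <= y <= y1 -> x0 <= x' <= x1 -> y0 <= y' <= y1 ->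
     Rabs (x' - x) <= h -> Rabs (y' - y) <= h ->
     Rabs (G x' y' - G x y - (G1 x y * (x' - x) + G2 x y * (y' - y)))
     <= 3 * K * Rpower M beta * (h * h)).
Proof.
  intros HK Hb [G1 [G2 [G11 [G12 [G22 [D1 [D2 [D11 [D12 [D22 [Z [Z1 [Z2 HB]]]]]]]]]]]]].
  exists G1, G2.
  assert (HB' : forall v, v = G11 \/ v = G12 \/ v = G22 -> forall M x y, (x, y) <> (0, 0) ->
     norm2 x y <= M -> Rabs (v x y) <= K * Rpower M beta).
  { intros v Hv M x y NE HM. apply Rpower_bound with (norm2 x y); auto.
    split; auto. apply norm2_pos; auto. }
  assert (B1 : forall M x y, 0 < M -> 0 <= x -> 0 <= y -> norm2 x y <= M ->
     Rabs (G1 x y) <= K * M * Rpower M beta).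
  { intros M x y PM Px Py HM. pose proof (Rpower_pos M beta).
    destruct Px as [Px|<-].
    2:{ rewrite Z1, Rabs_R0. assert (0 <= K * M) by nra. nra. }
    destruct (MVT_cor2 (fun t => G1 t y) (fun t => G11 t y) 0 x Px ltac:(auto)) as [c [E Hc]].
    rewrite Z1, !Rminus_0_r in E. rewrite E.
    replace (K * M * Rpower M beta) with ((K * Rpower M beta) * M) by ring.
    apply Rabs_mult_le.
    - apply HB'; auto.
      + intros E'; injection E'; lra.
      + eapply Rle_trans; [|apply HM]. apply norm2_le; lra.
    - eapply Rle_trans; [apply norm2_ge_abs_l|apply HM]. }
  assert (B2 : forall M x y, 0 < M -> 0 <= x -> 0 <= y -> norm2 x y <= M ->
     Rabs (G2 x y) <= K * M * Rpower M beta).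
  { intros M x y PM Px Py HM. pose proof (Rpower_pos M beta).
    destruct Py as [Py|<-].
    2:{ rewrite Z2, Rabs_R0. assert (0 <= K * M) by nra. nra. }
    destruct (MVT_cor2 (fun t => G2 x t) (fun t => G22 x t) 0 y Py ltac:(auto)) as [c [E Hc]].
    rewrite Z2, !Rminus_0_r in E. rewrite E.
    replace (K * M * Rpower M beta) with ((K * Rpower M beta) * M) by ring.
    apply Rabs_mult_le.
    - apply HB'; auto.
      + intros E'; injection E'; lra.
      + eapply Rle_trans; [|apply HM]. apply norm2_le; lra.
    - eapply Rle_trans; [apply norm2_ge_abs_r|apply HM]. }
  split.
  - intros M x y PM Px Py HM. repeat split; auto.
    destruct (MVT_any (fun t => G t y) (fun t => G1 t y) 0 x ltac:(auto)) as [c1 [E1 C1]].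
    destruct (MVT_any (fun t => G 0 t) (fun t => G2 0 t) 0 y ltac:(auto)) as [c2 [E2 C2]].
    rewrite Rmin_left, Rmax_right in C1, C2 by lra. rewrite !Rminus_0_r in E1, E2.
    replace (G x y) with (G1 c1 y * x + G2 0 c2 * y) by (cbv beta in *; lra).
    replace (2 * K * (M * M) * Rpower M beta)
      with ((K * M * Rpower M beta) * M + (K * M * Rpower M beta) * M) by ring.
    apply Rabs_plus_le; apply Rabs_mult_le.
    + apply B1; auto; try lra. eapply Rle_trans; [|apply HM]. apply norm2_le; lra.
    + eapply Rle_trans; [apply norm2_ge_abs_l|apply HM].
    + apply B2; auto; try lra. eapply Rle_trans; [|apply HM]. apply norm2_le; lra.
    + eapply Rle_trans; [apply norm2_ge_abs_r|apply HM].
  - intros M x0 y0 x1 y1 h x y x' y' Px Py NE HM Hx Hy Hx' Hy' Hdx Hdy.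
    assert (Hbox : forall s t, x0 <= s <= x1 -> y0 <= t <= y1 -> (s, t) <> (0, 0) /\ norm2 s t <= M).
    { intros s t Hs Ht. split.
      - intros E; injection E as E1 E2. apply NE; f_equal; lra.
      - eapply Rle_trans; [|apply HM]. apply norm2_le; lra. }
    assert (Hmid : forall lo hi a b c, lo <= a <= hi -> lo <= b <= hi -> Rmin a b <= c <= Rmax a b ->
        lo <= c <= hi /\ Rabs (c - a) <= Rabs (b - a)).
    { clear. intros lo hi a b c. unfold Rmin, Rmax, Rabs.
      repeat destruct Rle_dec; repeat destruct Rcase_abs; lra. }
    (* The path goes from [(x, y)] to [(x, y')] and then to [(x', y')]. Comparing the intermediate
       slopes with those at [(x, y)] uses [G11], [G12] and [G22] once each. *)
    destruct (MVT_any (fun t => G t y') (fun t => G1 t y') x x' ltac:(auto)) as [c1 [E1 C1]].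
    destruct (Hmid x0 x1 x x' c1 Hx Hx' C1) as [I1 A1].
    destruct (MVT_any (fun t => G1 t y') (fun t => G11 t y') x c1 ltac:(auto)) as [c2 [E2 C2]].
    destruct (Hmid x0 x1 x c1 c2 Hx I1 C2) as [I2 A2].
    destruct (MVT_any (fun t => G1 x t) (fun t => G12 x t) y y' ltac:(auto)) as [c3 [E3 C3]].
    destruct (Hmid y0 y1 y y' c3 Hy Hy' C3) as [I3 A3].
    destruct (MVT_any (fun t => G x t) (fun t => G2 x t) y y' ltac:(auto)) as [c4 [E4 C4]].
    destruct (Hmid y0 y1 y y' c4 Hy Hy' C4) as [I4 A4].
    destruct (MVT_any (fun t => G2 x t) (fun t => G22 x t) y c4 ltac:(auto)) as [c5 [E5 C5]].
    destruct (Hmid y0 y1 y c4 c5 Hy I4 C5) as [I5 A5].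
    cbv beta in *.
    replace (G x' y' - G x y - (G1 x y * (x' - x) + G2 x y * (y' - y)))
      with (G11 c2 y' * ((c1 - x) * (x' - x)) + G12 x c3 * ((y' - y) * (x' - x))
        + G22 x c5 * ((c4 - y) * (y' - y))).
    2:{ replace (G11 c2 y' * ((c1 - x) * (x' - x))) with ((G1 c1 y' - G1 x y') * (x' - x)) by (rewrite E2; ring).
        replace (G12 x c3 * ((y' - y) * (x' - x))) with ((G1 x y' - G1 x y) * (x' - x)) by (rewrite E3; ring).
        replace (G22 x c5 * ((c4 - y) * (y' - y))) with ((G2 x c4 - G2 x y) * (y' - y)) by (rewrite E5; ring).
        lra. }
    set (b := Rpower M beta) in *.
    replace (3 * K * b * (h * h)) with (K * b * (h * h) + K * b * (h * h) + K * b * (h * h)) by ring.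
    repeat apply Rabs_plus_le; apply Rabs_mult_le;
      try (apply Rabs_mult_le; lra).
    + destruct (Hbox c2 y'); auto. apply HB'; auto.
    + destruct (Hbox x c3); auto. apply HB'; auto.
    + destruct (Hbox x c5); auto. apply HB'; auto.
Qed.

Lemma small_C2_quot K beta G : 0 <= K -> 0 <= beta -> small_C2 K beta G ->
  forall x y, 0 <= x -> 0 <= y -> (x, y) <> (0, 0) ->
  Rabs (G x y / (x * x + y * y)) <= 2 * K * Rpower (norm2 x y) beta.
Proof.
  intros HK Hb HG x y Hx Hy NE. pose proof (norm2_pos _ _ NE) as P.
  destruct (small_C2_bounds K beta G HK Hb HG) as [G1 [G2 [HB _]]].
  destruct (HB (norm2 x y) x y P Hx Hy (Rle_refl _)) as [H _].
  rewrite <- norm2_sqr. set (rho := norm2 x y) in *.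
  assert (0 < rho * rho) by nra. unfold Rdiv. rewrite Rabs_mult, (Rabs_right (/ _)).
  2:{ apply Rle_ge; left; apply Rinv_0_lt_compat; auto. }
  apply Rmult_le_reg_r with (rho * rho); auto.
  rewrite Rmult_assoc, Rinv_l by lra. lra.
Qed.

(** At distance about [s] from the origin, [G / |xi|^2] should have second derivatives of order
    [s^(beta - 2)]. They are never formed: [G] and [1 / |xi|^2] are expanded separately about the
    centre of the cell and the products are collected. *)
Lemma cell_linear K beta G x0 y0 h s : 0 <= K -> 0 <= beta -> small_C2 K beta G ->
  0 <= x0 -> 0 <= y0 -> 0 < h <= s -> s / 2 <= norm2 x0 y0 -> norm2 (x0 + h) (y0 + h) <= 2 * s ->
  exists A B g0, forall x y, x0 <= x <= x0 + h -> y0 <= y <= y0 + h ->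
    Rabs (G x y / (x * x + y * y) - g0 - (A * (x - (x0 + h / 2)) + B * (y - (y0 + h / 2))))
      <= 60000 * K * Rpower (2 * s) beta * (h * h * / s * / s) /\
    Rabs (A * (x - (x0 + h / 2)) + B * (y - (y0 + h / 2)))
      <= 2000 * K * Rpower (2 * s) beta * (h * / s).
Proof.
  intros HK Hb HG Px Py Hh Hlo Hhi.
  destruct (small_C2_bounds K beta G HK Hb HG) as [G1 [G2 [HB HT]]].
  set (cx := x0 + h / 2). set (cy := y0 + h / 2). set (b := Rpower (2 * s) beta) in *.
  assert (Pb : 0 < b) by apply Rpower_pos.
  assert (NE : (x0, y0) <> (0, 0)).
  { intros E; injection E as -> ->. unfold norm2 in Hlo.
    replace (0 * 0 + 0 * 0) with 0 in Hlo by ring. rewrite sqrt_0 in Hlo. lra. }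
  assert (Hn : forall x y, x0 <= x <= x0 + h -> y0 <= y <= y0 + h ->
     s / 2 <= norm2 x y <= 2 * s).
  { intros x y hx hy. pose proof (norm2_le x0 y0 x y ltac:(lra) ltac:(lra)).
    pose proof (norm2_le x y (x0 + h) (y0 + h) ltac:(lra) ltac:(lra)). lra. }
  set (z := / s). assert (Pz : 0 < z) by (apply Rinv_0_lt_compat; lra).
  assert (Esz : s * z = 1) by (apply Rinv_r; lra).
  assert (Hi : forall x y, x0 <= x <= x0 + h -> y0 <= y <= y0 + h ->
     0 < x * x + y * y /\ Rabs (/ (x * x + y * y)) <= 4 * (z * z)).
  { intros x y hx hy. destruct (Hn x y hx hy) as [Q1 Q2]. rewrite <- norm2_sqr.
    set (rho := norm2 x y) in *. assert (s / 2 * (s / 2) <= rho * rho) by nra.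
    assert (0 < s / 2 * (s / 2)) by nra.
    split; [lra|]. rewrite Rabs_right by (apply Rle_ge; left; apply Rinv_0_lt_compat; lra).
    replace (4 * (z * z)) with (/ (s / 2 * (s / 2))) by (unfold z; field; lra).
    apply Rinv_le_contravar; auto. }
  assert (Hc1 : x0 <= cx <= x0 + h) by (unfold cx; lra).
  assert (Hc2 : y0 <= cy <= y0 + h) by (unfold cy; lra).
  destruct (Hn cx cy Hc1 Hc2) as [Nc1 Nc2].
  destruct (Hi cx cy Hc1 Hc2) as [Pc Ic].
  destruct (HB (2 * s) cx cy ltac:(lra) ltac:(lra) ltac:(lra) Nc2) as [BG [BG1 BG2]]. fold b in BG, BG1, BG2.
  set (i0 := / (cx * cx + cy * cy)) in *.
  (* Gradient and value of the quotient at the centre, by the quotient rule. *)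
  exists (G1 cx cy * i0 - G cx cy * (2 * cx) * (i0 * i0)),
         (G2 cx cy * i0 - G cx cy * (2 * cy) * (i0 * i0)), (G cx cy * i0).
  intros x y hx hy. destruct (Hi x y hx hy) as [P I].
  pose proof (HT (2 * s) x0 y0 (x0 + h) (y0 + h) h cx cy x y Px Py NE Hhi Hc1 Hc2 hx hy
    ltac:(unfold cx; apply Rabs_le; lra) ltac:(unfold cy; apply Rabs_le; lra)) as HE. fold b in HE.
  set (i1 := / (x * x + y * y)) in *.
  set (d1 := x - cx) in *. set (d2 := y - cy) in *.
  assert (Hd1 : Rabs d1 <= h) by (unfold d1, cx; apply Rabs_le; lra).
  assert (Hd2 : Rabs d2 <= h) by (unfold d2, cy; apply Rabs_le; lra).
  set (T := G1 cx cy * d1 + G2 cx cy * d2) in *.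
  set (q := 2 * cx * d1 + 2 * cy * d2). set (dd := d1 * d1 + d2 * d2).
  assert (HT' : Rabs T <= 4 * K * s * b * h).
  { replace (4 * K * s * b * h) with (K * (2 * s) * b * h + K * (2 * s) * b * h) by ring.
    apply Rabs_plus_le; apply Rabs_mult_le; auto. }
  assert (Hcx : Rabs (2 * cx) <= 4 * s).
  { rewrite Rabs_right by lra. pose proof (norm2_ge_l cx cy). lra. }
  assert (Hcy : Rabs (2 * cy) <= 4 * s).
  { rewrite Rabs_right by lra. pose proof (norm2_ge_r cx cy). lra. }
  assert (Hq : Rabs q <= 8 * s * h).
  { replace (8 * s * h) with (4 * s * h + 4 * s * h) by ring.
    apply Rabs_plus_le; apply Rabs_mult_le; auto. }
  assert (Hdd : Rabs dd <= 2 * (h * h)).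
  { replace (2 * (h * h)) with (h * h + h * h) by ring. apply Rabs_plus_le; apply Rabs_mult_le; auto. }
  assert (HD : Rabs (q + dd) <= 10 * s * h).
  { replace (10 * s * h) with (8 * s * h + 2 * (s * h)) by ring. apply Rabs_plus_le; auto. nra. }
  assert (Edd : x * x + y * y = cx * cx + cy * cy + (q + dd)) by (unfold q, dd, d1, d2; ring).
  (* The increment of [|xi|^2] is [q + dd], with [q] linear and [dd] quadratic in the displacement.
     [E1] and [E2] expand the inverse to order zero and one with exact remainders. *)
  assert (E1 : i1 - i0 = - (q + dd) * (i1 * i0)) by (unfold i1, i0; rewrite Edd; field; lra).
  assert (E2 : i1 - i0 + q * (i0 * i0) = - dd * (i0 * i0) + (q + dd) * (q + dd) * (i1 * (i0 * i0))).
  { unfold i1, i0; rewrite Edd; field; lra. }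
  set (Gc := G cx cy) in *. set (Ex := G x y - Gc - T) in *.
  assert (HGc : Rabs Gc <= 8 * K * (s * s) * b) by lra.
  assert (HI2 : Rabs (i0 * i0) <= 4 * (z * z) * (4 * (z * z))) by (apply Rabs_mult_le; auto).
  split.
  - replace (G x y / (x * x + y * y) - Gc * i0
       - ((G1 cx cy * i0 - Gc * (2 * cx) * (i0 * i0)) * d1 + (G2 cx cy * i0 - Gc * (2 * cy) * (i0 * i0)) * d2))
     with (Ex * i1 + T * (i1 - i0) + Gc * (i1 - i0 + q * (i0 * i0))).
    2:{ unfold Ex, T, q, Rdiv. fold i1. ring. }
    rewrite E2, E1.
    (* With [s * z = 1] the coefficients add up to [12 + 640 + 256 + 51200], which is below
       60000. *)
    apply Rle_trans with (3 * K * b * (h * h) * (4 * (z * z))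
       + 4 * K * s * b * h * (10 * s * h * (4 * (z * z) * (4 * (z * z))))
       + 8 * K * (s * s) * b * (2 * (h * h) * (4 * (z * z) * (4 * (z * z)))
           + 10 * s * h * (10 * s * h) * (4 * (z * z) * (4 * (z * z) * (4 * (z * z)))))).
    + repeat apply Rabs_plus_le; repeat apply Rabs_mult_le; rewrite ?Rabs_Ropp; auto.
      apply Rabs_plus_le; repeat apply Rabs_mult_le; rewrite ?Rabs_Ropp; auto.
    + replace (_ + _ + _) with (K * b * (h * h * z * z)
        * (12 + 640 * ((s * z) * (s * z)) + 256 * ((s * z) * (s * z))
           + 51200 * ((s * z) * (s * z) * (s * z) * (s * z)))) by ring.
      rewrite Esz. assert (0 <= K * b) by nra. assert (0 < h * h * z * z).
      { repeat apply Rmult_lt_0_compat; lra. }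
      assert (0 <= K * b * (h * h * z * z)) by nra. nra.
  - replace ((G1 cx cy * i0 - Gc * (2 * cx) * (i0 * i0)) * d1 + (G2 cx cy * i0 - Gc * (2 * cy) * (i0 * i0)) * d2)
     with (T * i0 + (- Gc) * (q * (i0 * i0))) by (unfold T, q; ring).
    apply Rle_trans with (4 * K * s * b * h * (4 * (z * z))
       + 8 * K * (s * s) * b * (8 * s * h * (4 * (z * z) * (4 * (z * z))))).
    + apply Rabs_plus_le; repeat apply Rabs_mult_le; rewrite ?Rabs_Ropp; auto.
    + replace (_ + _) with (K * b * (h * z)
        * (16 * (s * z) + 1024 * ((s * z) * (s * z) * (s * z)))) by ring.
      rewrite Esz. assert (0 <= K * b) by nra. assert (0 < h * z) by nra.
      assert (0 <= K * b * (h * z)) by nra. nra.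
Qed.

(** The difference of norms is controlled through [r^2 - r'^2], the power by the mean value theorem,
    its slope being steepest at [s / 2]. The 32 collects [al <= 2], a factor 2 from [1 / (s / 2)]
    and the 8 of [Hr]. *)
Lemma norm2_Rpower_diff al x y x' y' s h : 0 < al < 2 -> 0 < s ->
  0 <= x -> 0 <= y -> 0 <= x' -> 0 <= y' ->
  s / 2 <= norm2 x y <= 2 * s -> s / 2 <= norm2 x' y' <= 2 * s ->
  Rabs (x - x') <= h -> Rabs (y - y') <= h ->
  Rabs (Rpower (norm2 x y) (- al) - Rpower (norm2 x' y') (- al))
    <= 32 * (h * / s) * Rpower (s / 2) (- al).
Proof.
  intros Hal Hs Hx Hy Hx' Hy' N N' Dx Dy.
  assert (Hh : 0 <= h) by (eapply Rle_trans; [apply Rabs_pos|apply Dx]).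
  set (r := norm2 x y) in *. set (r' := norm2 x' y') in *.
  assert (Hr : Rabs (r - r') <= 8 * h).
  { apply Rmult_le_reg_r with (r + r'); [lra|].
    replace (Rabs (r - r') * (r + r')) with (Rabs ((x - x') * (x + x') + (y - y') * (y + y'))).
    2:{ rewrite <- (Rabs_right (r + r')) by lra. rewrite <- Rabs_mult. f_equal.
        replace ((r - r') * (r + r')) with (r * r - r' * r') by ring.
        unfold r, r'; rewrite !norm2_sqr. ring. }
    assert (x <= r) by apply norm2_ge_l. assert (y <= r) by apply norm2_ge_r.
    assert (x' <= r') by apply norm2_ge_l. assert (y' <= r') by apply norm2_ge_r.
    apply Rle_trans with (h * (r + r') + h * (r + r')).
    - apply Rabs_plus_le; apply Rabs_mult_le; auto; rewrite Rabs_right; lra.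
    - nra. }
  assert (HM : forall p q, s / 2 <= p -> p < q ->
     Rabs (Rpower q (- al) - Rpower p (- al)) <= al * Rpower (s / 2) (- al - 1) * Rabs (q - p)).
  { intros p q Hp Hpq.
    destruct (MVT_cor2 (fun t => Rpower t (- al)) (fun t => - al * Rpower t (- al - 1)) p q Hpq)
      as [c [E Hc]].
    { intros c Hc. apply derivable_pt_lim_power; lra. }
    rewrite E. rewrite !Rabs_mult, Rabs_Ropp, (Rabs_right al) by lra.
    apply Rmult_le_compat_r; [apply Rabs_pos|]. apply Rmult_le_compat_l; [lra|].
    pose proof (Rpower_pos c (- al - 1)). rewrite Rabs_right by lra. apply Rpower_anti; lra. }
  assert (HF : Rabs (Rpower r (- al) - Rpower r' (- al)) <= al * Rpower (s / 2) (- al - 1) * Rabs (r - r')).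
  { destruct (Rtotal_order r r') as [h1|[h1|h1]].
    - rewrite Rabs_minus_sym, (Rabs_minus_sym r). apply HM; lra.
    - rewrite h1, !Rminus_diag, Rabs_R0. lra.
    - apply HM; lra. }
  eapply Rle_trans; [apply HF|].
  assert (E : Rpower (s / 2) (- al - 1) = Rpower (s / 2) (- al) * (2 * / s)).
  { replace (- al - 1) with (- al + - (1)) by ring. rewrite Rpower_plus, (Rpower_Ropp _ 1), Rpower_1 by lra.
    field; lra. }
  rewrite E. pose proof (Rpower_pos (s / 2) (- al)).
  assert (0 < / s) by (apply Rinv_0_lt_compat; auto).
  set (p := Rpower (s / 2) (- al)) in *. set (z := / s) in *.
  apply Rle_trans with (2 * (p * (2 * z)) * (8 * h)).
  - apply Rmult_le_compat; auto using Rabs_pos.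
    + assert (0 < p * (2 * z)) by (apply Rmult_lt_0_compat; lra). nra.
    + assert (0 < p * (2 * z)) by (apply Rmult_lt_0_compat; lra). nra.
  - right; ring.
Qed.


(** * Quadrature error *)

Definition quot (G : R -> R -> R) (x y : R) : R := G x y / (x * x + y * y).

(** What remains of the kernel [|xi|^(-2-al)] when [|xi|^2] is moved to the other factor; the same
    as [omega al 2]. *)
Definition om (al x y : R) : R := Rpower (norm2 x y) (- al).

Lemma dsum_Rabs_le n f B : (forall i j, (i < n)%nat -> (j < n)%nat -> Rabs (f i j) <= B) ->
  Rabs (dsum n f) <= INR n * INR n * B.
Proof.
  intros H. eapply Rle_trans; [apply dsum_abs|]. rewrite <- dsum_const. apply dsum_le; auto.
Qed.

(* The linear part of the interpolation error is odd about the centre of the cell, so only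
   the variation of the weight across the cell contributes to it. *)
Lemma cell_error al K beta G x0 y0 h s m : 0 < al < 2 -> 0 <= K -> 0 <= beta ->
  small_C2 K beta G -> 0 <= x0 -> 0 <= y0 -> 0 < h <= s -> s / 2 <= norm2 x0 y0 ->
  norm2 (x0 + h) (y0 + h) <= 2 * s -> (0 < m)%nat ->
  let w := h / INR m in
  let X p := x0 + (INR p + / 2) * w in
  let Y p := y0 + (INR p + / 2) * w in
  let gbar := / 4 * (quot G x0 y0 + quot G (x0 + h) y0 + quot G x0 (y0 + h)
                     + quot G (x0 + h) (y0 + h)) in
  Rabs (dsum m (fun p q => om al (X p) (Y q) * (gbar - quot G (X p) (Y q))) * w * w)
  <= 152000 * K * (Rpower (2 * s) beta * Rpower (s / 2) (- al)) * (h * h * / s * / s) * (h * h).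
Proof.
  intros Hal HK Hb HG Px Py Hh Hlo Hhi Hm w X Y gbar.
  assert (Pm : 0 < INR m) by (apply lt_0_INR; lia).
  assert (Pw : 0 < w) by (apply Rdiv_lt_0_compat; lra).
  assert (Emw : INR m * w = h) by (unfold w; field; lra).
  destruct (cell_linear K beta G x0 y0 h s HK Hb HG Px Py Hh Hlo Hhi) as [A [B [g0 HL]]].
  set (b := Rpower (2 * s) beta) in *. set (z := / s) in *.
  assert (Pz : 0 < z) by (apply Rinv_0_lt_compat; lra).
  assert (Pb : 0 < b) by apply Rpower_pos.
  set (c := Rpower (s / 2) (- al)). assert (Pc : 0 < c) by apply Rpower_pos.
  set (C1 := 60000 * K * b * (h * h * z * z)) in *.
  set (C2 := 2000 * K * b * (h * z)) in *.
  assert (PC1 : 0 <= C1).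
  { unfold C1. assert (0 < h * h * z * z) by (repeat apply Rmult_lt_0_compat; lra).
    assert (0 <= K * b) by nra. nra. }
  set (l := fun x y => A * (x - (x0 + h / 2)) + B * (y - (y0 + h / 2))).
  assert (Hg : forall x y, x0 <= x <= x0 + h -> y0 <= y <= y0 + h ->
     Rabs (quot G x y - g0 - l x y) <= C1 /\ Rabs (l x y) <= C2).
  { intros x y hx hy. apply HL; auto. }
  (* The linear part averages to zero over the four vertices. *)
  assert (Hgb : Rabs (gbar - g0) <= C1).
  { destruct (Hg x0 y0 ltac:(lra) ltac:(lra)) as [V1 _].
    destruct (Hg (x0 + h) y0 ltac:(lra) ltac:(lra)) as [V2 _].
    destruct (Hg x0 (y0 + h) ltac:(lra) ltac:(lra)) as [V3 _].
    destruct (Hg (x0 + h) (y0 + h) ltac:(lra) ltac:(lra)) as [V4 _].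
    unfold l in *. apply Rabs_le_inv in V1, V2, V3, V4.
    unfold gbar. apply Rabs_le. lra. }
  assert (HX : forall p, (p < m)%nat -> 0 < (INR p + / 2) * w < h).
  { intros p Hp. pose proof (pos_INR p).
    assert (INR p + 1 <= INR m) by (rewrite <- S_INR; apply le_INR; lia). nra. }
  assert (HXY : forall p q, (p < m)%nat -> (q < m)%nat ->
     (x0 <= X p <= x0 + h /\ y0 <= Y q <= y0 + h)
     /\ s / 2 <= norm2 (X p) (Y q) <= 2 * s).
  { intros p q Hp Hq. pose proof (HX p Hp). pose proof (HX q Hq).
    assert (x0 <= X p <= x0 + h) by (unfold X; lra).
    assert (y0 <= Y q <= y0 + h) by (unfold Y; lra).
    pose proof (norm2_le x0 y0 (X p) (Y q) ltac:(lra) ltac:(lra)).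
    pose proof (norm2_le (X p) (Y q) (x0 + h) (y0 + h) ltac:(lra) ltac:(lra)). lra. }
  assert (Hom : forall p q, (p < m)%nat -> (q < m)%nat -> Rabs (om al (X p) (Y q)) <= c).
  { intros p q Hp Hq. destruct (HXY p q Hp Hq) as [_ N].
    pose proof (Rpower_pos (norm2 (X p) (Y q)) (- al)). unfold om.
    rewrite Rabs_right by lra. apply Rpower_anti; lra. }
  set (D1 := dsum m (fun p q => om al (X p) (Y q) *
     ((gbar - g0) + - (quot G (X p) (Y q) - g0 - l (X p) (Y q))))).
  set (D2 := dsum m (fun p q => om al (X p) (Y q) * l (X p) (Y q))).
  assert (ED : dsum m (fun p q => om al (X p) (Y q) * (gbar - quot G (X p) (Y q))) = D1 - D2).
  { unfold D1, D2. rewrite <- dsum_minus. apply dsum_ext; intros; ring. }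
  assert (B1 : Rabs D1 <= INR m * INR m * (c * (C1 + C1))).
  { apply dsum_Rabs_le; intros p q Hp Hq. apply Rabs_mult_le; auto.
    destruct (HXY p q Hp Hq) as [[I1 I2] _]. destruct (Hg _ _ I1 I2) as [V _].
    apply Rabs_plus_le; auto. rewrite Rabs_Ropp; auto. }
  (* Adding the sum to its reversal pairs each midpoint with its reflection in the centre, where [l]
     changes sign. Only the difference of the weights at the two points survives, and it brings the
     missing factor [h / s]. *)
  assert (B2 : Rabs (2 * D2) <= INR m * INR m * (32 * (h * z) * c * C2)).
  { replace (2 * D2) with (dsum m (fun p q =>
       (om al (X p) (Y q) - om al (X (m - 1 - p)%nat) (Y (m - 1 - q)%nat)) * l (X p) (Y q))).
    - apply dsum_Rabs_le; intros p q Hp Hq.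
      destruct (HXY p q Hp Hq) as [[I1 I2] N].
      destruct (HXY (m - 1 - p)%nat (m - 1 - q)%nat ltac:(lia) ltac:(lia)) as [[I1' I2'] N'].
      destruct (Hg _ _ I1 I2) as [_ V]. apply Rabs_mult_le; auto.
      apply norm2_Rpower_diff; auto; try lra; apply Rabs_le; lra.
    - replace (2 * D2) with (D2 + D2) by ring. unfold D2 at 2.
      rewrite <- (dsum_rev m (fun p q => om al (X p) (Y q) * l (X p) (Y q))).
      unfold D2. rewrite <- dsum_plus. apply dsum_ext; intros p q Hp Hq.
      assert (EX : forall a p, (p < m)%nat ->
         a + (INR (m - 1 - p) + / 2) * w - (a + h / 2) = - (a + (INR p + / 2) * w - (a + h / 2))).
      { intros a p' Hp'. rewrite !minus_INR by lia. simpl INR. rewrite <- Emw. field. }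
      assert (El : l (X (m - 1 - p)%nat) (Y (m - 1 - q)%nat) = - l (X p) (Y q)).
      { unfold l, X, Y. rewrite !EX by auto. ring. }
      rewrite El. ring. }
  rewrite ED.
  assert (HD2 : Rabs D2 <= INR m * INR m * (16 * (h * z) * c * C2)).
  { rewrite Rabs_mult, (Rabs_right 2) in B2 by lra. lra. }
  assert (BT : Rabs (D1 - D2) <= INR m * INR m * (c * (C1 + C1)) + INR m * INR m * (16 * (h * z) * c * C2)).
  { unfold Rminus. apply Rabs_plus_le; auto. rewrite Rabs_Ropp; auto. }
  rewrite Rmult_assoc, Rabs_mult, (Rabs_right (w * w)) by nra.
  apply Rle_trans with ((INR m * INR m * (c * (C1 + C1)) + INR m * INR m * (16 * (h * z) * c * C2)) * (w * w)).
  { apply Rmult_le_compat_r; [nra|auto]. }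
  replace (_ * (w * w)) with ((INR m * w) * (INR m * w) * (c * (C1 + C1) + 16 * (h * z) * c * C2)) by ring.
  rewrite Emw. unfold C1, C2. 
  (* [152000 = 2 * 60000 + 16 * 2000]. *)
  replace (h * h * (c * (60000 * K * b * (h * h * z * z) + 60000 * K * b * (h * h * z * z)) +
      16 * (h * z) * c * (2000 * K * b * (h * z))))
    with (152000 * (K * (b * c) * (h * h * z * z) * (h * h))) by ring.
  replace (152000 * K * (b * c) * (h * h * z * z) * (h * h))
    with (152000 * (K * (b * c) * (h * h * z * z) * (h * h))) by ring.
  apply Rmult_le_compat_r; [|lra].
  repeat apply Rmult_le_pos; lra.
Qed.

(** The norm dominates both coordinates, so [|xi|^(-al)] is at most a product of two powers of
    exponent [- al / 2], each summable because [al / 2 < 1]. The factors [(1/2)^(-al/2)] come from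
    [k + 1/2 >= (k + 1) / 2], which trades midpoints for right endpoints. *)
Lemma corner_sum al h m : 0 < al < 2 -> 0 < h -> (0 < m)%nat ->
  let w := h / INR m in
  dsum m (fun p q => om al ((INR p + / 2) * w) ((INR q + / 2) * w)) * w * w
  <= Rpower (/ 2) (- (al / 2)) * Rpower (/ 2) (- (al / 2))
     * / (1 - al / 2) * / (1 - al / 2) * Rpower h (2 - al).
Proof.
  intros Hal Hh Hm w.
  assert (Pm : 0 < INR m) by (apply lt_0_INR; lia).
  assert (Pw : 0 < w) by (apply Rdiv_lt_0_compat; lra).
  assert (Emw : INR m * w = h) by (unfold w; field; lra).
  set (q := al / 2). set (c := Rpower (/ 2) (- q)).
  pose proof (sum_Rpower_le q w m ltac:(unfold q; lra) Pw Hm) as HS. rewrite Emw in HS.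
  set (S0 := sumR m (fun k => w * Rpower (INR (S k) * w) (- q))) in *.
  assert (P0 : 0 <= S0).
  { apply sumR_nonneg; intros. pose proof (Rpower_pos (INR (S i) * w) (- q)). nra. }
  assert (Pc : 0 < c) by apply Rpower_pos.
  apply Rle_trans with ((c * c) * (S0 * S0)).
  - unfold S0. rewrite <- dsum_prod, <- dsum_scal, Rmult_assoc, Rmult_comm, <- dsum_scal.
    apply dsum_le; intros i j _ _. unfold om.
    replace (- al) with (- q + - q) by (unfold q; field). rewrite Rpower_plus.
    assert (Hx : forall k r, (INR k + / 2) * w <= r ->
       Rpower r (- q) <= c * Rpower (INR (S k) * w) (- q)).
    { intros k r Hk. pose proof (pos_INR k). unfold c. rewrite Rpower_mult_distr.
      - apply Rpower_anti; [unfold q; lra|]. rewrite S_INR. split; nra.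
      - lra.
      - rewrite S_INR; nra. }
    pose proof (Hx i _ (norm2_ge_l ((INR i + / 2) * w) ((INR j + / 2) * w))) as H1.
    pose proof (Hx j _ (norm2_ge_r ((INR i + / 2) * w) ((INR j + / 2) * w))) as H2.
    pose proof (Rpower_pos (norm2 ((INR i + / 2) * w) ((INR j + / 2) * w)) (- q)).
    set (a := Rpower (norm2 ((INR i + / 2) * w) ((INR j + / 2) * w)) (- q)) in *.
    set (b1 := Rpower (INR (S i) * w) (- q)) in *. set (b2 := Rpower (INR (S j) * w) (- q)) in *.
    replace (c * c * (w * b1 * (w * b2))) with (w * w * ((c * b1) * (c * b2))) by ring.
    apply Rmult_le_compat_l; [nra|]. apply Rmult_le_compat; lra.
  - replace (2 - al) with ((1 - q) + (1 - q)) by (unfold q; field). rewrite Rpower_plus.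
    set (R0 := Rpower h (1 - q)) in *. unfold Rdiv in HS. fold q.
    replace (c * c * / (1 - q) * / (1 - q) * (R0 * R0))
      with ((c * c) * ((R0 * / (1 - q)) * (R0 * / (1 - q)))) by ring.
    apply Rmult_le_compat_l; [nra|]. apply Rmult_le_compat; auto.
Qed.

(** The corner branch is [(2 g(h,0) + 2 g(0,h)) / 4], that is [c_10 = c_01 = 2] and [c_11 = 0]. In
    both branches the weights add up to 1. *)
Definition vertex_avg (h : R) (g : R -> R -> R) (i j : nat) : R :=
  if (Nat.eqb i 0 && Nat.eqb j 0)%bool then / 2 * (g h 0 + g 0 h)
  else / 4 * (g (INR i * h) (INR j * h) + g (INR (S i) * h) (INR j * h)
              + g (INR i * h) (INR (S j) * h) + g (INR (S i) * h) (INR (S j) * h)).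

(** The whole discretization error before any limit: for [h = L / N], a midpoint sum of mesh [h / m]
    for the integral, over [(0, L)^2] without the disk of radius [r], of the weight times the vertex
    average minus [g]. *)
Definition quad_error (al h r : R) (N m : nat) (g : R -> R -> R) : R :=
  dsum N (fun i j => dsum m (fun p q =>
    let x := (INR (i * m + p) + / 2) * (h / INR m) in
    let y := (INR (j * m + q) + / 2) * (h / INR m) in
    qcut r (om al) x y * (vertex_avg h g i j - g x y))) * (h / INR m) * (h / INR m).

(** The constant depends on [G] only through [K]. The corner cell is estimated by size alone and
    contributes the order [h^(al+eps) h^(2-al)], that is [h^(2+eps)]; all other cells use
    [cell_error]. *)
Lemma quad_error_bound al eps K L : 0 < al < 2 -> 0 < eps < 2 -> 0 <= K -> 0 < L ->
  exists C, 0 <= C /\ forall G N m r h, small_C2 K (al + eps) G -> (0 < N)%nat -> (0 < m)%nat ->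
    h = L / INR N -> 0 < r <= h ->
    Rabs (quad_error al h r N m (quot G)) <= C * (h * h).
Proof.
  intros Hal Heps HK HL. set (beta := al + eps).
  set (c1 := Rpower 2 beta * Rpower (/ 2) (- al)).
  (* Chosen so that [s^(eps-2)] is the square of [s^(-q)] with [q < 1]: the sum over cells is then
     dominated by the square of a bounded one-dimensional sum. *)
  set (q := 1 - eps / 2).
  set (D := Rpower L (1 - q) / (1 - q)).
  set (C0 := 152000 * K * c1).
  set (c2 := Rpower (/ 2) (- (al / 2)) * Rpower (/ 2) (- (al / 2)) * / (1 - al / 2) * / (1 - al / 2)).
  set (C1 := 4 * K * Rpower 2 beta * c2 * Rpower L eps).
  assert (Pc1 : 0 < c1) by (apply Rmult_lt_0_compat; apply Rpower_pos).
  assert (Pc2 : 0 < c2).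
  { assert (0 < / (1 - al / 2)) by (apply Rinv_0_lt_compat; lra).
    unfold c2. pose proof (Rpower_pos (/ 2) (- (al / 2))). repeat apply Rmult_lt_0_compat; auto. }
  assert (PC0 : 0 <= C0) by (unfold C0; nra).
  assert (PC1 : 0 <= C1).
  { unfold C1. pose proof (Rpower_pos 2 beta). pose proof (Rpower_pos L eps).
    assert (0 <= 4 * K * Rpower 2 beta) by nra. assert (0 <= c2 * Rpower L eps) by nra. nra. }
  exists (C1 + C0 * (D * D)). split; [nra|].
  intros G N m r h HG HN Hm Eh Hr.
  assert (PN : 0 < INR N) by (apply lt_0_INR; lia).
  assert (Pm : 0 < INR m) by (apply lt_0_INR; lia).
  assert (Ph : 0 < h) by lra.
  assert (ENh : INR N * h = L) by (rewrite Eh; field; lra).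
  assert (HhL : h <= L).
  { rewrite <- ENh. assert (1 <= INR N) by (change 1 with (INR 1); apply le_INR; lia). nra. }
  set (w := h / INR m). assert (Pw : 0 < w) by (apply Rdiv_lt_0_compat; lra).
  assert (Emw : INR m * w = h) by (unfold w; field; lra).
  assert (Hmid : forall i p, (p < m)%nat ->
     (INR (i * m + p) + / 2) * w = INR i * h + (INR p + / 2) * w /\ 0 < (INR p + / 2) * w < h).
  { intros i p Hp. rewrite plus_INR, mult_INR. pose proof (pos_INR p).
    assert (INR p + 1 <= INR m) by (rewrite <- S_INR; apply le_INR; lia).
    split; [rewrite <- Emw; ring|nra]. }
  set (T := fun i j => dsum m (fun p q =>
    qcut r (om al) ((INR (i * m + p) + / 2) * w) ((INR (j * m + q) + / 2) * w)
    * (vertex_avg h (quot G) i j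
       - quot G ((INR (i * m + p) + / 2) * w) ((INR (j * m + q) + / 2) * w))) * w * w).
  assert (ET : quad_error al h r N m (quot G) = dsum N T).
  { unfold quad_error, T. fold w. rewrite Rmult_assoc, Rmult_comm, <- dsum_scal.
    apply dsum_ext; intros; ring. }
  set (a := fun k => h * Rpower (INR (S k) * h) (- q)).
  assert (Pa : forall k, 0 <= a k).
  { intros; unfold a. pose proof (Rpower_pos (INR (S k) * h) (- q)). nra. }
  assert (HT : forall i j, (i < N)%nat -> (j < N)%nat ->
     Rabs (T i j) <= (if (Nat.eqb i 0 && Nat.eqb j 0)%bool then C1 * (h * h) else 0)
       + C0 * (h * h) * (a i * a j)).
  { intros i j Hi Hj.
    assert (Hcell : 0 <= C0 * (h * h) * (a i * a j)).
    { assert (0 <= C0 * (h * h)) by (assert (0 < h * h) by nra; nra).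
      assert (0 <= a i * a j) by (apply Rmult_le_pos; apply Pa). nra. }
    destruct (Nat.eqb i 0 && Nat.eqb j 0)%bool eqn:Eij.
    - apply andb_prop in Eij. destruct Eij as [Ei Ej].
      apply Nat.eqb_eq in Ei, Ej. subst i j.
      cut (Rabs (T 0%nat 0%nat) <= C1 * (h * h)); [lra|].
      assert (Hg : forall x y, 0 <= x <= h -> 0 <= y <= h -> (x, y) <> (0, 0) ->
         Rabs (quot G x y) <= 2 * K * Rpower (2 * h) beta).
      { intros x y hx hy NE. unfold quot. apply Rpower_bound with (norm2 x y); unfold beta; try lra.
        - pose proof (norm2_le_sum x y ltac:(lra) ltac:(lra)). split; [apply norm2_pos; auto|lra].
        - apply small_C2_quot; auto; lra. }
      assert (HV : Rabs (vertex_avg h (quot G) 0 0) <= 2 * K * Rpower (2 * h) beta).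
      { unfold vertex_avg. simpl.
        pose proof (Hg h 0 ltac:(lra) ltac:(lra) ltac:(intros E; injection E; lra)) as V1.
        pose proof (Hg 0 h ltac:(lra) ltac:(lra) ltac:(intros E; injection E; lra)) as V2.
        apply Rabs_le_inv in V1, V2. apply Rabs_le; lra. }
      unfold T. rewrite Rmult_assoc, Rabs_mult, (Rabs_right (w * w)) by nra.
      pose proof (corner_sum al h m Hal Ph Hm) as HC. cbv zeta in HC. fold w c2 in HC.
      apply Rle_trans with (4 * K * Rpower (2 * h) beta
        * (dsum m (fun p q => om al ((INR p + / 2) * w) ((INR q + / 2) * w)) * w * w)).
      { rewrite (Rmult_assoc (dsum _ _)), <- (Rmult_assoc (4 * K * Rpower (2 * h) beta)). apply Rmult_le_compat_r; [nra|].
        rewrite <- dsum_scal. eapply Rle_trans; [apply dsum_abs|]. apply dsum_le; intros p q' Hp Hq.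
        destruct (Hmid 0%nat p Hp) as [E1 I1]. destruct (Hmid 0%nat q' Hq) as [E2 I2].
        rewrite E1, E2. simpl (INR 0). rewrite Rmult_0_l, !Rplus_0_l.
        rewrite Rmult_comm. apply Rabs_mult_le.
        - replace (4 * K * Rpower (2 * h) beta)
            with (2 * K * Rpower (2 * h) beta + 2 * K * Rpower (2 * h) beta) by ring.
          unfold Rminus. apply Rabs_plus_le; auto. rewrite Rabs_Ropp. apply Hg; try lra.
          intros E; injection E; lra.
        - unfold qcut. pose proof (Rpower_pos (norm2 ((INR p + / 2) * w) ((INR q' + / 2) * w)) (- al)).
          fold (om al ((INR p + / 2) * w) ((INR q' + / 2) * w)) in H.
          destruct Rlt_dec; [rewrite Rabs_right; lra|rewrite Rabs_R0; lra]. }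
      apply Rle_trans with (4 * K * Rpower (2 * h) beta * (c2 * Rpower h (2 - al))).
      { apply Rmult_le_compat_l; auto. pose proof (Rpower_pos (2 * h) beta). 
        repeat apply Rmult_le_pos; lra. }
      rewrite <- Rpower_mult_distr by lra.
      replace (4 * K * (Rpower 2 beta * Rpower h beta) * (c2 * Rpower h (2 - al)))
        with (4 * K * Rpower 2 beta * c2 * (Rpower h beta * Rpower h (2 - al))) by ring.
      rewrite <- Rpower_plus. replace (beta + (2 - al)) with (eps + (1 + 1)) by (unfold beta; ring).
      rewrite !Rpower_plus, !Rpower_1 by auto. unfold C1.
      rewrite <- !Rmult_assoc. do 2 (apply Rmult_le_compat_r; [lra|]).
      apply Rmult_le_compat_l.
      + pose proof (Rpower_pos 2 beta). assert (0 <= 4 * K * Rpower 2 beta) by nra. nra.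
      + apply Rle_Rpower_l; lra.
    (* [s = (k + 1) h] meets both size conditions of [cell_error]: [k >= 1] gives [s / 2 <= k h],
       and the far vertex has both coordinates at most [s]. As [s] is at least [(i + 1) h] and
       [(j + 1) h], the power [s^(-2 q)] is at most a product of one power for each index. *)
    - rewrite Rplus_0_l. set (k := Nat.max i j).
      assert (Hk : (1 <= k)%nat).
      { unfold k. destruct i, j; simpl in *; try discriminate; lia. }
      set (s := INR (S k) * h).
      assert (Hik : INR i <= INR k) by (apply le_INR; unfold k; lia).
      assert (Hjk : INR j <= INR k) by (apply le_INR; unfold k; lia).
      assert (Hk1 : 1 <= INR k) by (change 1 with (INR 1); apply le_INR; auto).
      pose proof (pos_INR i) as Pi. pose proof (pos_INR j) as Pj.
      assert (Hs : h <= s) by (unfold s; rewrite S_INR; nra).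
      assert (Hlo : INR k * h <= norm2 (INR i * h) (INR j * h)).
      { unfold k. destruct (Nat.max_spec i j) as [[_ ->]|[_ ->]].
        - apply norm2_ge_r.
        - apply norm2_ge_l. }
      assert (Hhi : norm2 (INR i * h + h) (INR j * h + h) <= 2 * s).
      { eapply Rle_trans; [apply norm2_le_sum; nra|]. unfold s; rewrite S_INR; nra. }
      pose proof (cell_error al K beta G (INR i * h) (INR j * h) h s m Hal HK ltac:(unfold beta; lra)
        HG ltac:(nra) ltac:(nra) ltac:(lra) ltac:(unfold s; rewrite S_INR; nra) Hhi Hm) as HC.
      cbv zeta in HC. fold w in HC.
      match type of HC with Rabs (?u * w * w) <= _ => replace (T i j) with (u * w * w) end.
      2:{ unfold T. do 2 f_equal. apply dsum_ext; intros p q' Hp Hq.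
          destruct (Hmid i p Hp) as [E1 I1]. destruct (Hmid j q' Hq) as [E2 I2].
          rewrite E1, E2. f_equal.
          (* Outside the corner cell every midpoint is farther than [h >= r] from the origin, so
             nothing is excised. *)
          - unfold qcut. destruct Rlt_dec as [|n]; auto. exfalso. apply n.
            assert (INR i * h < INR i * h + (INR p + / 2) * w) by lra.
            assert (INR j * h < INR j * h + (INR q' + / 2) * w) by lra.
            apply Rle_lt_trans with (INR k * h); [nra|].
            unfold k. destruct (Nat.max_spec i j) as [[_ ->]|[_ ->]].
            + eapply Rlt_le_trans; [|apply norm2_ge_r]. lra.
            + eapply Rlt_le_trans; [|apply norm2_ge_l]. lra.
          - f_equal. unfold vertex_avg. rewrite Eij.
            rewrite !S_INR. rewrite !(Rmult_plus_distr_r _ 1), !Rmult_1_l. reflexivity. }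
      eapply Rle_trans; [apply HC|].
      assert (Ps : 0 < s) by lra.
      assert (Esc : Rpower (2 * s) beta * Rpower (s / 2) (- al) = c1 * Rpower s eps).
      { unfold Rdiv. rewrite <- !Rpower_mult_distr by lra. unfold c1.
        replace eps with (beta + - al) by (unfold beta; ring). rewrite (Rpower_plus beta (- al) s). ring. }
      rewrite Esc.
      assert (Eq : Rpower s eps * / s * / s = Rpower s (- q) * Rpower s (- q)).
      { rewrite <- (Rpower_1 s) at 2 3 by auto. rewrite <- !Rpower_Ropp, <- !Rpower_plus.
        f_equal. unfold q. field. }
      replace (152000 * K * (c1 * Rpower s eps) * (h * h * / s * / s) * (h * h))
        with (C0 * (h * h) * (h * h * (Rpower s eps * / s * / s))) by (unfold C0; ring).
      rewrite Eq. apply Rmult_le_compat_l; [nra|]. unfold a.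
      assert (Hsi : forall i, (i <= k)%nat -> Rpower s (- q) <= Rpower (INR (S i) * h) (- q)).
      { intros i' Hi'. apply Rpower_anti; [unfold q; lra|]. unfold s.
        assert (INR (S i') <= INR (S k)) by (apply le_INR; lia).
        assert (0 < INR (S i')) by (apply lt_0_INR; lia). split; nra. }
      pose proof (Hsi i ltac:(unfold k; lia)). pose proof (Hsi j ltac:(unfold k; lia)).
      pose proof (Rpower_pos s (- q)).
      replace (h * h * (Rpower s (- q) * Rpower s (- q)))
        with ((h * Rpower s (- q)) * (h * Rpower s (- q))) by ring.
      apply Rmult_le_compat; try nra; apply Rmult_le_compat_l; lra. }
  rewrite ET. eapply Rle_trans; [apply dsum_abs|].
  eapply Rle_trans; [apply dsum_le; exact HT|].
  rewrite dsum_plus, dsum_scal, dsum_prod.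
  rewrite (dsum_single N _ 0%nat 0%nat); auto.
  2:{ intros i j Hi Hj NE. destruct i, j; simpl; auto. congruence. }
  cbn [Nat.eqb andb].
  pose proof (sum_Rpower_le q h N ltac:(unfold q; lra) Ph HN) as HS. rewrite ENh in HS.
  fold D in HS. fold a in HS.
  change (fun k => h * Rpower (INR (S k) * h) (- q)) with a in HS.
  assert (0 <= sumR N a) by (apply sumR_nonneg; auto).
  assert (sumR N a * sumR N a <= D * D) by (apply Rmult_le_compat; auto).
  assert (C0 * (h * h) * (sumR N a * sumR N a) <= C0 * (h * h) * (D * D)).
  { apply Rmult_le_compat_l; auto. apply Rmult_le_pos; nra. }
  lra.
Qed.

(** The grid, the weight, the disk and the rule for the vertex averages are invariant under
    exchanging the coordinates, so the sum equals its own opposite. *)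
Lemma quad_error_antisym al h r N m g : (forall x y, g y x = - g x y) ->
  quad_error al h r N m g = 0.
Proof.
  intros Hg. unfold quad_error.
  assert (HV : forall i j, vertex_avg h g j i = - vertex_avg h g i j).
  { intros i j. unfold vertex_avg. rewrite (Bool.andb_comm (Nat.eqb j 0)).
    destruct (Nat.eqb i 0 && Nat.eqb j 0)%bool.
    - pose proof (Hg h 0). lra.
    - pose proof (Hg (INR i * h) (INR j * h)). pose proof (Hg (INR (S i) * h) (INR j * h)).
      pose proof (Hg (INR i * h) (INR (S j) * h)). pose proof (Hg (INR (S i) * h) (INR (S j) * h)). lra. }
  match goal with |- ?d * _ * _ = 0 => assert (E : d = - d) end.
  { match goal with |- _ = - dsum N ?F => rewrite <- (dsum_swap N F) at 1;
      replace (- dsum N F) with ((-1) * dsum N F) by ring end.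
    rewrite <- dsum_scal. apply dsum_ext; intros i j _ _.
    rewrite <- dsum_swap, <- dsum_scal. apply dsum_ext; intros p q _ _.
    cbv zeta. rewrite HV, Hg.
    unfold qcut, om. rewrite (norm2_comm ((INR (j * m + q) + / 2) * (h / INR m))).
    destruct Rlt_dec; ring. }
  match goal with |- ?d * _ * _ = 0 => replace d with 0 by lra end. ring.
Qed.


(** * The three integrands: local integrability and folding *)

Lemma Rintable_of_lipschitz f a b c d : a < b -> c < d -> loc_lipschitz f -> Rintable f a b c d.
Proof.
  intros Hab Hcd Hf.
  set (M := Rabs a + Rabs b + Rabs c + Rabs d).
  destruct (Hf M) as [B [PB HB]].
  { unfold M. pose proof (Rabs_pos a). pose proof (Rabs_pos b). pose proof (Rabs_pos c).
    pose proof (Rabs_pos d). lra. }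
  assert (HM : forall x, a <= x <= b \/ c <= x <= d -> Rabs x <= M).
  { intros x Hx. unfold M.
    unfold Rabs; destruct (Rcase_abs a), (Rcase_abs b), (Rcase_abs c), (Rcase_abs d), (Rcase_abs x); lra. }
  apply Rintable_lipschitz with B; auto.
Qed.

(** Half-plane indicators are monotone; those of the cells and of [D_2] are polynomials in them. *)
Lemma Rintable_ind_x (P : R -> Prop) (dec : forall x, {P x} + {~ P x}) a b c d : a < b -> c < d ->
  (forall x x', x <= x' -> P x -> P x') \/ (forall x x', x <= x' -> P x' -> P x) ->
  Rintable (fun x y => if dec x then 1 else 0) a b c d.
Proof.
  intros Hab Hcd [H|H].
  - apply Rintable_incr_incr; auto. intros x x' _ _ [_ Hx] _ _ _.
    pose proof (H x x' Hx). destruct (dec x), (dec x'); try lra; tauto.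
  - apply Rintable_decr_decr; auto. intros x x' _ _ [_ Hx] _ _ _.
    pose proof (H x x' Hx). destruct (dec x), (dec x'); try lra; tauto.
Qed.

Lemma Rintable_ind_y (P : R -> Prop) (dec : forall x, {P x} + {~ P x}) a b c d : a < b -> c < d ->
  (forall x x', x <= x' -> P x -> P x') \/ (forall x x', x <= x' -> P x' -> P x) ->
  Rintable (fun x y => if dec y then 1 else 0) a b c d.
Proof.
  intros Hab Hcd [H|H].
  - apply Rintable_incr_incr; auto. intros _ _ y y' _ _ [_ Hy] _.
    pose proof (H y y' Hy). destruct (dec y), (dec y'); try lra; tauto.
  - apply Rintable_decr_decr; auto. intros _ _ y y' _ _ [_ Hy] _.
    pose proof (H y y' Hy). destruct (dec y), (dec y'); try lra; tauto.
Qed.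

Lemma Rintable_indI h i j a b c d : a < b -> c < d -> Rintable (indI h i j) a b c d.
Proof.
  intros Hab Hcd.
  apply Rintable_ext with (fun x y =>
    ((if Rle_dec (INR i * h) x then 1 else 0) * (if Rle_dec x (INR (S i) * h) then 1 else 0))
    * ((if Rle_dec (INR j * h) y then 1 else 0) * (if Rle_dec y (INR (S j) * h) then 1 else 0))); auto.
  { intros x y _ _. unfold indI. repeat destruct Rle_dec; ring. }
  apply Rintable_mult; auto; apply Rintable_mult; auto.
  - apply (Rintable_ind_x (fun x => INR i * h <= x)); auto. left; intros; lra.
  - apply (Rintable_ind_x (fun x => x <= INR (S i) * h) (fun x => Rle_dec x _)); auto. right; intros; lra.
  - apply (Rintable_ind_y (fun x => INR j * h <= x)); auto. left; intros; lra.
  - apply (Rintable_ind_y (fun x => x <= INR (S j) * h) (fun x => Rle_dec x _)); auto. right; intros; lra.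
Qed.

Lemma Rintable_indD2 L a b c d : a < b -> c < d -> Rintable (indD2 L) a b c d.
Proof.
  intros Hab Hcd.
  apply Rintable_ext with (fun x y =>
    ((if Rle_dec 0 x then 1 else 0) * (if Rle_dec 0 y then 1 else 0))
    * (1 - ((if Rlt_dec 0 x then 1 else 0) * (if Rlt_dec x L then 1 else 0))
       * ((if Rlt_dec 0 y then 1 else 0) * (if Rlt_dec y L then 1 else 0)))); auto.
  { intros x y _ _. unfold indD2. repeat destruct Rle_dec; repeat destruct Rlt_dec; ring. }
  apply Rintable_mult; auto; [apply Rintable_mult; auto|apply Rintable_minus; auto].
  - apply (Rintable_ind_x (fun x => 0 <= x)); auto. left; intros; lra.
  - apply (Rintable_ind_y (fun x => 0 <= x)); auto. left; intros; lra.
  - apply Rintable_const; auto.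
  - apply Rintable_mult; auto; apply Rintable_mult; auto.
    + apply (Rintable_ind_x (fun x => 0 < x)); auto. left; intros; lra.
    + apply (Rintable_ind_x (fun x => x < L) (fun x => Rlt_dec x _)); auto. right; intros; lra.
    + apply (Rintable_ind_y (fun x => 0 < x)); auto. left; intros; lra.
    + apply (Rintable_ind_y (fun x => x < L) (fun x => Rlt_dec x _)); auto. right; intros; lra.
Qed.

Lemma loc_int_kernel cx cy f p g : p <= 0 ->
  (forall a b c d, a < b -> c < d -> Rintable f a b c d) ->
  (forall x y, g x y = f x y * Rpower (dist2 x y cx cy) p) -> loc_int cx cy g.
Proof.
  intros Hp Hf E r Rr Hr HR.
  apply Rintable_ext with (cut r cx cy (fun x y => f x y * Rpower (dist2 x y cx cy) p)); try lra.
  { intros; unfold cut; destruct Rlt_dec; auto. }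
  apply Rintable_cut_mult; try lra.
  - apply Hf; lra.
  - apply (Rintable_cut_radial (fun s => Rpower s p)); try lra. intros; apply Rpower_anti; auto.
Qed.

Lemma omega_om al xi eta : omega al 2 xi eta = om al xi eta.
Proof. unfold omega, om. f_equal; ring. Qed.

Lemma Rpower_m2 s : 0 < s -> Rpower s (- (2)) = / (s * s).
Proof.
  intros Hs. rewrite Rpower_Ropp. f_equal. replace 2 with (1 + 1) by ring.
  rewrite Rpower_plus, Rpower_1; auto.
Qed.

Definition frac_int (al : R) (u : R -> R -> R) (x y x' y' : R) : R :=
  (u x y - u x' y') / Rpower (dist2 x y x' y') (2 + al).

Definition cell_int (al h : R) (i j : nat) (xi eta : R) : R := indI h i j xi eta * omega al 2 xi eta.

Definition ext_int (al L xi eta : R) : R := indD2 L xi eta * Rpower (norm2 xi eta) (- (2 + al)).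

Lemma dist2_sym x y x' y' : dist2 x y x' y' = dist2 x' y' x y.
Proof.
  unfold dist2. rewrite <- norm2_opp_l, <- norm2_opp_r. f_equal; ring.
Qed.

Lemma loc_int_frac al u x y : 0 < al -> loc_lipschitz u -> loc_int x y (frac_int al u x y).
Proof.
  intros Hal Hu. apply (loc_int_kernel x y (fun x' y' => u x y - u x' y') (- (2 + al))); [lra| |].
  - intros. apply Rintable_minus; auto.
    + apply Rintable_const; auto.
    + apply Rintable_of_lipschitz; auto.
  - intros x' y'. unfold frac_int, Rdiv. rewrite Rpower_Ropp, dist2_sym. reflexivity.
Qed.

Lemma loc_int_cell al h i j : 0 < al -> loc_int 0 0 (cell_int al h i j).
Proof.
  intros Hal. apply (loc_int_kernel 0 0 (indI h i j) (- al)); [lra| |].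
  - intros; apply Rintable_indI; auto.
  - intros. unfold cell_int. rewrite omega_om. unfold om, dist2. rewrite !Rminus_0_r. reflexivity.
Qed.

Lemma loc_int_ext al L : 0 < al -> loc_int 0 0 (ext_int al L).
Proof.
  intros Hal. apply (loc_int_kernel 0 0 (indD2 L) (- (2 + al))); [lra| |].
  - intros; apply Rintable_indD2; auto.
  - intros. unfold ext_int, dist2. rewrite !Rminus_0_r. reflexivity.
Qed.

Lemma quad_frac al u x y xi eta :
  quad (frac_int al u x y) x y xi eta
  = - (quad u x y xi eta - 4 * u x y) * Rpower (norm2 xi eta) (- (2 + al)).
Proof.
  unfold quad, frac_int, dist2, Rdiv. rewrite Rpower_Ropp.
  replace (x - (x + xi)) with (- xi) by ring. replace (x - (x - xi)) with xi by ring.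
  replace (y - (y + eta)) with (- eta) by ring. replace (y - (y - eta)) with eta by ring.
  rewrite !norm2_opp_l, !norm2_opp_r. ring.
Qed.

Lemma indI_neg_l h i j xi eta : 0 <= h -> xi < 0 -> indI h i j xi eta = 0.
Proof.
  intros Hh Hx. unfold indI. pose proof (pos_INR i).
  destruct Rle_dec as [H1|]; auto. exfalso. nra.
Qed.

Lemma indI_neg_r h i j xi eta : 0 <= h -> eta < 0 -> indI h i j xi eta = 0.
Proof.
  intros Hh Hx. unfold indI. pose proof (pos_INR j).
  destruct Rle_dec as [H1|]; auto. destruct Rle_dec as [H2|]; auto.
  destruct Rle_dec as [H3|]; auto. exfalso. nra.
Qed.

(** Only one of the four reflected points lies in the closed first quadrant, so folding leaves
    quadrant integrals unchanged although [integral2] runs over the plane. *)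
Lemma quad_cell al h i j xi eta : 0 <= h -> 0 < xi -> 0 < eta ->
  quad (cell_int al h i j) 0 0 xi eta = indI h i j xi eta * om al xi eta.
Proof.
  intros Hh Hx Hy. unfold quad, cell_int.
  rewrite (indI_neg_r h i j (0 + xi) (0 - eta)), (indI_neg_l h i j (0 - xi) (0 + eta)),
    (indI_neg_l h i j (0 - xi) (0 - eta)) by lra.
  rewrite !Rplus_0_l, omega_om. ring.
Qed.

Lemma quad_ext al L xi eta : 0 < xi -> 0 < eta ->
  quad (ext_int al L) 0 0 xi eta = indD2 L xi eta * Rpower (norm2 xi eta) (- (2 + al)).
Proof.
  intros Hx Hy. unfold quad, ext_int, indD2. rewrite !Rplus_0_l.
  destruct (Rle_dec 0 (0 - xi)); [lra|]. destruct (Rle_dec 0 (0 - eta)); [lra|].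
  destruct (Rle_dec 0 xi); ring.
Qed.

(** [L] is at least each side of the rectangle, so a shift by [L] or more in one coordinate leads
    out of it from any interior point. *)
Lemma quad_vanish ax bx ay by_ u L x y xi eta :
  (forall x y, ~ (ax < x < bx /\ ay < y < by_) -> u x y = 0) ->
  bx - ax <= L -> by_ - ay <= L -> ax < x < bx -> ay < y < by_ ->
  L <= xi \/ L <= eta -> quad u x y xi eta = 0.
Proof.
  intros Hu H1 H2 Hx Hy H. unfold quad. rewrite !Hu; [ring| | | |]; intros [h1 h2]; lra.
Qed.

(** [2 A xi^2 + 2 B eta^2] equals [(A + B)(xi^2 + eta^2) + (A - B)(xi^2 - eta^2)], which after
    division is the split into a constant and an antisymmetric quotient. *)
Lemma taylor_rem_quot u uxx uyy x y xi eta : (xi, eta) <> (0, 0) ->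
  quad u x y xi eta - 4 * u x y
  = (xi * xi + eta * eta) *
    (quot (taylor_rem u uxx uyy x y) xi eta
     + (uxx x y + uyy x y)
     + (uxx x y - uyy x y) * ((xi * xi - eta * eta) / (xi * xi + eta * eta))).
Proof.
  intros NE. pose proof (norm2_pos _ _ NE) as P. pose proof (norm2_sqr xi eta).
  assert (0 < xi * xi + eta * eta) by nra.
  unfold quot, taylor_rem. field. lra.
Qed.

Lemma Rpower_kappa al xi eta : (xi, eta) <> (0, 0) ->
  (xi * xi + eta * eta) * Rpower (norm2 xi eta) (- (2 + al)) = om al xi eta.
Proof.
  intros NE. pose proof (norm2_pos _ _ NE) as P. unfold om.
  replace (- (2 + al)) with (- (2) + - al) by ring. rewrite Rpower_plus, Rpower_m2 by auto.
  rewrite <- norm2_sqr. field. lra.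
Qed.

(** * Convergence of the three integrals *)

Lemma frac_int_ex al eps K ax bx ay by_ u ux uy uxx uxy uyy L x y : 0 < al < 2 -> 0 < eps ->
  0 <= K -> loc_lipschitz u -> sym_C2 K (al + eps) u ux uy uxx uxy uyy ->
  (forall x y, ~ (ax < x < bx /\ ay < y < by_) -> u x y = 0) ->
  bx - ax <= L -> by_ - ay <= L -> ax < x < bx -> ay < y < by_ ->
  exists v, integral2_val x y (frac_int al u x y) v.
Proof.
  intros Hal Heps HK Hlip HC Hu HL1 HL2 Hx Hy.
  (* The minimum meets the conditions of both [ker_near] and [ker_far]. *)
  set (a := Rmin (al / 2) (1 - al / 2)).
  assert (Ha : 0 < a < 1 /\ a <= al / 2 /\ a <= 1 - al / 2).
  { unfold a, Rmin. destruct Rle_dec; lra. }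
  destruct Ha as [Ha [Ha1 Ha2]]. assert (PL : 0 < L) by lra.
  destruct (ker_near al a (2 * L) Ha Ha2 ltac:(lra)) as [C1 [P1 K1]].
  destruct (ker_far al a L Ha Ha1 PL) as [C2 [P2 K2]].
  pose proof (taylor_rem_small K _ _ _ _ _ _ _ x y HC) as HG.
  set (G := taylor_rem u uxx uyy x y) in *.
  (* Bounds the folded difference divided by [|xi|^2] for [|xi| <= 2 L]. It varies with the centre,
     which is harmless for mere existence. *)
  set (W0 := 4 * K * Rpower (2 * L) (al + eps) + (Rabs (uxx x y + uyy x y) + Rabs (uxx x y - uyy x y))).
  assert (PW : 0 <= W0).
  { unfold W0. pose proof (Rpower_pos (2 * L) (al + eps)).
    pose proof (Rabs_pos (uxx x y + uyy x y)). pose proof (Rabs_pos (uxx x y - uyy x y)). nra. }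
  apply (integral2_dominated_ex x y _ (ker a) (W0 * C1 + 4 * Rabs (u x y) * C2) (4 * (/ a * / a))).
  - apply loc_int_frac; auto; lra.
  - pose proof (Rabs_pos (u x y)). nra.
  - intros; apply ker_nonneg.
  - intros; apply ker_anti; auto.
  - intros; apply ker_trunc_le; auto.
  - intros xi eta Hxi Heta. rewrite quad_frac.
    assert (NE : (xi, eta) <> (0, 0)) by (intros E; injection E; lra).
    pose proof (norm2_pos _ _ NE) as P. pose proof (ker_nonneg a (norm2 xi eta)) as Pk.
    pose proof (Rabs_pos (u x y)) as Pu.
    destruct (Rle_dec (norm2 xi eta) (2 * L)) as [Hn|Hn].
    + apply Rle_trans with (W0 * C1 * ker a (norm2 xi eta)).
      2:{ apply Rmult_le_compat_r; nra. }
      rewrite (taylor_rem_quot u uxx uyy x y xi eta NE). fold G.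
      rewrite Ropp_mult_distr_r, (Rmult_comm (xi * xi + eta * eta)), Rmult_assoc, Rpower_kappa by auto.
      rewrite Rmult_assoc. apply Rabs_mult_le.
      * rewrite Rabs_Ropp, Rplus_assoc. unfold W0. apply Rabs_plus_le; [|apply Rabs_plus_le; [lra|]].
        -- apply Rle_trans with (2 * (2 * K) * Rpower (norm2 xi eta) (al + eps)).
           ++ apply small_C2_quot; auto; lra.
           ++ replace (2 * (2 * K)) with (4 * K) by ring. apply Rmult_le_compat_l; [lra|].
              apply Rle_Rpower_l; lra.
        -- rewrite <- (Rmult_1_r (Rabs (uxx x y - uyy x y))). apply Rabs_mult_le; [lra|].
           assert (0 < xi * xi + eta * eta) by nra.
           unfold Rdiv. rewrite Rabs_mult, (Rabs_right (/ _)).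
           2:{ apply Rle_ge; left; apply Rinv_0_lt_compat; auto. }
           apply Rmult_le_reg_r with (xi * xi + eta * eta); auto.
           rewrite Rmult_assoc, Rinv_l by lra. rewrite Rmult_1_r, Rmult_1_l. apply Rabs_le; nra.
      * unfold om. pose proof (Rpower_pos (norm2 xi eta) (- al)). rewrite Rabs_right by lra.
        apply K1; lra.
    (* The norm is at most the sum of the coordinates, so a norm above [2 L] forces one of them to
       reach [L]; there the folded [u] vanishes and only [- 4 u x y] remains. *)
    + assert (HLL : L <= xi \/ L <= eta).
      { pose proof (norm2_le_sum xi eta ltac:(lra) ltac:(lra)). lra. }
      rewrite (quad_vanish ax bx ay by_ u L) by auto.
      apply Rle_trans with (4 * Rabs (u x y) * (C2 * ker a (norm2 xi eta))).
      * apply Rabs_mult_le.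
        -- replace (- (0 - 4 * u x y)) with (4 * u x y) by ring.
           rewrite Rabs_mult, (Rabs_right 4) by lra. lra.
        -- pose proof (Rpower_pos (norm2 xi eta) (- (2 + al))). rewrite Rabs_right by lra.
           apply K2; lra.
      * assert (0 <= W0 * C1 * ker a (norm2 xi eta)) by (apply Rmult_le_pos; nra). nra.
Qed.

Lemma cell_int_ex al h i j : 0 < al < 2 -> 0 < h -> exists v, integral2_val 0 0 (cell_int al h i j) v.
Proof.
  intros Hal Hh. set (a := Rmin (al / 2) (1 - al / 2)).
  assert (Ha : 0 < a < 1 /\ a <= 1 - al / 2) by (unfold a, Rmin; destruct Rle_dec; lra).
  destruct Ha as [Ha Ha2].
  assert (PM : 0 < INR (S i) * h + INR (S j) * h).
  { pose proof (lt_0_INR (S i) ltac:(lia)). pose proof (lt_0_INR (S j) ltac:(lia)). nra. }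
  destruct (ker_near al a _ Ha Ha2 PM) as [C1 [P1 K1]].
  apply (integral2_dominated_ex 0 0 _ (ker a) C1 (4 * (/ a * / a))); auto.
  - apply loc_int_cell; lra.
  - intros; apply ker_nonneg.
  - intros; apply ker_anti; auto.
  - intros; apply ker_trunc_le; auto.
  - intros xi eta Hxi Heta. rewrite quad_cell by lra.
    pose proof (ker_nonneg a (norm2 xi eta)) as Pk.
    assert (P : 0 < norm2 xi eta) by (apply norm2_pos; intros E; injection E; lra).
    unfold indI. repeat destruct Rle_dec; rewrite ?Rmult_0_l, ?Rabs_R0; try nra.
    rewrite Rmult_1_l. unfold om. pose proof (Rpower_pos (norm2 xi eta) (- al)).
    rewrite Rabs_right by lra. apply K1. split; auto.
    eapply Rle_trans; [apply norm2_le_sum; lra|lra].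
Qed.

Lemma ext_int_ex al L : 0 < al < 2 -> 0 < L -> exists v, integral2_val 0 0 (ext_int al L) v.
Proof.
  intros Hal HL. set (a := Rmin (al / 2) (1 - al / 2)).
  assert (Ha : 0 < a < 1 /\ a <= al / 2) by (unfold a, Rmin; destruct Rle_dec; lra).
  destruct Ha as [Ha Ha1].
  destruct (ker_far al a _ Ha Ha1 HL) as [C1 [P1 K1]].
  apply (integral2_dominated_ex 0 0 _ (ker a) C1 (4 * (/ a * / a))); auto.
  - apply loc_int_ext; lra.
  - intros; apply ker_nonneg.
  - intros; apply ker_anti; auto.
  - intros; apply ker_trunc_le; auto.
  - intros xi eta Hxi Heta. rewrite quad_ext by lra.
    pose proof (ker_nonneg a (norm2 xi eta)) as Pk.
    pose proof (Rpower_pos (norm2 xi eta) (- (2 + al))) as Pr.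
    (* At positive coordinates, lying outside [(0, L)^2] means that one coordinate reaches [L], so
       [ker_far] applies. *)
    assert (E : indD2 L xi eta = 0 \/ indD2 L xi eta = 1 /\ (L <= xi \/ L <= eta)).
    { unfold indD2. repeat destruct Rle_dec; repeat destruct Rlt_dec; auto; right; split; auto; lra. }
    destruct E as [-> | [-> HLL]].
    + rewrite Rmult_0_l, Rabs_R0. nra.
    + rewrite Rmult_1_l, Rabs_right by lra. apply K1.
      pose proof (norm2_ge_l xi eta). pose proof (norm2_ge_r xi eta). lra.
Qed.

(** * Reduction of both operators to the quadrature error *)

Lemma dsum_restrict n n' F : (n <= n')%nat ->
  (forall i j, (n <= i \/ n <= j)%nat -> F i j = 0) -> dsum n' F = dsum n F.
Proof.
  intros Hn HF. replace n' with (n + (n' - n))%nat by lia. unfold dsum. rewrite sumR_app.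
  rewrite (sumR_ext (n' - n) _ (fun _ => 0)), sumR_const.
  - rewrite Rmult_0_r, Rplus_0_r. apply sumR_ext; intros i Hi. rewrite sumR_app.
    rewrite (sumR_ext (n' - n) _ (fun _ => 0)), sumR_const; [ring|]. intros; apply HF; lia.
  - intros i Hi. rewrite (sumR_ext _ _ (fun _ => 0)), sumR_const; [ring|]. intros; apply HF; lia.
Qed.

(** A plain quotient in place of the power in [psi 2]. The two agree away from the origin, and every
    vertex sampled with a nonzero weight differs from the origin. *)
Definition psi_quot (u : R -> R -> R) (x y xi eta : R) : R :=
  (quad u x y xi eta - 4 * u x y) / (xi * xi + eta * eta).

Lemma psi_psi_quot u x y xi eta : (xi, eta) <> (0, 0) -> psi 2 u x y xi eta = psi_quot u x y xi eta.
Proof.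
  intros NE. pose proof (norm2_pos _ _ NE) as P. unfold psi, psi_quot, quad.
  rewrite Rpower_m2 by auto. rewrite <- norm2_sqr. field. lra.
Qed.

(** The separate corner term becomes the [(0, 0)] entry of one double sum: the weights 2, 2, 0
    divided by 4 are the first branch of [vertex_avg]. *)
Lemma disc_frac_lap_eq al ax bx ay by_ N u x y : (0 < N)%nat -> ax < bx ->
  let L := Rmax (bx - ax) (by_ - ay) in
  let h := L / INR N in
  disc_frac_lap al 2 ax bx ay by_ N u x y
  = - c2 al * (dsum N (fun i j => vertex_avg h (psi_quot u x y) i j * integral2 0 0 (cell_int al h i j))
               - 4 * u x y * integral2 0 0 (ext_int al L)).
Proof.
  intros HN Hab L h. unfold disc_frac_lap. fold L. fold h. cbv zeta.
  assert (PL : 0 < L) by (unfold L; eapply Rlt_le_trans; [|apply Rmax_l]; lra).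
  assert (Ph : 0 < h) by (apply Rdiv_lt_0_compat; auto; apply lt_0_INR; lia).
  fold (ext_int al L). f_equal. f_equal.
  assert (Hpos : forall i j, (i, j) <> (0%nat, 0%nat) ->
    psi 2 u x y (INR i * h) (INR j * h) = psi_quot u x y (INR i * h) (INR j * h)).
  { intros i j NE. apply psi_psi_quot. intros E; injection E as E1 E2. apply NE.
    apply Rmult_integral in E1, E2.
    destruct E1 as [E1|E1]; [|lra]. destruct E2 as [E2|E2]; [|lra].
    f_equal; apply INR_eq; auto. }
  match goal with |- _ + / 4 * ?s = _ =>
    change s with (dsum N (fun i j => if (Nat.eqb i 0 && Nat.eqb j 0)%bool then 0
      else (psi 2 u x y (INR i * h) (INR j * h) + psi 2 u x y (INR (S i) * h) (INR j * h)
          + psi 2 u x y (INR i * h) (INR (S j) * h) + psi 2 u x y (INR (S i) * h) (INR (S j) * h))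
          * integral2 0 0 (cell_int al h i j))) end.
  change (integral2 0 0 (fun xi eta => indI h 0 0 xi eta * omega al 2 xi eta))
    with (integral2 0 0 (cell_int al h 0 0)).
  rewrite <- dsum_scal.
  match goal with |- ?A + _ = _ => replace A with (dsum N (fun i j =>
    if (Nat.eqb i 0 && Nat.eqb j 0)%bool then A else 0)) end.
  2:{ rewrite (dsum_single N _ 0%nat 0%nat); auto.
      intros i j _ _ NE. destruct i, j; simpl; auto. congruence. }
  rewrite <- dsum_plus. apply dsum_ext; intros i j _ _. unfold vertex_avg.
  destruct (Nat.eqb i 0 && Nat.eqb j 0)%bool eqn:E.
  - apply andb_prop in E. destruct E as [E1 E2]. apply Nat.eqb_eq in E1, E2. subst.
    rewrite !(Hpos 1%nat), !(Hpos 0%nat 1%nat) by congruence.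
    unfold cgam. destruct Req_EM_T; [|lra]. simpl INR. rewrite Rmult_1_l, Rmult_0_l. field.
  - rewrite !(Hpos (S i)), !(Hpos i (S j)), (Hpos i j) by (try congruence;
      intros E'; injection E' as -> ->; simpl in E; discriminate).
    ring.
Qed.

(** The cells are closed and share edges, so the offsets have to be strictly interior for exactly
    one indicator to be 1. *)
Lemma indI_mid h i j i' j' a b : 0 < h -> 0 < a < h -> 0 < b < h ->
  indI h i j (INR i' * h + a) (INR j' * h + b)
  = if (Nat.eqb i i' && Nat.eqb j j')%bool then 1 else 0.
Proof.
  intros Hh Ha Hb.
  assert (H : forall i i' a, 0 < a < h -> INR i * h <= INR i' * h + a -> INR i' * h + a <= INR (S i) * h -> i = i').
  { clear - Hh. intros i i' a Ha H1 H2. rewrite S_INR in H2.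
    assert (INR i < INR (S i')) by (rewrite S_INR; nra).
    assert (INR i' < INR (S i)) by (rewrite S_INR; nra).
    apply INR_lt in H, H0. lia. }
  destruct (Nat.eqb_spec i i') as [->|Ni]; [destruct (Nat.eqb_spec j j') as [->|Nj]|]; cbn [andb].
  - unfold indI. rewrite !S_INR. repeat destruct Rle_dec; auto; exfalso; nra.
  - unfold indI. repeat destruct Rle_dec; auto. exfalso; apply Nj, (H j j' b); auto.
  - unfold indI. repeat destruct Rle_dec; auto. exfalso; apply Ni, (H i i' a); auto.
Qed.

Lemma indI_outside h i j xi eta N : 0 < h -> (i < N)%nat -> (j < N)%nat ->
  INR N * h < xi \/ INR N * h < eta -> indI h i j xi eta = 0.
Proof.
  intros Hh Hi Hj H. unfold indI.
  assert (INR (S i) <= INR N) by (apply le_INR; lia).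
  assert (INR (S j) <= INR N) by (apply le_INR; lia).
  repeat destruct Rle_dec; auto. exfalso. nra.
Qed.

(** The constant passes through because the weights of each average add up to 1, in the corner cell
    as well; this makes the quadrature exact on constants. *)
Lemma vertex_avg_lin h g1 g2 g3 c i j : 0 < h ->
  (forall x y, (x, y) <> (0, 0) -> g1 x y = g2 x y + c + g3 x y) ->
  vertex_avg h g1 i j = vertex_avg h g2 i j + c + vertex_avg h g3 i j.
Proof.
  intros Hh Hg. unfold vertex_avg.
  assert (H : forall i j, (i, j) <> (0%nat, 0%nat) ->
    g1 (INR i * h) (INR j * h) = g2 (INR i * h) (INR j * h) + c + g3 (INR i * h) (INR j * h)).
  { clear - Hh Hg. intros i j NE. apply Hg. intros E; injection E as E1 E2. apply NE.
    apply Rmult_integral in E1, E2.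
    destruct E1 as [E1|E1]; [|lra]. destruct E2 as [E2|E2]; [|lra].
    f_equal; apply INR_eq; auto. }
  destruct (Nat.eqb i 0 && Nat.eqb j 0)%bool eqn:E.
  - pose proof (H 1%nat 0%nat ltac:(congruence)) as V1. pose proof (H 0%nat 1%nat ltac:(congruence)) as V2.
    simpl INR in V1, V2. rewrite Rmult_1_l, Rmult_0_l in V1, V2. rewrite V1, V2. field.
  - rewrite !(H (S i)), !(H i (S j)), (H i j) by (try congruence;
      intros E'; injection E' as -> ->; simpl in E; discriminate). field.
Qed.


(* Outside [(0, L)^2] the three integrands cancel, and inside each midpoint lies in the
   interior of exactly one cell. *)
Lemma midsum_quad_error al ax bx ay by_ u L N x y t m : 0 < al < 2 ->
  (forall x y, ~ (ax < x < bx /\ ay < y < by_) -> u x y = 0) ->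
  0 < L -> bx - ax <= L -> by_ - ay <= L -> ax < x < bx -> ay < y < by_ ->
  (0 < N)%nat -> (0 < m)%nat ->
  let h := L / INR N in
  midsum L N (quad (frac_int al u x y) x y) t m
    + 1 * dsum N (fun i j => vertex_avg h (psi_quot u x y) i j
                             * midsum L N (quad (cell_int al h i j) 0 0) t m)
    + (- 4 * u x y) * midsum L N (quad (ext_int al L) 0 0) t m
  = quad_error al h (h / INR (S t)) N m (psi_quot u x y).
Proof.
  intros Hal Hu PL HL1 HL2 Hx Hy HN Hm h.
  assert (PN : 0 < INR N) by (apply lt_0_INR; lia).
  assert (Pm : 0 < INR m) by (apply lt_0_INR; lia).
  assert (Ph : 0 < h) by (apply Rdiv_lt_0_compat; auto).
  assert (ENh : INR N * h = L) by (unfold h; field; lra).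
  set (r := h / INR (S t)). set (w := h / INR m). assert (Pw : 0 < w) by (apply Rdiv_lt_0_compat; auto).
  assert (Emw : INR m * w = h) by (unfold w; field; lra).
  set (n' := (S t * (N * m))%nat). set (T := fun k : nat => (INR k + / 2) * w).
  set (Q := vertex_avg h (psi_quot u x y)).
  set (F := fun k l => qcut r (quad (frac_int al u x y) x y) (T k) (T l)
     + dsum N (fun i j => Q i j * qcut r (quad (cell_int al h i j) 0 0) (T k) (T l))
     + (- 4 * u x y) * qcut r (quad (ext_int al L) 0 0) (T k) (T l)).
  assert (EM : forall g, midsum L N g t m = dsum n' (fun k l => qcut r g (T k) (T l)) * w * w).
  { intros g. unfold midsum, qsum.
    replace (L / INR (N * m)) with w by (rewrite mult_INR; unfold w, h; field; lra). reflexivity. }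
  transitivity (dsum n' F * w * w).
  { rewrite !EM. rewrite (dsum_ext N _ (fun i j => Q i j * (dsum n' (fun k l =>
        qcut r (quad (cell_int al h i j) 0 0) (T k) (T l)) * w * w)))
      by (intros; rewrite EM; reflexivity).
    unfold F. rewrite !dsum_plus, dsum_scal.
    rewrite (dsum_swap_dsum n' N (fun k l i j => Q i j * qcut r (quad (cell_int al h i j) 0 0) (T k) (T l))).
    rewrite (dsum_ext N (fun i j => Q i j * (dsum n' (fun k l =>
        qcut r (quad (cell_int al h i j) 0 0) (T k) (T l)) * w * w))
      (fun i j => (w * w) * dsum n' (fun k l => Q i j * qcut r (quad (cell_int al h i j) 0 0) (T k) (T l)))).
    - rewrite dsum_scal. ring.
    - intros i j _ _. rewrite dsum_scal. ring. }
  unfold quad_error. fold w. do 2 f_equal.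
  assert (HT : forall k, 0 < T k).
  { intros; unfold T. pose proof (pos_INR k). nra. }
  assert (HNE : forall k l, (T k, T l) <> (0, 0)).
  { intros k l E; injection E as E1 E2. pose proof (HT k). lra. }
  rewrite (dsum_restrict (N * m) n' F).
  - rewrite dsum_mul. apply dsum_ext; intros i j Hi Hj. apply dsum_ext; intros p q Hp Hq.
    cbv zeta. fold (T (i * m + p)%nat) (T (j * m + q)%nat). unfold F.
    set (xi := T (i * m + p)%nat). set (eta := T (j * m + q)%nat).
    assert (NE : (xi, eta) <> (0, 0)) by apply HNE.
    assert (Pxi : 0 < xi) by apply HT. assert (Peta : 0 < eta) by apply HT.
    assert (HM : forall i p, (p < m)%nat ->
       T (i * m + p)%nat = INR i * h + (INR p + / 2) * w /\ 0 < (INR p + / 2) * w < h).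
    { clear - Pw Emw. intros i p Hp. unfold T. rewrite plus_INR, mult_INR. pose proof (pos_INR p).
      assert (INR p + 1 <= INR m) by (rewrite <- S_INR; apply le_INR; lia).
      split; [rewrite <- Emw; ring|nra]. }
    destruct (HM i p Hp) as [E1 I1]. destruct (HM j q Hq) as [E2 I2].
    unfold qcut. destruct (Rlt_dec r (norm2 xi eta)).
    2:{ rewrite (dsum_ext N _ (fun _ _ => 0)), dsum_const by (intros; ring). ring. }
    rewrite (dsum_single N _ i j Hi Hj).
    (* Inside the square the exterior term is absent, one cell survives with its average [Q i j],
       and the folded integrand is [- psi_quot] times [om]: together [om] times
       [Q i j - psi_quot]. *)
    + rewrite quad_frac, quad_cell, quad_ext by lra.
      replace (indI h i j xi eta) with 1.
      2:{ unfold xi, eta. rewrite E1, E2, indI_mid by auto. rewrite !Nat.eqb_refl. reflexivity. }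
      assert (Hlt : forall i p, (i < N)%nat -> (p < m)%nat -> T (i * m + p)%nat < L).
      { clear - HM ENh Ph. intros i p Hi Hp. destruct (HM i p Hp) as [E I]. rewrite E, <- ENh.
        assert (INR i + 1 <= INR N) by (rewrite <- S_INR; apply le_INR; lia). nra. }
      pose proof (Hlt i p Hi Hp) as L1. pose proof (Hlt j q Hj Hq) as L2. fold xi in L1. fold eta in L2.
      replace (indD2 L xi eta) with 0.
      2:{ unfold indD2. repeat destruct Rle_dec; repeat destruct Rlt_dec; lra. }
      rewrite <- (Rpower_kappa al xi eta NE). fold Q. unfold psi_quot.
      pose proof (norm2_pos _ _ NE). pose proof (norm2_sqr xi eta).
      assert (0 < xi * xi + eta * eta) by nra. field. lra.
    + intros i' j' Hi' Hj' NEij. rewrite quad_cell by lra.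
      unfold xi, eta. rewrite E1, E2, indI_mid by auto.
      destruct (Nat.eqb_spec i' i) as [->|]; [destruct (Nat.eqb_spec j' j) as [->|]|];
        cbn [andb]; try congruence; ring.
  - unfold n'. simpl. lia.
  (* Beyond the square the folded integrand is [4 u x y] times the kernel, every cell indicator is
     0, and the exterior term subtracts the same amount. *)
  - intros k l Hkl. unfold F.
    assert (Hbig : forall k, (N * m <= k)%nat -> L < T k).
    { clear - Emw ENh Pw. intros k Hk. apply le_INR in Hk. rewrite mult_INR in Hk.
      unfold T. rewrite <- ENh, <- Emw. nra. }
    assert (HLT : L < T k \/ L < T l) by (destruct Hkl; [left|right]; auto).
    pose proof (HT k) as Pk. pose proof (HT l) as Pl.
    unfold qcut. destruct (Rlt_dec r (norm2 (T k) (T l))).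
    2:{ rewrite (dsum_ext N _ (fun _ _ => 0)), dsum_const by (intros; ring). ring. }
    rewrite (dsum_ext N _ (fun _ _ => 0)), dsum_const.
    2:{ intros i j Hi Hj. rewrite quad_cell by lra.
        rewrite (indI_outside h i j _ _ N) by (auto; lra). ring. }
    rewrite quad_frac, quad_ext by lra.
    rewrite (quad_vanish ax bx ay by_ u L) by (auto; lra).
    replace (indD2 L (T k) (T l)) with 1; [ring|].
    unfold indD2. repeat destruct Rle_dec; repeat destruct Rlt_dec; lra.
Qed.

(** The constant [u_xx + u_yy] cancels between average and value, and the rest of the quadratic part
    is antisymmetric. The second derivatives at the centre thus leave no trace in the error, and no
    bound on them over the rectangle enters the final constant. *)
Lemma quad_error_psi al h r N m u uxx uyy x y : 0 < h -> (0 < m)%nat ->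
  quad_error al h r N m (psi_quot u x y)
  = quad_error al h r N m (quot (taylor_rem u uxx uyy x y)).
Proof.
  intros Ph Hm.
  assert (Pw : 0 < h / INR m) by (apply Rdiv_lt_0_compat; auto; apply lt_0_INR; lia).
  set (G := taylor_rem u uxx uyy x y). set (c := uxx x y + uyy x y).
  set (g3 := fun s t => (uxx x y - uyy x y) * ((s * s - t * t) / (s * s + t * t))).
  assert (Hg : forall s t, (s, t) <> (0, 0) -> psi_quot u x y s t = quot G s t + c + g3 s t).
  { intros s t NE. unfold psi_quot. rewrite (taylor_rem_quot u uxx uyy x y s t NE).
    pose proof (norm2_pos _ _ NE). pose proof (norm2_sqr s t).
    assert (0 < s * s + t * t) by nra. fold G c. unfold g3. field. lra. }
  assert (Z : quad_error al h r N m g3 = 0).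
  { apply quad_error_antisym. intros s t. unfold g3, Rdiv. rewrite (Rplus_comm (t * t)). ring. }
  rewrite <- (Rplus_0_r (quad_error al h r N m (quot G))), <- Z.
  unfold quad_error. rewrite <- !Rmult_plus_distr_r, <- dsum_plus. do 2 f_equal.
  apply dsum_ext; intros i j _ _. rewrite <- dsum_plus.
  apply dsum_ext; intros p q _ _. cbv zeta.
  rewrite (vertex_avg_lin h _ (quot G) g3 c i j Ph Hg).
  rewrite Hg; [ring|]. intros E; injection E as E1 E2. pose proof (pos_INR (i * m + p)). nra.
Qed.

Theorem theorem2 :
  forall (alpha ax bx ay by_ eps : R) (u : R -> R -> R),
    0 < alpha < 2 ->
    ax < bx -> ay < by_ ->
    (forall x y, ~ (ax < x < bx /\ ay < y < by_) -> u x y = 0) ->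
    0 < eps <= 1 + IZR (floorR alpha) - alpha ->
    Holder2 (Z.to_nat (2 + floorR alpha)) (alpha - IZR (floorR alpha) + eps) u ->
    exists C, 0 < C /\ exists N0 : nat, forall N : nat, (N0 <= N)%nat -> (0 < N)%nat ->
      forall x y, ax < x < bx -> ay < y < by_ ->
        Rabs (frac_lap alpha u x y - disc_frac_lap alpha 2 ax bx ay by_ N u x y)
          <= C * (Rmax (bx - ax) (by_ - ay) / INR N) ^ 2.
Proof.
  intros al ax bx ay by_ eps u Hal Hab Hcd Hu Heps HH.
  destruct (Holder2_sym_C2 al eps u Hal Heps HH)
    as [Hlip [K [ux [uy [uxx [uxy [uyy [HK HC]]]]]]]].
  set (L := Rmax (bx - ax) (by_ - ay)).
  assert (HL1 : bx - ax <= L) by apply Rmax_l. assert (HL2 : by_ - ay <= L) by apply Rmax_r.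
  assert (PL : 0 < L) by lra.
  assert (Heps2 : 0 < eps < 2).
  { destruct (floor_cases al Hal) as [[F _]|[F _]]; rewrite F in Heps; simpl in Heps; lra. }
  (* [2 * K] is the constant of [taylor_rem_small]. [C] is fixed before [N], [x] and [y]. *)
  destruct (quad_error_bound al eps (2 * K) L Hal Heps2 ltac:(lra) PL) as [C [PC HE]].
  (* The summand 1 ensures positivity, as [C] may be 0. *)
  exists (Rabs (c2 al) * C + 1). split; [pose proof (Rabs_pos (c2 al)); nra|].
  (* The estimate holds for every [N >= 1], with no smallness of [h]. *)
  exists O. intros N _ HN x y Hx Hy. set (h := L / INR N).
  assert (PN : 0 < INR N) by (apply lt_0_INR; lia).
  assert (Ph : 0 < h) by (apply Rdiv_lt_0_compat; auto).
  rewrite disc_frac_lap_eq by auto. cbv zeta. fold L. fold h.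
  unfold frac_lap. fold (frac_int al u x y).
  (* Up to the factor [c2 al] this is the difference of the two operators. The midpoint sums obey
     the bound for all [t] and [m], and it passes to the iterated limit. *)
  assert (HI : Rabs (integral2 x y (frac_int al u x y)
      + 1 * dsum N (fun i j => vertex_avg h (psi_quot u x y) i j * integral2 0 0 (cell_int al h i j))
      + (- 4 * u x y) * integral2 0 0 (ext_int al L)) <= C * (h * h)).
  { apply iter_lim_bound with (fun t m => midsum L N (quad (frac_int al u x y) x y) t m
      + 1 * dsum N (fun i j => vertex_avg h (psi_quot u x y) i j
                             * midsum L N (quad (cell_int al h i j) 0 0) t m)
      + (- 4 * u x y) * midsum L N (quad (ext_int al L) 0 0) t m).
    - apply (iter_lim_lin (fun t m => midsum L N (quad (frac_int al u x y) x y) t m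
         + 1 * dsum N (fun i j => vertex_avg h (psi_quot u x y) i j
                             * midsum L N (quad (cell_int al h i j) 0 0) t m))).
      + apply (iter_lim_lin (midsum L N (quad (frac_int al u x y) x y))
          (fun t m => dsum N (fun i j => vertex_avg h (psi_quot u x y) i j
                             * midsum L N (quad (cell_int al h i j) 0 0) t m))).
        * apply integral2_midsum; auto.
          -- apply loc_int_frac; auto; lra.
          -- apply (frac_int_ex al eps K ax bx ay by_ u ux uy uxx uxy uyy L); auto; lra.
        * apply (iter_lim_dsum N (fun i j => midsum L N (quad (cell_int al h i j) 0 0))).
          intros i j _ _. apply integral2_midsum; auto.
          -- apply loc_int_cell; lra.
          -- apply cell_int_ex; auto.
      + apply integral2_midsum; auto.
        * apply loc_int_ext; lra.
        * apply ext_int_ex; auto.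
    - intros t m Hm.
      pose proof (midsum_quad_error al ax bx ay by_ u L N x y t m Hal Hu PL HL1 HL2 Hx Hy HN Hm) as E.
      cbv zeta in E. fold h in E. rewrite E, (quad_error_psi al h _ N m u uxx uyy x y Ph Hm).
      apply HE; auto.
      + apply (taylor_rem_small K _ _ ux uy uxx uxy uyy); auto.
      + assert (Pt : 0 < INR (S t)) by (apply lt_0_INR; lia).
        assert (1 <= INR (S t)) by (rewrite S_INR; pose proof (pos_INR t); lra).
        split; [apply Rdiv_lt_0_compat; auto|].
        apply Rmult_le_reg_r with (INR (S t)); auto.
        unfold Rdiv. rewrite Rmult_assoc, Rinv_l by lra. nra. }
  match type of HI with Rabs ?X <= _ => match goal with |- Rabs ?Y <= _ =>
    replace Y with (c2 al * X) end end.
  - rewrite Rabs_mult. pose proof (Rabs_pos (c2 al)).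
    apply Rle_trans with (Rabs (c2 al) * (C * (h * h))); [apply Rmult_le_compat_l; auto|].
    assert (0 < h * h) by nra. simpl. rewrite Rmult_1_r. nra.
  - change (fun x' y' => (u x y - u x' y') / Rpower (dist2 x y x' y') (2 + al)) with (frac_int al u x y).
    ring.
Qed.
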